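(* Let $\Lambda$ be an Artin Gorenstein algebra with Jacobson radical $\mathfrak{r}$, and let $M$ be a finitely generated maximal Cohen-Macaulay left $\Lambda$-module. Suppose that $\operatorname{Ext}_{\Lambda}^*(M,\Lambda/\mathfrak{r})$ is eventually Noetherian of finite length over some graded-commutative ring $R$ acting centrally on $D^b(\Lambda)$, and let $r_1,\dots,r_c$ be a sequence of positive degree homogeneous elements of $R$ reducing the complexity of $M$ (as an object of $D^b(\Lambda)$), where $c=\operatorname{cx}_{\Lambda}M$. Then for any finitely generated left $\Lambda$-module $N$, the equivalences (i) $\Leftrightarrow$ (ii) and (iii) $\Leftrightarrow$ (iv) hold for the following statements: (i) There exists a number $n>\operatorname{id}\Lambda$ such that $\operatorname{Ext}_{\Lambda}^i(M,N)=0$ for $n\le i\le n+|r_1|+\cdots+|r_c|-c$. (ii) $\operatorname{Ext}_{\Lambda}^i(M,N)=0$ for all $i>\operatorname{id}\Lambda$. (iii) There exists a number $n>\operatorname{id}\Lambda$ such that $\operatorname{Ext}_{\Lambda}^i(N,M)=0$ for $n\le i\le n+|r_1|+\cdots+|r_c|-c$. (iv) $\operatorname{Ext}_{\Lambda}^i(N,M)=0$ for all $i>\operatorname{id}\Lambda$.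
   Context: Algebras and modules. An Artin algebra is a ring $\Lambda$ whose center $Z(\Lambda)$ is a commutative Artin ring over which $\Lambda$ is finitely generated as a module. $\Lambda$ is Gorenstein if its injective dimension both as a left and as a right module over itself is finite; $\operatorname{id}\Lambda$ denotes the injective dimension of $\Lambda$. A finitely generated left module $M$ is maximal Cohen-Macaulay if $\operatorname{Ext}_{\Lambda}^i(M,\Lambda)=0$ for all $i>0$. $D^b(\Lambda)$ is the bounded derived category of finitely generated left $\Lambda$-modules, with suspension $\Sigma$; for modules $M,N$, $\operatorname{Ext}_{\Lambda}^*(M,N)=\bigoplus_i\operatorname{Ext}^i_\Lambda(M,N)=\operatorname{Hom}_{D^b(\Lambda)}^*(M,N)$. The complexity $\operatorname{cx}_{\Lambda}M$ is the infimum of integers $t\ge0$ for which there is $a\in\mathbb{R}$ with $\ell_{Z(\Lambda)}(P_n)\le an^{t-1}$ for $n\gg0$, where $\cdots\to P_1\to P_0\to M\to0$ is the minimal projective resolution and $\ell$ denotes length. (When $\operatorname{Ext}_{\Lambda}^*(M,\Lambda/\mathfrak{r})$ is eventually Noetherian of finite length over $R$, so is $\operatorname{Ext}_\Lambda^*(M,M)$, and $\operatorname{cx}_{\Lambda}M=\operatorname{cx}_{D^b(\Lambda)}M$ as defined below.) Central actions (for a triangulated category $\mathcal{T}$; here $\mathcal{T}=D^b(\Lambda)$). Put $\operatorname{Hom}_{\mathcal{T}}^*(X,Y)=\bigoplus_{i\in\mathbb{Z}}\operatorname{Hom}_{\mathcal{T}}(X,\Sigma^iY)$. The graded center $Z^*(\mathcal{T})$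 has as its degree $n$ component the set of natural transformations $f:\operatorname{Id}\to\Sigma^n$ with $f_{\Sigma X}=(-1)^n\Sigma f_X$ for all $X$. A graded-commutative ring is a graded ring $R=\bigoplus_{i\ge 0}R_i$ with $r_1r_2=(-1)^{|r_1||r_2|}r_2r_1$ for homogeneous elements. $R$ acts centrally on $\mathcal{T}$ if there is a (given) graded ring homomorphism $R\to Z^*(\mathcal{T})$; it induces graded ring homomorphisms $\varphi_X:R\to\operatorname{Hom}_{\mathcal{T}}^*(X,X)$, and $\operatorname{Hom}_{\mathcal{T}}^*(X,Y)$ becomes an $R$-module via $\varphi_X$ or, equivalently up to sign, via $\varphi_Y$. $\operatorname{Hom}_{\mathcal{T}}^*(X,Y)$ is eventually Noetherian of finite length over $R$ if there is $n_0\in\mathbb{Z}$ such that the $R$-module $\bigoplus_{i\ge n_0}\operatorname{Hom}_{\mathcal{T}}(X,\Sigma^iY)$ is Noetherian and $\ell_{R_0}(\operatorname{Hom}_{\mathcal{T}}(X,\Sigma^nY))<\infty$ for every $n\ge n_0$. $\operatorname{cx}_{\mathcal{T}}X$ is the Krull dimension of $\operatorname{Hom}_{\mathcal{T}}^*(X,X)$ over $R^{\mathrm{ev}}=\bigoplus_{i\ge0}R_{2i}$; when $\operatorname{Hom}_{\mathcal{T}}^*(X,X)$ is eventually Noetherian of finite length this equals the infimum of integers $t\ge 0$ for which there is $a\in\mathbb{R}$ with $\ell_{R_0}(\operatorname{Hom}_{\mathcal{T}}(X,\Sigma^nX))\le an^{t-1}$ for $n\gg0$, and this is the value meant here. For homogeneous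 $r\in R$, the Koszul object $X/\!\!/r$ is defined (up to isomorphism) by a distinguished triangle $X\xrightarrow{\varphi_X(r)}\Sigma^{|r|}X\to X/\!\!/r\to\Sigma X$; inductively $X/\!\!/(r_1,\dots,r_i)=(X/\!\!/(r_1,\dots,r_{i-1}))/\!\!/r_i$. With $c=\operatorname{cx}_{\mathcal{T}}X$, a sequence $r_1,\dots,r_c$ of homogeneous elements of $R$ of positive degree reduces the complexity of $X$ if $\operatorname{cx}_{\mathcal{T}}X/\!\!/(r_1,\dots,r_i)=c-i$ for $1\le i\le c$ (for $c=0$ the sequence is empty). *)

(* Defs.v *)
From HB Require Import structures.
From mathcomp Require Import all_boot all_order all_algebra.
From mathcomp Require Import reals Rstruct.
From mathcomp Require Import zify.
Set Implicit Arguments.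
Unset Strict Implicit.
Unset Printing Implicit Defensive.
Import Order.TTheory GRing.Theory Num.Theory.
Local Open Scope ring_scope.

(** [sub] is the collection of "submodules" under consideration, each given as a
  predicate on a carrier [T].  [T] need not be a MathComp structure: below it
  is also a type of morphisms of the derived category, which is too large to
  carry one and whose equality is an equivalence relation. *)

Section Chains.
Variables (T : Type) (sub : (T -> Prop) -> Prop).

Definition artinian : Prop :=
  forall C : nat -> T -> Prop, (forall n, sub (C n)) ->
    (forall n x, C n.+1 x -> C n x) ->
  exists N, forall n, (N <= n)%N -> forall x, C N x -> C n x.

Definition noetherian : Prop :=
  forall C : nat -> T -> Prop, (forall n, sub (C n)) ->
    (forall n x, C n x -> C n.+1 x) ->
  exists N, forall n, (N <= n)%N -> forall x, C n x -> C N x.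

Definition strict_chain (l : nat) : Prop :=
  exists C : nat -> T -> Prop,
    (forall n, (n <= l)%N -> sub (C n)) /\
    (forall n, (n < l)%N -> (forall x, C n x -> C n.+1 x) /\
                            (exists x, C n.+1 x /\ ~ C n x)).

Definition has_length (l : nat) : Prop := strict_chain l /\ ~ strict_chain l.+1.

Definition finite_length : Prop := exists l, has_length l.

End Chains.

(** [growth L t]: a sequence of lengths ([L n l]: "the n-th length is l") is
  eventually bounded by [a * n ^ (t - 1)]. *)

Definition growth (L : nat -> nat -> Prop) (t : nat) : Prop :=
  exists (a : Rdefinitions.R) (N : nat), forall n, (N <= n)%N ->
    exists l, L n l /\ l%:R <= a * n%:R ^ (t%:Z - 1).

Definition growth_rate (L : nat -> nat -> Prop) (c : nat) : Prop :=
  growth L c /\ forall t, growth L t -> (c <= t)%N.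

(** [lmodType A] is the type of left [A]-modules, so right [A]-modules are
  [lmodType A^c], and [A^o], [(A^c)^o] are the left and right regular modules. *)

Section Modules.
Variable A : pzRingType.
Implicit Types V W : lmodType A.

Definition central (z : A) : Prop := forall x, z * x = x * z.

Definition submod_over (C : A -> Prop) V (S : V -> Prop) : Prop :=
  [/\ S 0,
      forall x y, S x -> S y -> S (x + y),
      forall x, S x -> S (- x) &
      forall a x, C a -> S x -> S (a *: x)].

Definition submod V : (V -> Prop) -> Prop := submod_over (fun _ => True) (V := V).

Definition fingen_over (C : A -> Prop) V : Prop :=
  exists s : seq V, forall x, exists c : nat -> A,
    (forall i, C (c i)) /\ x = \sum_(i < size s) c i *: s`_i.

Definition fingen V : Prop := fingen_over (fun _ => True) V.

Definition artin_algebra : Prop :=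
  artinian (fun I : A^o -> Prop =>
    submod_over central I /\ (forall x, I x -> central x)) /\
  fingen_over central A^o.

Definition maximal_left_ideal (I : A^o -> Prop) : Prop :=
  [/\ submod I, exists x, ~ I x &
      forall J : A^o -> Prop, submod J -> (forall x, I x -> J x) ->
        (forall x, J x -> I x) \/ (forall x, J x)].

Definition jacobson (x : A) : Prop := forall I, maximal_left_ideal I -> I x.

(** [p] exhibits [V] as the left module [A / rad A]. *)
Definition is_mod_jacobson V (p : {linear A^o -> V}) : Prop :=
  (forall v, exists x, p x = v) /\ (forall x, p x = 0 <-> jacobson x).

Definition injective_module V : Prop :=
  forall (U W : lmodType A) (i : {linear U -> W}) (f : {linear U -> V}),
    injective i -> exists g : {linear W -> V}, forall u, g (i u) = f u.

Definition projective_module V : Prop :=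
  forall (U W : lmodType A) (p : {linear U -> W}) (f : {linear V -> W}),
    (forall w, exists u, p u = w) -> exists g : {linear V -> U}, forall v, p (g v) = f v.

Definition injdim_le V (n : nat) : Prop :=
  exists (I : nat -> lmodType A) (e : {linear V -> I 0%N})
         (d : forall k, {linear I k -> I k.+1}),
    (forall k, injective_module (I k)) /\
    (forall k (x : I k), (n < k)%N -> x = 0) /\
    injective e /\
    (forall x, d 0%N x = 0 <-> exists v, x = e v) /\
    (forall k (x : I k.+1), d k.+1 x = 0 <-> exists y, x = d k y).

Definition is_injdim V (n : nat) : Prop :=
  injdim_le V n /\ forall m, injdim_le V m -> (n <= m)%N.

Definition superfluous V (K : V -> Prop) : Prop :=
  forall U : V -> Prop, submod U ->
    (forall x, exists u k, U u /\ K k /\ x = u + k) -> forall x, U x.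

(** Minimality: each map is a projective cover of its image. *)
Definition minimal_projective_resolution V (P : nat -> lmodType A)
    (e : {linear P 0%N -> V}) (d : forall n, {linear P n.+1 -> P n}) : Prop :=
  (forall n, projective_module (P n)) /\
  (forall v, exists x, e x = v) /\
  (forall x, e x = 0 <-> exists y, x = d 0%N y) /\
  (forall n x, d n x = 0 <-> exists y, x = d n.+1 y) /\
  superfluous (fun x => e x = 0) /\
  (forall n, superfluous (fun x => d n x = 0)).

Definition is_complexity V (c : nat) : Prop :=
  exists (P : nat -> lmodType A) (e : {linear P 0%N -> V})
         (d : forall n, {linear P n.+1 -> P n}),
    minimal_projective_resolution e d /\
    growth_rate (fun n => has_length (submod_over central (V := P n))) c.

End Modules.

Definition gorenstein (A : pzRingType) : Prop :=
  (exists n, injdim_le (A^o : lmodType A) n) /\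
  (exists n, injdim_le ((A^c)^o : lmodType A^c) n).

Record fgmod (A : pzRingType) := FGMod {
  fg_sort :> lmodType A;
  fgP : fingen fg_sort }.

Section FGModules.
Variable A : pzRingType.

Lemma fingen_prod (V W : lmodType A) : fingen V -> fingen W -> fingen (V * W)%type.
Proof.
move=> [s hs] [t ht]; pose r := [seq (x, 0 : W) | x <- s] ++ [seq (0 : V, y) | y <- t].
exists r => -[v w]; have [c [_ ->]] := hs v; have [e [_ ->]] := ht w.
exists (fun i => if (i < size s)%N then c i else e (i - size s)%N); split=> //.
rewrite /r size_cat !size_map big_split_ord /=.
rewrite (eq_bigr (fun i : 'I_(size s) => c i *: (s`_i, 0 : W))) => [|i _]; last first.
  by rewrite ltn_ord nth_cat size_map ltn_ord (nth_map 0).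
rewrite [X in _ = _ + X](eq_bigr (fun i : 'I_(size t) => e i *: (0 : V, t`_i))) => [|i _]; last first.
  rewrite ltnNge leq_addr /= addKn nth_cat size_map ltnNge leq_addr /= addKn.
  by rewrite (nth_map 0).
have hfst : forall (I : finType) (F : I -> (V * W)%type),
    \sum_i F i = (\sum_i (F i).1, \sum_i (F i).2).
  move=> I F; rewrite [LHS]surjective_pairing; congr pair.
    exact: (raddf_sum (fst : {linear (V * W)%type -> V})).
  exact: (raddf_sum (snd : {linear (V * W)%type -> W})).
rewrite !hfst; congr pair => /=.
  by rewrite [X in _ + X]big1 ?addr0 // => i _; rewrite scaler0.
by rewrite [X in X + _]big1 ?add0r // => i _; rewrite scaler0.
Qed.

Definition fgprod (V W : fgmod A) : fgmod A := FGMod (fingen_prod (fgP V) (fgP W)).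

Lemma fingen0 : fingen 'rV[A]_0.
Proof. by exists [::] => x; exists (fun=> 0); split=> //; rewrite big_ord0 thinmx0. Qed.

Definition fgzero : fgmod A := FGMod fingen0.

Lemma fingen_regular : fingen A^o.
Proof.
by exists [:: 1] => x; exists (fun=> x); split=> //; rewrite big_ord1 /= [RHS]mulr1.
Qed.

Definition fgregular : fgmod A := FGMod fingen_regular.

End FGModules.

(** The bounded derived category.  Objects are cochain complexes of finitely
  generated left modules with bounded cohomology; morphisms are roofs (left
  fractions by quasi-isomorphisms).

  Encoding: a "graded map" from X to Y is a family of linear maps
  [X i -> Y j] over all pairs (i, j).  As a map of degree n, only its entries
  with [j = i + n] are meaningful, and all conditions below only look at those.
  This gives maps [X -> Sigma^n Y] without any transport along equalities
  such as [(i + m) + n = i + (m + n)].  The differential is encoded likewise. *)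

Section Derived.
Variable A : pzRingType.

Definition exact_at (X : int -> fgmod A) (d : forall i j, {linear X i -> X j}) (i : int) :=
  forall h k : int, i = h + 1 -> k = i + 1 ->
    forall x : X i, d i k x = 0 -> exists y, d h i y = x.

Record Db := MkDb {
  ob :> int -> fgmod A;
  diff : forall i j, {linear ob i -> ob j};
  diffK : forall i j k : int, j = i + 1 -> k = j + 1 ->
    forall x, diff j k (diff i j x) = 0;
  bounded : exists b : nat, forall i : int, (b < `|i|)%N -> exact_at diff i }.

Definition gmap (X Y : Db) := forall i j : int, {linear X i -> Y j}.

Definition sgn (n : int) : A := (-1) ^+ `|n|%N.

(** Chain maps [X -> Sigma^n Y], where [Sigma^n Y] has differential [(-1)^n d]. *)
Definition chmap (X Y : Db) (n : int) (f : gmap X Y) : Prop :=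
  forall i i' j j' : int, i' = i + 1 -> j = i + n -> j' = j + 1 ->
    forall x, f i' j' (diff X i i' x) = sgn n *: diff Y j j' (f i j x).

Definition homotopic (X Y : Db) (n : int) (f g : gmap X Y) : Prop :=
  exists h : gmap X Y, forall i i' j j' : int, i' = i + 1 -> j = i + n -> j = j' + 1 ->
    forall x, f i j x - g i j x = diff Y j' j (h i j' x) + sgn n *: h i' j (diff X i i' x).

(** [g] after [f], where [f] has degree [m]. *)
Definition gcomp (X Y Z : Db) (m : int) (g : gmap Y Z) (f : gmap X Y) : gmap X Z :=
  fun i k => g (i + m) k \o f i (i + m).

Definition quasi_iso (X Y : Db) (s : gmap X Y) : Prop :=
  chmap 0 s /\
  (forall h i j : int, i = h + 1 -> j = i + 1 ->
     (forall x : X i, diff X i j x = 0 ->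
        (exists y, s i i x = diff Y h i y) -> exists x', x = diff X h i x') /\
     (forall y : Y i, diff Y i j y = 0 ->
        exists x y', diff X i j x = 0 /\ y = s i i x + diff Y h i y')).

(** [dmor n X Y] is [Hom(X, Sigma^n Y)], up to [dmor_eq]:
  roofs [X <- X' -> Sigma^n Y]. *)
Record dmor (n : int) (X Y : Db) := Roof {
  apex : Db;
  den : gmap apex X;
  num : gmap apex Y;
  denP : quasi_iso den;
  numP : chmap n num }.

(** Equality of roofs.  The degrees are allowed to be only propositionally equal. *)
Definition dmor_eq (n m : int) (X Y : Db) (u : dmor n X Y) (v : dmor m X Y) : Prop :=
  n = m /\
  exists (C : Db) (a : gmap C (apex u)) (b : gmap C (apex v)),
    [/\ chmap 0 a, chmap 0 b, quasi_iso (gcomp 0 (den u) a),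
        homotopic 0 (gcomp 0 (den u) a) (gcomp 0 (den v) b) &
        homotopic n (gcomp 0 (num u) a) (gcomp 0 (num v) b)].

Fact quasi_isoE (X Y : Db) (s : gmap X Y) : quasi_iso s ->
  forall h i j h' i' j' : int, i = h + 1 -> j = i + 1 -> h' = h -> i' = i -> j' = j ->
     (forall x : X i, diff X i j x = 0 ->
        (exists y, s i i' x = diff Y h' i' y) -> exists x', x = diff X h i x') /\
     (forall y : Y i', diff Y i' j' y = 0 ->
        exists x y', diff X i j x = 0 /\ y = s i i' x + diff Y h' i' y').
Proof. by move=> [_ qs] h i j h' i' j' ih ji -> -> ->; exact: qs. Qed.

Lemma sgnM (n : int) (V : lmodType A) (x : V) : sgn n *: (sgn n *: x) = x.
Proof. by rewrite scalerA /sgn -exprMn_comm ?mulrNN ?mulr1 ?expr1n ?scale1r. Qed.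

Lemma sgnC (n : int) (a : A) : a * sgn n = sgn n * a.
Proof. exact: commr_sign. Qed.

Lemma sgnD (m n : int) : sgn (m + n) = sgn m * sgn n.
Proof.
rewrite /sgn -exprD -signr_odd -[RHS]signr_odd; congr (_ ^+ nat_of_bool _).
by lia.
Qed.


End Derived.

Arguments sgn {A} n.
Arguments numP {A n X Y} d _ _ _ _ _ _ _ _.
Arguments denP {A n X Y} d.

Section Constructions.
Variable A : pzRingType.

Definition sgn_map (n : int) (V W : lmodType A) (f : {linear V -> W}) (x : V) : W :=
  sgn n *: f x.

Fact sgn_mapE n (V W : lmodType A) (f : {linear V -> W}) x : sgn_map n f x = sgn n *: f x.
Proof. by []. Qed.

Fact sgn_map_linear n (V W : lmodType A) (f : {linear V -> W}) : linear (sgn_map n f).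
Proof. by move=> a x y; rewrite /sgn_map linearP scalerDr !scalerA sgnC. Qed.

HB.instance Definition _ n (V W : lmodType A) (f : {linear V -> W}) :=
  GRing.isLinear.Build A V W _ (sgn_map n f) (sgn_map_linear n f).

Definition pair_map (U V W : lmodType A) (f : {linear U -> V}) (g : {linear U -> W})
  (x : U) : (V * W)%type := (f x, g x).

Fact pair_map_linear (U V W : lmodType A) (f : {linear U -> V}) (g : {linear U -> W}) :
  linear (pair_map f g).
Proof. by move=> a x y; rewrite /pair_map !linearP. Qed.

HB.instance Definition _ (U V W : lmodType A) (f : {linear U -> V}) (g : {linear U -> W}) :=
  GRing.isLinear.Build A U (V * W)%type _ (pair_map f g) (pair_map_linear f g).

Section Stalk.
Variable M : fgmod A.

Definition stalk_ob (i : int) : fgmod A := if i == 0 then M else fgzero A.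
Definition stalk_diff i j : {linear stalk_ob i -> stalk_ob j} := \0.

Fact stalk_diffK (i j k : int) : j = i + 1 -> k = j + 1 ->
  forall x, stalk_diff j k (stalk_diff i j x) = 0.
Proof. by []. Qed.

Fact stalk_bounded : exists b : nat, forall i : int, (b < `|i|)%N -> exact_at stalk_diff i.
Proof.
exists 0%N => i i0 h k _ _ x _; exists 0.
suff z : forall y y' : stalk_ob i, y = y' by exact: z.
rewrite /stalk_ob; case: eqP => [e|_ y y']; first by move: i0; rewrite e.
by rewrite [y]thinmx0 [y']thinmx0.
Qed.

Definition stalk : Db A := MkDb stalk_diffK stalk_bounded.

End Stalk.

Section Shift.
Variable X : Db A.

Definition shift_ob (i : int) : fgmod A := X (i + 1).
Definition shift_diff i j : {linear shift_ob i -> shift_ob j} :=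
  sgn_map 1 (diff X (i + 1) (j + 1)).

Fact shift_diffE i j x : shift_diff i j x = sgn 1 *: diff X (i + 1) (j + 1) x.
Proof. by []. Qed.

Fact shift_diffK (i j k : int) : j = i + 1 -> k = j + 1 ->
  forall x, shift_diff j k (shift_diff i j x) = 0.
Proof.
move=> ij jk x; by rewrite !shift_diffE linearZ /= diffK ?scaler0 //; lia.
Qed.

Fact shift_bounded : exists b : nat, forall i : int, (b < `|i|)%N -> exact_at shift_diff i.
Proof.
have [b hb] := bounded X; exists b.+1 => i bi h k ih ki x dx.
have [||||y <-] := hb (i + 1) _ (h + 1) (k + 1) _ _ x; try lia.
  by rewrite -[LHS](sgnM 1) [X in sgn 1 *: X]dx scaler0.
exists (sgn 1 *: y); by rewrite shift_diffE linearZ /= sgnM.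
Qed.

Definition shift : Db A := MkDb shift_diffK shift_bounded.

End Shift.

(** [f] is seen as a chain map [X -> Sigma^n Y]. *)

Section Cone.
Variables (n : int) (X Y : Db A) (f : gmap X Y) (hf : chmap n f).

Definition cone_ob (i : int) : fgmod A := fgprod (X (i + 1)) (Y (i + n)).

Definition cone_diff i j : {linear cone_ob i -> cone_ob j} :=
  pair_map (sgn_map 1 (diff X (i + 1) (j + 1) \o fst))
    ((f (i + 1) (j + n) \o fst) \+ sgn_map n (diff Y (i + n) (j + n) \o snd)).

Fact cone_diffE i j x y :
  cone_diff i j (x, y) = (sgn 1 *: diff X (i + 1) (j + 1) x,
                          f (i + 1) (j + n) x + sgn n *: diff Y (i + n) (j + n) y).
Proof. by []. Qed.

Fact cone_diffK (i j k : int) : j = i + 1 -> k = j + 1 ->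
  forall x, cone_diff j k (cone_diff i j x) = 0.
Proof.
move=> ij jk [x y]; rewrite !cone_diffE; congr pair.
  by rewrite linearZ /= diffK ?scaler0 //; lia.
rewrite !linearD !linearZ /= (hf (j := j + n) (j' := k + n)) ?diffK ?scaler0 ?addr0; try lia.
by rewrite /sgn expr1 scaleN1r addNr.
Qed.

Fact cone_bounded : exists b : nat, forall i : int, (b < `|i|)%N -> exact_at cone_diff i.
Proof.
have [b hb] := bounded X; have [c hc] := bounded Y.
exists (b + c + `|n| + 1)%N => i bi h k ih ki [x y].
rewrite cone_diffE => -[dx dy].
have [||||x' ex] := hb (i + 1) _ (h + 1) (k + 1) _ _ x; try lia.
  by rewrite -[LHS](sgnM 1) dx scaler0.
have [||||y' ey] := hc (i + n) _ (h + n) (k + n) _ _ (y + f (h + 1) (i + n) x'); try lia.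
  rewrite linearD -[LHS](sgnM n) scalerDr -(hf (i := h + 1) (i' := i + 1)); try lia.
  by rewrite ex [X in sgn n *: X]addrC dy scaler0.
exists (sgn 1 *: x', sgn n *: y') => /=.
rewrite cone_diffE !linearZ /= !sgnM ex ey; congr pair.
by rewrite /sgn expr1 scaleN1r [LHS]addrC addrK.
Qed.

Definition cone : Db A := MkDb cone_diffK cone_bounded.

End Cone.

(** Homotopy pullback of [f : U -> Sigma^m Y] and [Sigma^m t : Sigma^m V -> Sigma^m Y];
  it provides the explicit Ore completion used to compose and add roofs. *)

Section Pullback.
Variables (m : int) (U V Y : Db A) (f : gmap U Y) (t : gmap V Y).
Hypotheses (hf : chmap m f) (ht : chmap 0 t).

Definition hpull_ob (i : int) : fgmod A := fgprod (fgprod (U i) (V (i + m))) (Y (i + m - 1)).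

Definition hpull_diff i j : {linear hpull_ob i -> hpull_ob j} :=
  pair_map
    (pair_map (diff U i j \o (fst \o fst)) (sgn_map m (diff V (i + m) (j + m) \o (snd \o fst))))
    ((f i (j + m - 1) \o (fst \o fst)) \- (t (i + m) (j + m - 1) \o (snd \o fst))
      \- sgn_map m (diff Y (i + m - 1) (j + m - 1) \o snd)).

Fact hpull_diffE i j u v y :
  hpull_diff i j (u, v, y) =
    (diff U i j u, sgn m *: diff V (i + m) (j + m) v,
     f i (j + m - 1) u - t (i + m) (j + m - 1) v
       - sgn m *: diff Y (i + m - 1) (j + m - 1) y).
Proof. by []. Qed.

Fact hpull_diffK (i j k : int) : j = i + 1 -> k = j + 1 ->
  forall x, hpull_diff j k (hpull_diff i j x) = 0.
Proof.
move=> ij jk [[u v] y]; rewrite !hpull_diffE; congr (_, _, _).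
- by rewrite diffK.
- by rewrite linearZ /= diffK ?scaler0 //; lia.
rewrite !linearB !linearZ /= (hf (j := j + m - 1) (j' := k + m - 1)); try lia.
rewrite (ht (j := j + m - 1) (j' := k + m - 1)); try lia.
rewrite diffK ?scaler0 ?subr0; try lia.
by rewrite /(sgn 0) expr0 scale1r -!scalerDr oppr0 scaler0 addr0 subrr scaler0.
Qed.

Fact hpull_bounded : exists b : nat, forall i : int, (b < `|i|)%N -> exact_at hpull_diff i.
Proof.
have [b hb] := bounded U; have [c hc] := bounded V; have [e he] := bounded Y.
exists (b + c + e + `|m| + 1)%N => i bi h k ih ki [[u v] y].
rewrite hpull_diffE => -[du dv dy].
have [||||u' eu] := hb i _ h k _ _ u; try lia; first by [].
have [||||v' ev] := hc (i + m) _ (h + m) (k + m) _ _ v; try lia.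
  by rewrite -[LHS](sgnM m) dv scaler0.
have [||||y' ey] := he (i + m - 1) _ (h + m - 1) (k + m - 1) _ _
  (f h (i + m - 1) u' - sgn m *: t (h + m) (i + m - 1) v' - y); try lia.
  have e1 : diff Y (i + m - 1) (k + m - 1) (f h (i + m - 1) u') = sgn m *: f i (k + m - 1) u.
    rewrite -eu (hf (j := i + m - 1) (j' := k + m - 1)) ?sgnM //; lia.
  have e2 : diff Y (i + m - 1) (k + m - 1) (t (h + m) (i + m - 1) v') = t (i + m) (k + m - 1) v.
    rewrite -ev (ht (j := i + m - 1) (j' := k + m - 1)) /(sgn 0) ?expr0 ?scale1r //; lia.
  by rewrite !linearB linearZ /= e1 e2 -[diff _ _ _ y](sgnM m) -!scalerBr dy scaler0.
exists (u', sgn m *: v', sgn m *: y') => /=.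
rewrite hpull_diffE !linearZ /= !sgnM eu ev ey; congr (_, _, _).
by rewrite scalerN subKr.
Qed.

Definition hpull : Db A := MkDb hpull_diffK hpull_bounded.

(** [g] after the projection to [U], resp. to [V]; their degrees are those of
  [g], resp. of [g] plus [m]. *)
Definition hpull_l (Z : Db A) (g : gmap U Z) : gmap hpull Z := fun i j => g i j \o (fst \o fst).
Definition hpull_r (Z : Db A) (g : gmap V Z) : gmap hpull Z :=
  fun i j => g (i + m) j \o (snd \o fst).

Fact hpull_l_chmap n Z (g : gmap U Z) : chmap n g -> chmap n (hpull_l g).
Proof. by move=> hg i i' j j' ii' ij jj' x /=; rewrite (hg _ _ j j'). Qed.

Fact hpull_r_chmap n Z (g : gmap V Z) : chmap n g -> chmap (m + n) (hpull_r g).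
Proof.
move=> hg i i' j j' ii' ij jj' x /=; rewrite !sgn_mapE /= linearZ /= (hg _ _ j j'); try lia.
by rewrite scalerA sgnD.
Qed.

Fact hpull_l_qiso X (s : gmap U X) : quasi_iso t -> quasi_iso s -> quasi_iso (hpull_l s).
Proof.
move=> /quasi_isoE qt [cs qs]; split=> [|h i j ih ji]; first exact: hpull_l_chmap.
have [si sj] := qs h i j ih ji.
have [ti tj] : _ /\ _ := qt (h + m) (i + m) (j + m) (i + m - 1) (j + m - 1) (j + 1 + m - 1)
  ltac:(lia) ltac:(lia) ltac:(lia) ltac:(lia) ltac:(lia).
have [_ tj'] : _ /\ _ := qt (h - 1 + m) (h + m) (i + m) (h + m - 1) (i + m - 1) (j + m - 1)
  ltac:(lia) ltac:(lia) ltac:(lia) ltac:(lia) ltac:(lia).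
split=> [[[u v] y]|x dx].
  rewrite hpull_diffE => -[du dv dy] su; have {si su}[u' eu] := si u du su.
  have fu : f i (j + m - 1) u = sgn m *: diff Y (i + m - 1) (j + m - 1) (f h (i + m - 1) u').
    by rewrite eu (hf (j := i + m - 1) (j' := j + m - 1)) //; lia.
  have [||v1 ev] := ti v.
  - by rewrite -[LHS](sgnM m) dv scaler0.
  - exists (sgn m *: (f h (i + m - 1) u' - y)); rewrite linearZ linearB /= scalerBr -fu.
    by apply/eqP; rewrite eq_sym -subr_eq0 [X in X == _]addrAC dy.
  have tv : t (i + m) (j + m - 1) v = diff Y (i + m - 1) (j + m - 1) (t (h + m) (i + m - 1) v1).
    rewrite ev (ht (j := i + m - 1) (j' := j + m - 1)) /(sgn 0) ?expr0 ?scale1r //; lia.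
  have [|w [y1 [dw ew]]] := tj' (f h (i + m - 1) u' - t (h + m) (i + m - 1) (sgn m *: v1) - y).
    rewrite !linearB !linearZ /= -tv -[diff _ _ _ (f _ _ _)](sgnM m) -fu.
    by rewrite -[diff _ _ _ y](sgnM m) -scalerN -!scalerDr dy scaler0.
  exists (u', sgn m *: v1 + w, sgn m *: y1); rewrite hpull_diffE eu; congr (_, _, _).
    by rewrite linearD linearZ /= dw addr0 sgnM.
  rewrite linearD [diff Y _ _ _]linearZ /= sgnM opprD addrA.
  by rewrite -[RHS]addrA -opprD -ew subKr.
have [u [x' [du ->]]] := sj x dx.
have [|v [y1 [dv ev]]] := tj (f i (j + m - 1) u).
  rewrite -[LHS](sgnM m) -(hf (i := i) (i' := j)) ?du ?linear0 ?scaler0 //; lia.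
exists (u, v, sgn m *: y1), x'; split=> //; rewrite hpull_diffE du dv scaler0; congr (_, _, _).
by rewrite [diff Y _ _ _]linearZ /= sgnM ev [t _ _ _ + _]addrC addrK subrr.
Qed.

End Pullback.

Arguments hpull_l {m U V Y f t} hf ht {Z} g.
Arguments hpull_r {m U V Y f t} hf ht {Z} g.
Arguments hpull_l_chmap {m U V Y f t} hf ht {n Z g} _.
Arguments hpull_r_chmap {m U V Y f t} hf ht {n Z g} _.
Arguments hpull_l_qiso {m U V Y f t} hf ht {X s} _ _.

Definition gid_fun (X : Db A) (i j : int) (x : X i) : X j :=
  if i =P j is ReflectT e then eq_rect i (fun k => X k : Type) x j e else 0.

Fact gid_fun_linear X i j : linear (@gid_fun X i j).
Proof.
move=> a x y; rewrite /gid_fun; case: eqP => [e|_]; last by rewrite scaler0 addr0.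
by case: j / e.
Qed.

HB.instance Definition _ (X : Db A) i j :=
  GRing.isLinear.Build A (X i) (X j) _ (@gid_fun X i j) (@gid_fun_linear X i j).

Definition gid (X : Db A) : gmap X X := fun i j => @gid_fun X i j.

Fact gidE X i x : @gid X i i x = x.
Proof. by rewrite /= /gid_fun; case: eqP => // e; rewrite eq_axiomK. Qed.

Fact gid_chmap X : chmap 0 (@gid X).
Proof.
move=> i i' j j' ii' ij jj' x; rewrite /(sgn 0) expr0 scale1r.
have {}ij : j = i by rewrite ij addr0.
have {}jj' : j' = i' by rewrite jj' ij.
by subst j j'; rewrite !gidE.
Qed.

Fact gid_qiso X : quasi_iso (@gid X).
Proof.
split=> [|h i j ih ji]; first exact: gid_chmap.
split=> [x _|y dy]; first by rewrite gidE.
by exists y, 0; rewrite gidE linear0 addr0.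
Qed.

Definition gzero (X Y : Db A) : gmap X Y := fun i j => \0.
Definition gadd (X Y : Db A) (f g : gmap X Y) : gmap X Y := fun i j => f i j \+ g i j.
Definition gopp (X Y : Db A) (f : gmap X Y) : gmap X Y := fun i j => sgn_map 1 (f i j).

Fact gzero_chmap X Y n : chmap n (@gzero X Y).
Proof. by move=> i i' j j' _ _ _ x; rewrite /= linear0 scaler0. Qed.

Fact gadd_chmap X Y n (f g : gmap X Y) : chmap n f -> chmap n g -> chmap n (gadd f g).
Proof.
by move=> hf hg i i' j j' h1 h2 h3 x /=; rewrite (hf _ _ j j') // (hg _ _ j j') // linearD scalerDr.
Qed.

Fact gopp_chmap X Y n (f : gmap X Y) : chmap n f -> chmap n (gopp f).
Proof.
move=> hf i i' j j' h1 h2 h3 x; rewrite /= !sgn_mapE (hf _ _ j j') //.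
by rewrite linearZ /= !scalerA sgnC.
Qed.

Definition did (X : Db A) : dmor 0 X X := Roof (@gid_qiso X) (@gid_chmap X).

Definition dzero n (X Y : Db A) : dmor n X Y := Roof (@gid_qiso X) (@gzero_chmap X Y n).

Definition dopp n (X Y : Db A) (u : dmor n X Y) : dmor n X Y :=
  Roof (denP u) (gopp_chmap (numP u)).

(** [v] after [u]: the composite X -> Sigma^m Y -> Sigma^(m+n) Z. *)
Definition dcomp m n (X Y Z : Db A) (v : dmor n Y Z) (u : dmor m X Y) : dmor (m + n) X Z :=
  Roof (hpull_l_qiso (numP u) (denP v).1 (denP v) (denP u))
       (hpull_r_chmap (numP u) (denP v).1 (numP v)).

Fact dadd_chmap n (X Y : Db A) (u v : dmor n X Y) :
  chmap n (gadd (hpull_l (denP u).1 (denP v).1 (num u)) (hpull_r (denP u).1 (denP v).1 (num v))).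
Proof.
apply: gadd_chmap; first exact/hpull_l_chmap/numP.
by rewrite -[n in chmap n]add0r; exact/hpull_r_chmap/numP.
Qed.

Definition dadd n (X Y : Db A) (u v : dmor n X Y) : dmor n X Y :=
  Roof (hpull_l_qiso (denP u).1 (denP v).1 (denP v) (denP u)) (@dadd_chmap n X Y u v).

Definition gshift (X Y : Db A) (f : gmap X Y) : gmap (shift X) (shift Y) :=
  fun i j => f (i + 1) (j + 1).

Fact gshift_chmap X Y n (f : gmap X Y) : chmap n f -> chmap n (gshift f).
Proof.
move=> hf i i' j j' h1 h2 h3 x.
have e := hf (i + 1) (i' + 1) (j + 1) (j' + 1) ltac:(lia) ltac:(lia) ltac:(lia) x.
transitivity (sgn 1 *: f (i' + 1) (j' + 1) (diff X (i + 1) (i' + 1) x)).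
  exact: (linearZ_LR (f (i' + 1) (j' + 1)) (sgn 1) _).
by rewrite e scalerA -sgnC -scalerA.
Qed.

Fact gshift_qiso X Y (f : gmap X Y) : quasi_iso f -> quasi_iso (gshift f).
Proof.
move=> [cf qf]; split=> [|h i j ih ji]; first exact: gshift_chmap.
have [fi fj] := qf (h + 1) (i + 1) (j + 1) ltac:(lia) ltac:(lia).
split=> [x|y]; rewrite shift_diffE => dx.
  have {}dx : diff X (i + 1) (j + 1) x = 0 by rewrite -[LHS](sgnM 1) dx scaler0.
  move=> [y ey]; have [|x' ->] := fi x dx.
    by exists (sgn 1 *: y); rewrite linearZ; exact: ey.
  by exists (sgn 1 *: x'); rewrite shift_diffE linearZ /= sgnM.
have {}dx : diff Y (i + 1) (j + 1) y = 0 by rewrite -[LHS](sgnM 1) dx scaler0.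
have [x [y' [dx' ->]]] := fj y dx.
exists x, (sgn 1 *: y'); split; first by rewrite shift_diffE dx' scaler0.
by rewrite shift_diffE linearZ /= sgnM.
Qed.

Definition dshift n (X Y : Db A) (u : dmor n X Y) : dmor n (shift X) (shift Y) :=
  Roof (gshift_qiso (denP u)) (gshift_chmap (numP u)).

End Constructions.

Notation "u =D v" := (dmor_eq u v) (at level 70, no associativity).

(** [Ext^n(M, N) = 0], with [Ext^n(M, N) = Hom(M, Sigma^n N)] in the derived category. *)
Definition Ext_vanishes (A : pzRingType) (n : nat) (M N : fgmod A) : Prop :=
  forall u : dmor n%:Z (stalk M) (stalk N), u =D dzero n%:Z (stalk M) (stalk N).

Definition maximal_CM (A : pzRingType) (M : fgmod A) : Prop :=
  forall i : nat, (0 < i)%N -> Ext_vanishes i M (fgregular A).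

Record gcring := GCRing {
  gc_sort :> pzRingType;
  homog : nat -> gc_sort -> Prop;
  homog0 : forall n, homog n 0;
  homogB : forall n r s, homog n r -> homog n s -> homog n (r - s);
  homog1 : homog 0%N 1;
  homogM : forall m n r s, homog m r -> homog n s -> homog (m + n)%N (r * s);
  homog_span : forall r, exists (N : nat) (c : nat -> gc_sort),
    (forall i, homog i (c i)) /\ r = \sum_(i < N) c i;
  homog_free : forall (N : nat) (c : nat -> gc_sort), (forall i, homog i (c i)) ->
    \sum_(i < N) c i = 0 -> forall i, (i < N)%N -> c i = 0;
  homog_comm : forall m n r s, homog m r -> homog n s ->
    r * s = (-1) ^+ (m * n)%N * (s * r) }.

(** A homomorphism of graded rings from R to the graded center of the derived
  category: [act n r] is the image of the homogeneous element [r] of degree [n]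
  (its values elsewhere are irrelevant). *)
Record central_action (R : gcring) (A : pzRingType) := CentralAction {
  act :> forall (n : nat) (r : R) (X : Db A), dmor n%:Z X X;
  act_natural : forall n r, homog n r -> forall X Y (f : dmor 0 X Y),
    dcomp (act n r Y) f =D dcomp f (act n r X);
  act_shift : forall n r, homog n r -> forall X,
    act n r (shift X) =D (if odd n then dopp (dshift (act n r X)) else dshift (act n r X));
  actD : forall n r s, homog n r -> homog n s -> forall X,
    act n (r + s) X =D dadd (act n r X) (act n s X);
  act1 : forall X, act 0 1 X =D did X;
  actM : forall m n r s, homog m r -> homog n s -> forall X,
    act (m + n)%N (r * s) X =D dcomp (act m r X) (act n s X) }.

Section Action.
Variables (A : pzRingType) (R : gcring) (phi : central_action R A).
Implicit Types X Y : Db A.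

(** [R_0]-submodules of [Hom(X, Sigma^n Y)]. *)
Definition hom_submod X Y (n : int) (S : dmor n X Y -> Prop) : Prop :=
  [/\ forall u v, S u -> u =D v -> S v,
      S (dzero n X Y),
      forall u v, S u -> S v -> S (dadd u v) &
      forall r u v, homog 0 r -> S u -> v =D dcomp u (phi 0%N r X) -> S v].

(** R-submodules of the direct sum of the [Hom(X, Sigma^i Y)], [i >= n0].  An
  element of the sum is a family of finite support; R is spanned by its
  homogeneous elements, so stability under these suffices. *)
Definition homsum_submod X Y (n0 : int) (S : (forall i : int, dmor i X Y) -> Prop) : Prop :=
  [/\ forall u, S u -> exists N : int, forall i, (i < n0) || (N < i) -> u i =D dzero i X Y,
      forall u v, S u -> (forall i, u i =D v i) -> S v,
      S (fun i => dzero i X Y),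
      forall u v, S u -> S v -> S (fun i => dadd (u i) (v i)) &
      forall (m : nat) r u v, homog m r -> S u ->
        (forall i, v i =D dcomp (u (i - m%:Z)) (phi m r X)) -> S v].

Definition ev_noetherian_fin_length X Y : Prop :=
  exists n0 : int, noetherian (homsum_submod (X := X) (Y := Y) n0) /\
    forall n : int, n0 <= n -> finite_length (hom_submod (X := X) (Y := Y) (n := n)).

Definition is_cx X (c : nat) : Prop :=
  growth_rate (fun n : nat => has_length (hom_submod (X := X) (Y := X) (n := n%:Z))) c.

(** [X // r] for [r] of degree [n]: if [phi_X(r)] is the roof [X <- X' -> Sigma^n X],
  the mapping cone of its numerator, which sits in a distinguished triangle
  [X -> Sigma^n X -> X // r -> Sigma X] whose first map is [phi_X(r)]. *)
Definition koszul X (nr : nat * R) : Db A := cone (numP (phi nr.1 nr.2 X)).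

(** [rs] lists homogeneous elements with their degrees. *)
Definition reduces_complexity (rs : seq (nat * R)) X : Prop :=
  [/\ forall r : nat * R, r \in rs -> (0 < r.1)%N /\ homog r.1 r.2,
      is_cx X (size rs) &
      forall i, (1 <= i <= size rs)%N ->
        is_cx (foldl koszul X (take i rs)) (size rs - i)%N].

End Action.

(* Main.v *)
(** For a free resolution [P] of an object [X], bounded above, [Hom(X, Sigma^n Y)] is the
  group of chain maps [P -> Sigma^n Y] up to homotopy.  The Koszul object of [X] at [r] is
  then resolved by the cone of a lift [P -> Sigma^|r| P] of the action of [r], so that
  iterating gives a resolution [Q] of the last object [X_c] of the reducing sequence.

  [X_c] has complexity 0, so [Hom(X_c, Sigma^n X_c) = 0] for large [n], and elements of [R]
  of large degree kill [Hom^*(X_c, K)].  Being eventually Noetherian passes from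
  [Hom^*(M, K)] to [Hom^*(X_c, K)] through the long exact sequences of the cones; hence
  [Hom(X_c, Sigma^n K) = 0] for large [n].  As finitely generated modules have finite length
  with simple factors summands of [K = A / rad A], this extends to all modules, so [X_c] is
  perfect.  Shifting dimensions from [A] itself, where [M] being maximal Cohen-Macaulay
  bounds the degrees, gives [Hom(X_c, Sigma^i N) = 0] for [i > |r_1| + ... + |r_c|];
  dually [Hom(N, Sigma^i X_c) = 0] for [i > id A - c].

  Going back from [X_j // r_{j+1}] to [X_j], vanishing for the cone makes the cohomology of
  [X_j] periodic with period [|r_{j+1}|] in the relevant range, while the window of zeros of
  [M] leaves at least [|r_{j+1}|] consecutive zeros for [X_j]; so everything vanishes. *)

Require Import Defs.
From HB Require Import structures.
From mathcomp Require Import all_boot all_order all_algebra.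
From mathcomp Require Import reals Rstruct boolp.
From mathcomp Require Import zify.
Set Implicit Arguments.
Unset Strict Implicit.
Unset Printing Implicit Defensive.
Import Order.TTheory GRing.Theory Num.Theory.
Local Open Scope ring_scope.

(** The length of the window comes from the triangles: a zero of the cone in degree i is obtained
    from zeros of X_j in degrees i - 1 and i - |r|, so each cone costs |r| - 1 zeros. A window of 1
    + sum (|r_j| - 1) zeros therefore leaves |r_{j+1}| of them for X_j and one for X_c. The bound id
    A - c has another source: as |r| > 0, the resolution of a cone stops one degree lower than that
    of X_j, so that Q lives in degrees at most - c.

    Q is infinite on the left, and its perfection is never turned into a finite complex. Vanishing
    of Ext against all modules makes Q contractible in low degrees, and the contraction removes the
    low components of any chain map into Q up to homotopy; finitely many degrees remain.

    The action of R is natural for morphisms of degree 0. For a morphism of degree i >= 0, the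
    actions on source and target are compared by shifting i times, at the price of an undetermined
    sign, which submodules do not see. *)

(** * Identities in abelian groups by reflection *)

Inductive zexpr := ZX0 | ZXv of nat | ZXadd of zexpr & zexpr | ZXopp of zexpr.

Fixpoint zeval (V : zmodType) (env : seq V) (e : zexpr) : V :=
  match e with
  | ZX0 => 0
  | ZXv i => env`_i
  | ZXadd a b => zeval env a + zeval env b
  | ZXopp a => - zeval env a
  end.

Fixpoint zcoef (e : zexpr) (k : nat) : int :=
  match e with
  | ZX0 => 0
  | ZXv i => (i == k)%:R
  | ZXadd a b => zcoef a k + zcoef b k
  | ZXopp a => - zcoef a k
  end.

(** A variable out of range has the default value 0 of [nth], in agreement with its coefficient
    being left out of the sum. *)
Lemma zevalE (V : zmodType) (env : seq V) e :
  zeval env e = \sum_(i < size env) env`_i *~ zcoef e i.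
Proof.
elim: e => [|i|a IHa b IHb|a IHa] /=.
- by rewrite big1 // => i _; rewrite mulr0z.
- have [lt_i|ge_i] := ltnP i (size env).
    rewrite (bigD1 (Ordinal lt_i)) //= eqxx mulr1z big1 ?addr0 // => j /eqP ne_j.
    by case: eqP => [e|_]; [case: ne_j; apply: val_inj|rewrite mulr0z].
  rewrite nth_default // big1 // => j _; case: eqP => [e|_]; last by rewrite mulr0z.
  by move: (ltn_ord j); rewrite -e ltnNge ge_i.
- by rewrite IHa IHb -big_split; apply: eq_bigr => i _; rewrite mulrzDr.
- by rewrite IHa -sumrN; apply: eq_bigr => i _; rewrite mulrNz.
Qed.

Lemma zeval_eq (V : zmodType) (env : seq V) e1 e2 :
  all (fun k => zcoef e1 k == zcoef e2 k) (iota 0 (size env)) ->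
  zeval env e1 = zeval env e2.
Proof.
move=> /allP h; rewrite !zevalE; apply: eq_bigr => i _; congr (_ *~ _).
by apply/eqP/h; rewrite mem_iota /= add0n ltn_ord.
Qed.

Ltac zidx x env :=
  lazymatch env with
  | x :: _ => constr:(0%N)
  | _ :: ?t => let i := zidx x t in constr:(i.+1)
  end.
Ltac zmem x env :=
  lazymatch env with
  | nil => constr:(false)
  | x :: _ => constr:(true)
  | _ :: ?t => zmem x t
  end.
Ltac zatoms e env :=
  lazymatch e with
  | ?a + ?b => let env := zatoms a env in zatoms b env
  | - ?a => zatoms a env
  | 0 => env
  | _ => lazymatch zmem e env with true => env | false => constr:(e :: env) end
  end.
Ltac zquote e env :=
  lazymatch e with
  | ?a + ?b => let a := zquote a env in let b := zquote b env in constr:(ZXadd a b)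
  | - ?a => let a := zquote a env in constr:(ZXopp a)
  | 0 => constr:(ZX0)
  | _ => let i := zidx e env in constr:(ZXv i)
  end.
Ltac zabs :=
  lazymatch goal with
  | |- ?l = ?r =>
    let rec findl e := lazymatch e with
      | ?a + ?b => first [findl a | findl b]
      | - ?a => findl a
      | 0 => fail
      | _ => tryif is_var e then fail else (let v := fresh "v" in set v := (e); clearbody v)
      end in
    first [findl l | findl r]
  end.
(* Solves identities in abelian groups, identifying atoms up to unification. *)
Ltac zmod :=
  repeat zabs;
  lazymatch goal with
  | |- @eq ?V ?l ?r =>
    let env := zatoms l (@nil V) in
    let env := zatoms r env in
    let l' := zquote l env in
    let r' := zquote r env in
    apply: (@zeval_eq _ env l' r'); vm_compute; reflexivity
  end.

(** * Complexes as total modules *)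

Lemma funext_dep (T : Type) (U : T -> Type) (f g : forall x, U x) :
  (forall x, f x = g x) -> f = g.
Proof. exact: functional_extensionality_dep. Qed.

Section Total.
Variable A : pzRingType.

(* Replacing a complex by the product of its terms turns graded maps into linear maps that
  compose without transport of degrees. *)
Definition total (X : int -> lmodType A) := forall i, X i.

Section TotalInstances.
Variable X : int -> lmodType A.
HB.instance Definition _ := gen_eqMixin (total X).
HB.instance Definition _ := gen_choiceMixin (total X).

Let add (x y : total X) : total X := fun i => x i + y i.
Let opp (x : total X) : total X := fun i => - x i.
Let zero : total X := fun i => 0.
Let scale a (x : total X) : total X := fun i => a *: x i.

Fact total_addA : associative add.
Proof. by move=> x y z; apply: funext_dep => i; rewrite /add addrA. Qed.
Fact total_addC : commutative add.
Proof. by move=> x y; apply: funext_dep => i; rewrite /add addrC. Qed.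
Fact total_add0 : left_id zero add.
Proof. by move=> x; apply: funext_dep => i; rewrite /add add0r. Qed.
Fact total_addN : left_inverse zero opp add.
Proof. by move=> x; apply: funext_dep => i; rewrite /add addNr. Qed.
HB.instance Definition _ := GRing.isZmodule.Build (total X)
  total_addA total_addC total_add0 total_addN.

Fact total_scaleA a b (x : total X) : scale a (scale b x) = scale (a * b) x.
Proof. by apply: funext_dep => i; rewrite /scale scalerA. Qed.
Fact total_scale1 : left_id 1 scale.
Proof. by move=> x; apply: funext_dep => i; rewrite /scale scale1r. Qed.
Fact total_scaleDr : right_distributive scale +%R.
Proof. by move=> a x y; apply: funext_dep => i; rewrite /scale scalerDr. Qed.
Fact total_scaleDl (x : total X) : {morph scale^~ x : a b / a + b}.
Proof. by move=> a b; apply: funext_dep => i; rewrite /scale scalerDl. Qed.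
HB.instance Definition _ := GRing.Zmodule_isLmodule.Build A (total X)
  total_scaleA total_scale1 total_scaleDr total_scaleDl.

Lemma totalDE (x y : total X) i : (x + y) i = x i + y i. Proof. by []. Qed.
Lemma totalNE (x : total X) i : (- x) i = - x i. Proof. by []. Qed.
Lemma total0E i : (0 : total X) i = 0. Proof. by []. Qed.
Lemma totalZE a (x : total X) i : (a *: x) i = a *: x i. Proof. by []. Qed.
End TotalInstances.

Definition totalE := (totalDE, totalNE, total0E, totalZE).

Section Move.
Variable X : int -> lmodType A.

Definition idx_fun (i j : int) (x : X i) : X j :=
  if i =P j is ReflectT e then eq_rect i (fun k => X k : Type) x j e else 0.

Fact idx_fun_linear i j : linear (@idx_fun i j).
Proof.
move=> a x y; rewrite /idx_fun; case: eqP => [e|_]; last by rewrite scaler0 addr0.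
by case: j / e.
Qed.
HB.instance Definition _ i j :=
  GRing.isLinear.Build A (X i) (X j) _ (@idx_fun i j) (@idx_fun_linear i j).

(** Zero unless [i = j]. Locked to keep simplification from exposing the equality test on
    degrees. *)
Definition idx i j : {linear X i -> X j} := locked (@idx_fun i j : {linear X i -> X j}).

Lemma idxE i x : idx i i x = x.
Proof. by rewrite /idx -lock /= /idx_fun; case: eqP => // e; rewrite eq_axiomK. Qed.

Lemma idx_ne i j x : i <> j -> idx i j x = 0.
Proof. by rewrite /idx -lock /= /idx_fun; case: eqP. Qed.

Lemma idx_at (x : total X) i j : i = j -> idx i j (x i) = x j.
Proof. by move=> e; subst j; rewrite idxE. Qed.

Definition single_fun i (v : X i) : total X := fun j => idx i j v.
Fact single_fun_linear i : linear (@single_fun i).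
Proof. by move=> a x y; apply: funext_dep => j; rewrite /single_fun linearP. Qed.
HB.instance Definition _ i := GRing.isLinear.Build A (X i) (total X) _
  (@single_fun i) (@single_fun_linear i).
Definition single i : {linear X i -> total X} := locked (@single_fun i : {linear X i -> total X}).

Lemma singleE i v : single i v i = v. Proof. by rewrite /single -lock; exact: idxE. Qed.
Lemma single_ne i j v : i <> j -> single i v j = 0.
Proof. by rewrite /single -lock; exact: idx_ne. Qed.

End Move.
End Total.

Arguments idx {A} X i j.
Arguments single {A} X i.

Section Maps.
Variable A : pzRingType.

Notation tot X := (total (fun i => fg_sort (ob X i))).

Section Diff.
Variable X : Db A.
Definition dif_fun (x : tot X) : tot X := fun j => diff X (j - 1) j (x (j - 1)).
Fact dif_fun_linear : linear dif_fun.
Proof. by move=> a x y; apply: funext_dep => j; rewrite /dif_fun linearP. Qed.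
HB.instance Definition _ := GRing.isLinear.Build A (tot X) (tot X) _ dif_fun dif_fun_linear.
Definition dif : {linear tot X -> tot X} := locked (dif_fun : {linear tot X -> tot X}).

Lemma difE x (i j : int) : j = i + 1 -> dif x j = diff X i j (x i).
Proof. by move=> e; have ei : i = j - 1 by [lia]; subst i; rewrite /dif -lock. Qed.

Lemma dif2 x : dif (dif x) = 0.
Proof.
apply: funext_dep => k; rewrite (@difE _ (k - 1)) ?(@difE _ (k - 2)) ?diffK //; lia.
Qed.

Lemma dif_single (i j : int) v : j = i + 1 -> dif (single (ob X) i v) = single (ob X) j (diff X i j v).
Proof.
move=> ij; apply: funext_dep => k; rewrite (@difE _ (k - 1)) ?subrK //.
have [e|ne] := pselect (k = j).
  subst k j; have -> : i + 1 - 1 = i by lia.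
  by rewrite !singleE.
rewrite single_ne ?linear0; last by lia.
by rewrite single_ne //; lia.
Qed.
End Diff.

Section Tot.
Variables (n : int) (X Y : Db A) (f : gmap X Y).
Definition tmap_fun (x : tot X) : tot Y := fun j => f (j - n) j (x (j - n)).
Fact tmap_fun_linear : linear tmap_fun.
Proof. by move=> a x y; apply: funext_dep => j; rewrite /tmap_fun linearP. Qed.
HB.instance Definition _ := GRing.isLinear.Build A (tot X) (tot Y) _ tmap_fun tmap_fun_linear.
Definition tmap : {linear tot X -> tot Y} := locked (tmap_fun : {linear tot X -> tot Y}).

Lemma tmapE x (i j : int) : j = i + n -> tmap x j = f i j (x i).
Proof. by move=> e; have ei : i = j - n by [lia]; subst i; rewrite /tmap -lock. Qed.
End Tot.

Section Ent.
Variables (X Y : Db A) (F : {linear tot X -> tot Y}).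
Definition ent_fun i j (v : X i) : Y j := F (single (ob X) i v) j.
Fact ent_fun_linear i j : linear (@ent_fun i j).
Proof. by move=> a x y; rewrite /ent_fun !linearP. Qed.
HB.instance Definition _ i j := GRing.isLinear.Build A (X i) (Y j) _
  (@ent_fun i j) (@ent_fun_linear i j).
Definition ent : gmap X Y := fun i j => locked (@ent_fun i j : {linear X i -> Y j}).
Lemma entE i j v : ent i j v = F (single (ob X) i v) j.
Proof. by rewrite /ent -lock. Qed.
End Ent.

End Maps.

Notation tot X := (total (fun i => fg_sort (ob X i))).
Arguments dif {A} X.
Arguments tmap {A} n {X Y} f.
Arguments ent {A X Y} F.

Section Sign.
Variable A : pzRingType.
Lemma sgn_or (n : int) : (@sgn A n = 1) \/ (@sgn A n = -1).
Proof. by rewrite /sgn -signr_odd; case: odd; [right; rewrite expr1|left; rewrite expr0]. Qed.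
Lemma sgn0 : @sgn A 0 = 1. Proof. by []. Qed.
Lemma sgn1 : @sgn A 1 = -1. Proof. by rewrite /sgn expr1. Qed.
Lemma sgnN (n : int) : @sgn A (- n) = sgn n.
Proof. by rewrite /sgn abszN. Qed.
End Sign.

Ltac sgn_cases :=
  rewrite ?scalerA ?sgnD ?sgnN ?sgn1 ?sgn0;
  repeat match goal with
  | |- context [@sgn ?A ?n] =>
     let e := fresh "e" in destruct (@sgn_or A n) as [e|e]; rewrite ?e; clear e
  end;
  rewrite ?(mulN1r, mulrN1, mul1r, mulr1, opprK, scaleN1r, scale1r, scaleNr, opprD).

(** * Chain maps and homotopies as linear maps of total modules *)

Section Cycles.
Variable A : pzRingType.
Implicit Types X Y Z : Db A.

(** For linear [F]: the component of [F x] in degree [j] depends only on the component of [x] in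
    degree [j - n]. This is how homogeneity of degree [n] is expressed without entries of [F]. *)
Definition hg (n : int) X Y (F : tot X -> tot Y) :=
  forall x j, x (j - n) = 0 -> F x j = 0.

Definition cyc (n : int) X Y (F : tot X -> tot Y) :=
  hg n F /\ forall x, F (dif X x) = sgn n *: dif Y (F x).

Definition htp (n : int) X Y (F G : tot X -> tot Y) :=
  exists H : {linear tot X -> tot Y}, hg (n - 1) H /\
    forall x, F x - G x = dif Y (H x) + sgn n *: H (dif X x).

Lemma hg_dif X : hg 1 (dif X).
Proof. by move=> x j e; rewrite (@difE _ _ _ (j - 1)) ?e ?linear0 // subrK. Qed.

Lemma hg_tmap n X Y (f : gmap X Y) : hg n (tmap n f).
Proof. by move=> x j e; rewrite (@tmapE _ _ _ _ _ _ (j - n)) ?e ?linear0 // subrK. Qed.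

Lemma hg_comp m n k X Y Z (G : tot Y -> tot Z) (F : tot X -> tot Y) :
  k = m + n -> hg m F -> hg n G -> hg k (G \o F).
Proof. by move=> -> hF hG x j e; apply: hG; apply: hF; have -> : j - n - m = j - (m + n) by lia. Qed.

Lemma hg_id X : hg 0 (@idfun (tot X)).
Proof. by move=> x j; rewrite subr0. Qed.

Lemma hgD n X Y (F G : tot X -> tot Y) : hg n F -> hg n G -> hg n (F \+ G).
Proof. by move=> hF hG x j e; rewrite /= totalE hF // hG // addr0. Qed.

Lemma hgB n X Y (F G : tot X -> tot Y) : hg n F -> hg n G -> hg n (F \- G).
Proof. by move=> hF hG x j e; rewrite /= totalE hF // totalE hG // subr0. Qed.

Lemma hg_sgn n m X Y (F : {linear tot X -> tot Y}) : hg n F -> hg n (sgn_map m F).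
Proof. by move=> hF x j e; rewrite sgn_mapE totalE hF // scaler0. Qed.

Lemma eq_hg n X Y (F G : tot X -> tot Y) : F =1 G -> hg n F -> hg n G.
Proof. by move=> e hF x j /hF; rewrite e. Qed.

(** A linear map out of a product need not be determined by its entries [ent F]. Homogeneity allows
    [x] to be replaced by its component in degree [j - n], as the difference vanishes there. *)
Lemma tmap_ent n X Y (F : {linear tot X -> tot Y}) : hg n F -> tmap n (ent F) =1 F.
Proof.
move=> hF x; apply: funext_dep => j; rewrite (@tmapE _ _ _ _ _ _ (j - n)) ?subrK // entE.
apply/eqP; rewrite -subr_eq0 -totalNE -totalDE -linearB; apply/eqP; apply: hF.
by rewrite totalE totalNE singleE subrr.
Qed.

Lemma chmapE n X Y (f : gmap X Y) :
  chmap n f <-> forall x, tmap n f (dif X x) = sgn n *: dif Y (tmap n f x).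
Proof.
split=> hf => [x|i i' j j' ii' ij jj' v].
  apply: funext_dep => j.
  rewrite (@tmapE _ _ _ _ _ _ (j - n)) ?subrK // (@difE _ _ _ (j - n - 1)) ?subrK //.
  rewrite totalE (@difE _ _ _ (j - 1)) ?subrK // (@tmapE _ _ _ _ _ _ (j - n - 1)); last by lia.
  by apply: hf; lia.
have e := congr1 (fun t : tot Y => t j') (hf (single (ob X) i v)).
move: e; rewrite (@dif_single _ _ i i') // (@tmapE _ _ _ _ _ _ i'); last by lia.
by rewrite singleE => ->; rewrite totalE (@difE _ _ _ j) // (@tmapE _ _ _ _ _ _ i) // singleE.
Qed.

Lemma chmap_cyc n X Y (f : gmap X Y) : chmap n f <-> cyc n (tmap n f).
Proof.
split=> [/chmapE h|[_ /chmapE //]]; split=> //; exact: hg_tmap.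
Qed.

Lemma eq_cyc n X Y (F G : tot X -> tot Y) : F =1 G -> cyc n F -> cyc n G.
Proof. by move=> e [h c]; split=> [|x]; [exact: eq_hg h|rewrite -!e]. Qed.

Lemma ent_chmap n X Y (F : {linear tot X -> tot Y}) : cyc n F -> chmap n (ent F).
Proof.
move=> cF; apply/chmap_cyc; apply: (eq_cyc _ cF) => x; rewrite tmap_ent //; exact: cF.1.
Qed.

Lemma homotopicE n X Y (f g : gmap X Y) :
  homotopic n f g <-> htp n (tmap n f) (tmap n g).
Proof.
split=> [[h hh]|[H [hH eH]]].
  exists (tmap (n - 1) h); split=> [|x]; first exact: hg_tmap.
  apply: funext_dep => j.
  rewrite !totalE !(@tmapE _ n _ _ _ _ (j - n)) ?subrK //.
  rewrite (@difE _ _ _ (j - 1)) ?subrK // (@tmapE _ _ _ _ _ _ (j - n)); last by lia.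
  rewrite (@tmapE _ _ _ _ _ _ (j - n + 1)); last by lia.
  by rewrite (@difE _ _ _ (j - n)) //; apply: hh; lia.
exists (ent H) => i i' j j' ii' ij jj' v.
have e := congr1 (fun t : tot Y => t j) (eH (single (ob X) i v)).
move: e; rewrite !totalE !(@tmapE _ n _ _ _ _ i) // !singleE => ->.
by rewrite (@difE _ _ _ j') // (@dif_single _ _ i i') // !entE.
Qed.

Lemma tmap_gcomp m n k X Y Z (g : gmap Y Z) (f : gmap X Y) : k = m + n ->
  tmap k (gcomp m g f) =1 tmap n g \o tmap m f.
Proof.
move=> -> x; apply: funext_dep => j /=.
rewrite (@tmapE _ _ _ _ _ _ (j - n - m)); last by lia.
rewrite (@tmapE _ _ _ _ _ _ (j - n - m + m)); last by lia.
by rewrite (@tmapE _ _ _ _ _ _ (j - n - m)).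
Qed.

Lemma tmap_gid X : tmap 0 (@gid A X) =1 idfun.
Proof.
move=> x; apply: funext_dep => j; rewrite (@tmapE _ _ _ _ _ _ j) ?addr0 //; exact: gidE.
Qed.

Lemma tmap_gzero n X Y : tmap n (@gzero A X Y) =1 \0.
Proof. by move=> x; apply: funext_dep => j; rewrite (@tmapE _ _ _ _ _ _ (j - n)) ?subrK. Qed.

Lemma tmap_gadd n X Y (f g : gmap X Y) : tmap n (gadd f g) =1 tmap n f \+ tmap n g.
Proof.
by move=> x; apply: funext_dep => j; rewrite /= totalE !(@tmapE _ _ _ _ _ _ (j - n)) ?subrK.
Qed.

Lemma tmap_gopp n X Y (f : gmap X Y) x : tmap n (gopp f) x = - tmap n f x.
Proof.
apply: funext_dep => j; rewrite totalNE !(@tmapE _ _ _ _ _ _ (j - n)) ?subrK //.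
by rewrite /= sgn_mapE sgn1 scaleN1r.
Qed.

Lemma eq_htp n X Y (F F' G G' : tot X -> tot Y) :
  F =1 F' -> G =1 G' -> htp n F G -> htp n F' G'.
Proof. by move=> eF eG [H [hH e]]; exists H; split=> // x; rewrite -eF -eG. Qed.

Lemma htp_refl n X Y (F : tot X -> tot Y) : htp n F F.
Proof. by exists \0; split=> // x; rewrite subrr /= linear0 scaler0 addr0. Qed.

Lemma eq1_htp n X Y (F G : tot X -> tot Y) : F =1 G -> htp n F G.
Proof. by move=> e; apply: (eq_htp (fun=> erefl) e); exact: htp_refl. Qed.

Lemma htpD n X Y (F F' G G' : tot X -> tot Y) :
  htp n F G -> htp n F' G' -> htp n (F \+ F') (G \+ G').
Proof.
move=> [H [hH e]] [H' [hH' e']]; exists (H \+ H'); split=> [|x]; first exact: hgD.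
transitivity ((F x - G x) + (F' x - G' x)); first by rewrite /=; zmod.
by rewrite e e' /= [dif _ (_ + _)]linearD scalerDr; zmod.
Qed.

Lemma htpN n X Y (F G : tot X -> tot Y) :
  htp n F G -> htp n (fun x => - F x) (fun x => - G x).
Proof.
move=> [H [hH e]]; exists (sgn_map 1 H); split=> [|x]; first exact: hg_sgn.
transitivity (- (F x - G x)); first by zmod.
by rewrite e /= !sgn_mapE sgn1 !scaleN1r [dif _ (- _)]linearN scalerN; zmod.
Qed.

Lemma htp_sym n X Y (F G : tot X -> tot Y) : htp n F G -> htp n G F.
Proof.
move=> [H [hH e]]; exists (sgn_map 1 H); split=> [|x]; first exact: hg_sgn.
transitivity (- (F x - G x)); first by zmod.
by rewrite e /= !sgn_mapE sgn1 !scaleN1r [dif _ (- _)]linearN scalerN; zmod.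
Qed.

Lemma htp_trans n X Y (F G K : tot X -> tot Y) : htp n F G -> htp n G K -> htp n F K.
Proof.
move=> [H [hH e]] [H' [hH' e']]; exists (H \+ H'); split=> [|x]; first exact: hgD.
transitivity ((F x - G x) + (G x - K x)); first by zmod.
by rewrite e e' /= [dif _ (_ + _)]linearD scalerDr; zmod.
Qed.

Lemma cyc_sgnE n X Y (F : {linear tot X -> tot Y}) :
  cyc n F -> forall x, dif Y (F x) = sgn n *: F (dif X x).
Proof. by move=> [_ c] x; rewrite c sgnM. Qed.

Lemma cyc_comp m n k X Y Z (G : {linear tot Y -> tot Z}) (F : tot X -> tot Y) :
  k = m + n -> cyc m F -> cyc n G -> cyc k (G \o F).
Proof.
move=> e [hF cF] [hG cG]; split=> [|x]; first exact: hg_comp e hF hG.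
by rewrite /= cF linearZ /= cG scalerA e sgnD.
Qed.

Lemma cyc_id X : cyc 0 (@idfun (tot X)).
Proof. by split=> [|x]; [exact: hg_id|rewrite sgn0 scale1r]. Qed.

Lemma cyc0 n X Y : cyc n (\0 : tot X -> tot Y).
Proof. by split=> // x; rewrite /= linear0 scaler0. Qed.

Lemma cycD n X Y (F G : tot X -> tot Y) : cyc n F -> cyc n G -> cyc n (F \+ G).
Proof.
move=> [hF cF] [hG cG]; split=> [|x]; first exact: hgD.
by rewrite /= cF cG linearD scalerDr.
Qed.

Lemma cycN n X Y (F : tot X -> tot Y) : cyc n F -> cyc n (fun x => - F x).
Proof.
move=> [hF cF]; split=> [x j e|x]; first by rewrite totalE hF ?oppr0.
by rewrite cF linearN scalerN.
Qed.

Lemma cycB n X Y (F G : tot X -> tot Y) : cyc n F -> cyc n G -> cyc n (F \- G).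
Proof. by move=> cF cG; apply: cycD cF (cycN cG). Qed.

Lemma cyc_htp n X Y (F : tot X -> tot Y) (G : {linear tot X -> tot Y}) :
  htp n F G -> cyc n F -> cyc n G.
Proof.
move=> [H [hH e]] [hF cF].
have eG x : G x = F x - (dif Y (H x) + sgn n *: H (dif X x)) by rewrite -e; zmod.
split=> [|x].
  apply: (@eq_hg _ _ _ (F \- (dif Y \o H \+ sgn_map n (H \o dif X)))) => [x|].
    by rewrite eG /= sgn_mapE.
  apply: hgB => //; apply: hgD.
    by apply: (@hg_comp (n - 1) 1); [lia|exact: hH|exact: hg_dif].
  by apply: hg_sgn; apply: (@hg_comp 1 (n - 1)); [lia|exact: hg_dif|exact: hH].
by rewrite !eG cF dif2 linear0 scaler0 addr0 linearB linearD dif2 add0r linearZ /= scalerBr sgnM.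
Qed.

Lemma htp_compl m n k X Y Z (G : {linear tot Y -> tot Z}) (F F' : tot X -> tot Y) :
  k = m + n -> cyc n G -> htp m F F' -> htp k (G \o F) (G \o F').
Proof.
move=> ek cG [H [hH e]]; exists (sgn_map n (G \o H)); split=> [|x].
  apply: hg_sgn; apply: (@hg_comp (m - 1) n); [lia|exact: hH|exact: cG.1].
rewrite /= !sgn_mapE /= -linearB e linearD [G (_ *: _)]linearZ /= cG.2 linearZ /= ek sgnD.
by congr (_ + _); rewrite -scalerA sgnM.
Qed.

Lemma htp_compr m n k X Y Z (G G' : tot Y -> tot Z) (F : {linear tot X -> tot Y}) :
  k = m + n -> cyc m F -> htp n G G' -> htp k (G \o F) (G' \o F).
Proof.
move=> ek cF [H [hH e]]; exists (H \o F); split=> [|x].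
  by apply: (@hg_comp m (n - 1)); [lia|exact: cF.1|exact: hH].
rewrite /= e (cyc_sgnE cF) linearZ /= scalerA -sgnD ek; congr (_ + sgn _ *: _); lia.
Qed.

End Cycles.

Arguments hg {A} n {X Y} F.
Arguments cyc {A} n {X Y} F.
Arguments htp {A} n {X Y} F G.

Section Quasi.
Variable A : pzRingType.
Implicit Types X Y Z : Db A.

Definition qis X Y (S : tot X -> tot Y) :=
  (forall x, dif X x = 0 -> (exists y, S x = dif Y y) -> exists x', x = dif X x') /\
  (forall y, dif Y y = 0 -> exists x y', dif X x = 0 /\ y = S x + dif Y y').

Definition acy X := forall x, dif X x = 0 -> exists y, x = dif X y.

Lemma dif_eqP X x y :
  x = dif X y <-> (forall i j : int, j = i + 1 -> x j = diff X i j (y i)).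
Proof.
split=> [-> i j ij|h]; first by rewrite (difE _ ij).
by apply: funext_dep => j; rewrite (@difE _ _ _ (j - 1)) ?subrK //; apply: h; rewrite subrK.
Qed.

Lemma single_eqP X (i : int) (x : X i) (y : tot X) :
  single (ob X) i x = dif X y -> forall h, i = h + 1 -> x = diff X h i (y h).
Proof. by move=> e h ih; rewrite -(difE _ ih) -e singleE. Qed.

(** Towards the total form, preimages are chosen in all degrees at once; conversely, an element of a
    single degree is embedded by [single]. *)
Lemma quasi_isoP X Y (s : gmap X Y) : quasi_iso s <-> chmap 0 s /\ qis (tmap 0 s).
Proof.
split=> [[cs q]|[cs [q1 q2]]]; split=> //.
  split=> [x dx [y sy]|y dy].
    have q1 (h : int) : exists x', x (h + 1) = diff X h (h + 1) x'.
      have [q1 _] := q h (h + 1) (h + 1 + 1) erefl erefl.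
      apply: q1; first by rewrite -(@difE _ _ _ (h + 1)) ?dx.
      exists (y h); rewrite -(@difE _ _ _ h) // -sy (@tmapE _ _ _ _ _ _ (h + 1)) ?addr0 //.
    exists (fun h => sval (cid (q1 h))); apply/dif_eqP => i j ->.
    by case: (cid _) => x' /= ->.
  have ys (i : int) : exists t : X (i + 1) * Y i,
      diff X (i + 1) (i + 1 + 1) t.1 = 0 /\ y (i + 1) = s (i + 1) (i + 1) t.1 + diff Y i (i + 1) t.2.
    have [_ q3] := q i (i + 1) (i + 1 + 1) erefl erefl.
    have [|x [y' [dx ey]]] := q3 (y (i + 1)); first by rewrite -(@difE _ _ _ (i + 1)) ?dy.
    by exists (x, y').
  (* The first component of [z i] has degree [i + 1], so reindexing by [j] requires the transport
     from [j - 1 + 1] to [j]. *)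
  pose z i := sval (cid (ys i)); pose x j := idx (ob X) (j - 1 + 1) j (z (j - 1)).1.
  have xE i : x (i + 1) = (z i).1.
    have e : i + 1 - 1 = i by lia.
    by rewrite /x; move: (i + 1 - 1) e => k ->; rewrite idxE.
  exists x, (fun i => (z i).2); split.
    apply/esym/dif_eqP => i j ->; have -> : i = i - 1 + 1 by lia.
    by rewrite xE /z; case: (cid _) => t [] /= ->.
  apply: funext_dep => j; have -> : j = j - 1 + 1 by lia.
  rewrite totalE (@tmapE _ _ _ _ _ _ (j - 1 + 1)) ?addr0 // (@difE _ _ _ (j - 1)) // xE /z.
  by case: (cid _) => t [] /=.
move=> h i j ih ji; split=> [x dx [y sy]|y dy].
  have [||x' ex] := q1 (single (ob X) i x).
  - by rewrite (dif_single _ ji) dx linear0.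
  - exists (single (ob Y) h y); rewrite (dif_single _ ih) -sy; apply: funext_dep => k.
    rewrite (@tmapE _ _ _ _ _ _ k) ?addr0 //; have [e|ne] := pselect (k = i).
      by subst k; rewrite !singleE.
    by rewrite !(single_ne _ (nesym ne)) linear0.
  by exists (x' h); exact: (single_eqP ex ih).
have [|x [y' [dx ey]]] := q2 (single (ob Y) i y); first by rewrite (dif_single _ ji) dy linear0.
exists (x i), (y' h); rewrite -(difE _ ji) dx; split=> //.
move: (congr1 (fun t : tot Y => t i) ey); rewrite singleE totalE (difE _ ih).
by rewrite (@tmapE _ _ _ _ _ _ i) ?addr0.
Qed.

Lemma acy_exact X : acy X -> forall i, exact_at (diff X) i.
Proof.
move=> aX i h k ih ki x dx.
have [|y e] := aX (single (ob X) i x); first by rewrite (dif_single _ ki) dx linear0.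
by exists (y h); rewrite -(single_eqP e ih).
Qed.

End Quasi.

Lemma total_ext (A : pzRingType) (X : int -> lmodType A) (k : int) (x y : total X) :
  (forall i, x (i + k) = y (i + k)) -> x = y.
Proof. by move=> h; apply: funext_dep => j; rewrite -(subrK k j). Qed.

(** * Cones, homotopy pullbacks and shifts on total modules *)

Section ConeTotal.
Variable A : pzRingType.
Variables (n : int) (X Y : Db A) (f : gmap X Y) (hf : chmap n f).
Notation C := (cone hf).

Definition cin1_fun (x : tot X) : tot C := fun i => (x (i + 1), 0).
Definition cin2_fun (y : tot Y) : tot C := fun i => (0, y (i + n)).
Definition cpr1_fun (z : tot C) : tot X := fun j => idx (ob X) (j - 1 + 1) j (z (j - 1)).1.
Definition cpr2_fun (z : tot C) : tot Y := fun j => idx (ob Y) (j - n + n) j (z (j - n)).2.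

Fact cin1_linear : linear cin1_fun.
Proof.
move=> a x y; apply: funext_dep => i; rewrite !totalE /cin1_fun; congr pair.
exact: esym (etrans (addr0 _) (scaler0 _ _)).
Qed.
Fact cin2_linear : linear cin2_fun.
Proof.
move=> a x y; apply: funext_dep => i; rewrite !totalE /cin2_fun; congr pair.
exact: esym (etrans (addr0 _) (scaler0 _ _)).
Qed.
Fact cpr1_linear : linear cpr1_fun.
Proof. by move=> a x y; apply: funext_dep => i; rewrite !totalE /cpr1_fun linearP. Qed.
Fact cpr2_linear : linear cpr2_fun.
Proof. by move=> a x y; apply: funext_dep => i; rewrite !totalE /cpr2_fun linearP. Qed.
HB.instance Definition _ := GRing.isLinear.Build A (tot X) (tot C) _ cin1_fun cin1_linear.
HB.instance Definition _ := GRing.isLinear.Build A (tot Y) (tot C) _ cin2_fun cin2_linear.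
HB.instance Definition _ := GRing.isLinear.Build A (tot C) (tot X) _ cpr1_fun cpr1_linear.
HB.instance Definition _ := GRing.isLinear.Build A (tot C) (tot Y) _ cpr2_fun cpr2_linear.
Definition cin1 : {linear tot X -> tot C} := locked (cin1_fun : {linear tot X -> tot C}).
Definition cin2 : {linear tot Y -> tot C} := locked (cin2_fun : {linear tot Y -> tot C}).
Definition cpr1 : {linear tot C -> tot X} := locked (cpr1_fun : {linear tot C -> tot X}).
Definition cpr2 : {linear tot C -> tot Y} := locked (cpr2_fun : {linear tot C -> tot Y}).

Lemma cin1E x i : cin1 x i = (x (i + 1), 0). Proof. by rewrite /cin1 -lock. Qed.
Lemma cin2E y i : cin2 y i = (0, y (i + n)). Proof. by rewrite /cin2 -lock. Qed.
Lemma cpr1E z i : cpr1 z (i + 1) = (z i).1.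
Proof.
rewrite /cpr1 -lock /= /cpr1_fun; have e : i + 1 - 1 = i by lia.
by move: (i + 1 - 1) e => k ->; rewrite idxE.
Qed.
Lemma cpr2E z i : cpr2 z (i + n) = (z i).2.
Proof.
rewrite /cpr2 -lock /= /cpr2_fun; have e : i + n - n = i by lia.
by move: (i + n - n) e => k ->; rewrite idxE.
Qed.

Lemma cpr1_in1 x : cpr1 (cin1 x) = x.
Proof. by apply: (@total_ext _ _ 1) => j; rewrite cpr1E cin1E. Qed.
Lemma cpr1_in2 y : cpr1 (cin2 y) = 0.
Proof. by apply: (@total_ext _ _ 1) => j; rewrite cpr1E cin2E. Qed.
Lemma cpr2_in1 x : cpr2 (cin1 x) = 0.
Proof. by apply: (@total_ext _ _ n) => j; rewrite cpr2E cin1E. Qed.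
Lemma cpr2_in2 y : cpr2 (cin2 y) = y.
Proof. by apply: (@total_ext _ _ n) => j; rewrite cpr2E cin2E. Qed.
Lemma cone_eta z : z = cin1 (cpr1 z) + cin2 (cpr2 z).
Proof.
apply: funext_dep => i; rewrite totalE cin1E cin2E cpr1E cpr2E.
by rewrite [LHS]surjective_pairing; congr pair; rewrite /= ?addr0 ?add0r.
Qed.

Lemma dif_cin2 y : dif C (cin2 y) = sgn n *: cin2 (dif Y y).
Proof.
apply: funext_dep => j; rewrite (@difE _ _ _ (j - 1)) ?subrK // totalE !cin2E cone_diffE.
rewrite !linear0 scaler0 add0r (@difE _ _ _ (j - 1 + n)); last by lia.
by congr pair; rewrite scaler0.
Qed.

Lemma dif_cin1 x : dif C (cin1 x) = cin2 (tmap n f x) - cin1 (dif X x).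
Proof.
apply: funext_dep => j; rewrite (@difE _ _ _ (j - 1)) ?subrK // !totalE !cin1E !cin2E cone_diffE.
rewrite !linear0 scaler0 addr0 (@difE _ _ _ (j - 1 + 1)); last by lia.
rewrite sgn1 scaleN1r (@tmapE _ _ _ _ _ _ (j - 1 + 1)); last by lia.
by congr pair => /=; rewrite ?add0r ?subr0.
Qed.

Lemma cpr1_dif z : cpr1 (dif C z) = - dif X (cpr1 z).
Proof.
rewrite [z in LHS]cone_eta linearD dif_cin1 dif_cin2 !(linearB, linearD) /= linearZ /=.
by rewrite !cpr1_in2 cpr1_in1 scaler0 add0r addr0.
Qed.

Lemma cpr2_dif z : cpr2 (dif C z) = tmap n f (cpr1 z) + sgn n *: dif Y (cpr2 z).
Proof.
rewrite [z in LHS]cone_eta linearD dif_cin1 dif_cin2 !(linearB, linearD) /= linearZ /=.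
by rewrite !cpr2_in2 cpr2_in1 subr0.
Qed.

Lemma hg_cin1 : hg (-1) cin1.
Proof. by move=> x j; rewrite cin1E opprK => ->. Qed.
Lemma hg_cin2 : hg (- n) cin2.
Proof. by move=> x j; rewrite cin2E opprK => ->. Qed.
Lemma hg_cpr1 : hg 1 cpr1.
Proof. by move=> x j e; rewrite /cpr1 -lock /= /cpr1_fun e linear0. Qed.
Lemma hg_cpr2 : hg n cpr2.
Proof. by move=> x j e; rewrite /cpr2 -lock /= /cpr2_fun e linear0. Qed.
Lemma cyc_cin2 : cyc (- n) cin2.
Proof. by split=> [|x]; [exact: hg_cin2|rewrite dif_cin2 sgnN sgnM]. Qed.
Lemma cyc_cpr1 : cyc 1 cpr1.
Proof. by split=> [|x]; [exact: hg_cpr1|rewrite cpr1_dif sgn1 scaleN1r]. Qed.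

Lemma cone0P z : dif C z = 0 ->
  dif X (cpr1 z) = 0 /\ tmap n f (cpr1 z) = - (sgn n *: dif Y (cpr2 z)).
Proof.
move=> dz; split.
  by apply: oppr_inj; rewrite oppr0 -cpr1_dif dz linear0.
by apply/eqP; rewrite -addr_eq0 -cpr2_dif dz linear0.
Qed.

End ConeTotal.

(** Injectivity of [s] on cohomology bounds the first component of a cycle; surjectivity then bounds
    what is left of the second one, after changing the first bounding element by a cycle. *)
Lemma acy_cone (A : pzRingType) (X Y : Db A) (s : gmap X Y) (hs : chmap 0 s) :
  qis (tmap 0 s) -> acy (cone hs).
Proof.
move=> [q1 q2] z /cone0P []; rewrite sgn0 scale1r => dx sx.
have [|x' ex] := q1 _ dx; first by exists (- cpr2 hs z); rewrite linearN.
have [|x1 [y1 [dx1 ey]]] := q2 (cpr2 hs z + tmap 0 s x').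
  rewrite linearD (cyc_sgnE (proj1 (chmap_cyc _ _) hs)) sgn0 scale1r -ex sx.
  by rewrite subrr.
exists (cin1 hs (x1 - x') + cin2 hs y1); rewrite linearD dif_cin1 dif_cin2 sgn0 scale1r.
rewrite [dif X (_ - _)]linearB /= dx1 -ex sub0r linearN opprK [tmap _ _ _]linearB /= linearB.
rewrite [LHS]cone_eta ex.
have -> : cpr2 hs z = tmap 0 s x1 + dif Y y1 - tmap 0 s x' by rewrite -ey addrK.
by rewrite !(linearB, linearD) /=; zmod.
Qed.

Section HpullTotal.
Variable A : pzRingType.
Variables (m : int) (U V Y : Db A) (f : gmap U Y) (t : gmap V Y).
Hypotheses (hf : chmap m f) (ht : chmap 0 t).
Notation H := (hpull hf ht).

Definition hin1_fun (u : tot U) : tot H := fun i => (u i, 0, 0).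
Definition hin2_fun (v : tot V) : tot H := fun i => (0, v (i + m), 0).
Definition hin3_fun (y : tot Y) : tot H := fun i => (0, 0, y (i + m - 1)).
Fact hin1_linear : linear hin1_fun.
Proof.
by move=> a x y; apply: funext_dep => i; rewrite !totalE /hin1_fun; congr (_, _, _);
   exact: esym (etrans (addr0 _) (scaler0 _ _)).
Qed.
Fact hin2_linear : linear hin2_fun.
Proof.
by move=> a x y; apply: funext_dep => i; rewrite !totalE /hin2_fun; congr (_, _, _);
   exact: esym (etrans (addr0 _) (scaler0 _ _)).
Qed.
Fact hin3_linear : linear hin3_fun.
Proof.
by move=> a x y; apply: funext_dep => i; rewrite !totalE /hin3_fun; congr (_, _, _);
   exact: esym (etrans (addr0 _) (scaler0 _ _)).
Qed.
HB.instance Definition _ := GRing.isLinear.Build A (tot U) (tot H) _ hin1_fun hin1_linear.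
HB.instance Definition _ := GRing.isLinear.Build A (tot V) (tot H) _ hin2_fun hin2_linear.
HB.instance Definition _ := GRing.isLinear.Build A (tot Y) (tot H) _ hin3_fun hin3_linear.
Definition hin1 : {linear tot U -> tot H} := locked (hin1_fun : {linear tot U -> tot H}).
Definition hin2 : {linear tot V -> tot H} := locked (hin2_fun : {linear tot V -> tot H}).
Definition hin3 : {linear tot Y -> tot H} := locked (hin3_fun : {linear tot Y -> tot H}).

Lemma hin1E u i : hin1 u i = (u i, 0, 0). Proof. by rewrite /hin1 -lock. Qed.
Lemma hin2E v i : hin2 v i = (0, v (i + m), 0). Proof. by rewrite /hin2 -lock. Qed.
Lemma hin3E y i : hin3 y i = (0, 0, y (i + m - 1)). Proof. by rewrite /hin3 -lock. Qed.

Lemma dif_hin1 u : dif H (hin1 u) = hin1 (dif U u) + hin3 (tmap m f u).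
Proof.
apply: funext_dep => j; rewrite (@difE _ _ _ (j - 1)) ?subrK // !totalE !hin1E hin3E hpull_diffE.
rewrite (@difE _ _ _ (j - 1)) ?subrK // (@tmapE _ _ _ _ _ _ (j - 1)); last by lia.
by congr (_, _, _); rewrite /= ?linear0 ?scaler0 ?subr0 ?addr0 ?add0r.
Qed.
Lemma dif_hin2 v : dif H (hin2 v) = sgn m *: hin2 (dif V v) - hin3 (tmap 0 t v).
Proof.
apply: funext_dep => j; rewrite (@difE _ _ _ (j - 1)) ?subrK // !totalE !hin2E hin3E hpull_diffE.
rewrite (@difE _ _ _ (j - 1 + m)); last by lia.
rewrite (@tmapE _ _ _ _ _ _ (j - 1 + m)); last by lia.
by congr (_, _, _); rewrite /= ?linear0 ?scaler0 ?subr0 ?addr0 ?add0r ?sub0r.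
Qed.
Lemma dif_hin3 y : dif H (hin3 y) = - (sgn m *: hin3 (dif Y y)).
Proof.
apply: funext_dep => j; rewrite (@difE _ _ _ (j - 1)) ?subrK // !totalE !hin3E hpull_diffE.
rewrite (@difE _ _ _ (j - 1 + m - 1)); last by lia.
by congr (_, _, _); rewrite /= ?linear0 ?scaler0 ?subr0 ?addr0 ?add0r ?sub0r ?oppr0.
Qed.
Lemma hg_hin1 : hg 0 hin1.
Proof. by move=> x j; rewrite hin1E subr0 => ->. Qed.
Lemma hg_hin2 : hg (- m) hin2.
Proof. by move=> x j; rewrite hin2E opprK => ->. Qed.
Lemma hg_hin3 : hg (1 - m) hin3.
Proof.
by move=> x j; rewrite hin3E opprB addrA => ->.
Qed.

Variable Z : Db A.
Variables (n : int).
Lemma tmap_hpull_l (g : gmap U Z) u v y :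
  tmap n (hpull_l hf ht g) (hin1 u + hin2 v + hin3 y) = tmap n g u.
Proof.
apply: funext_dep => j; rewrite !(@tmapE _ _ _ _ _ _ (j - n)) ?subrK //.
by rewrite /hpull_l /= hin1E hin2E hin3E /= !addr0.
Qed.
Lemma tmap_hpull_r (g : gmap V Z) u v y k : k = m + n ->
  tmap k (hpull_r hf ht g) (hin1 u + hin2 v + hin3 y) = tmap n g v.
Proof.
move=> ->; apply: funext_dep => j; rewrite [LHS](@tmapE _ _ _ _ _ _ (j - n - m)); last by lia.
rewrite [RHS](@tmapE _ _ _ _ _ _ (j - n - m + m)); last by lia.
by rewrite /hpull_r /= hin1E hin2E hin3E /= add0r addr0.
Qed.

End HpullTotal.

Section ShiftTotal.
Variable A : pzRingType.
Variable X : Db A.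
Definition sh_fun (x : tot X) : tot (shift X) := fun i => x (i + 1).
Definition unsh_fun (x : tot (shift X)) : tot X :=
  fun j => idx (ob X) (j - 1 + 1) j (x (j - 1)).
Fact sh_linear : linear sh_fun.
Proof. by move=> a x y; apply: funext_dep. Qed.
Fact unsh_linear : linear unsh_fun.
Proof.
move=> a x y; apply: funext_dep => i; rewrite !totalE /unsh_fun.
by rewrite -(linearP (idx (ob X) (i - 1 + 1) i)).
Qed.
HB.instance Definition _ := GRing.isLinear.Build A (tot X) (tot (shift X)) _ sh_fun sh_linear.
HB.instance Definition _ := GRing.isLinear.Build A (tot (shift X)) (tot X) _ unsh_fun unsh_linear.
Definition sh : {linear tot X -> tot (shift X)} := locked (sh_fun : {linear _ -> _}).
Definition unsh : {linear tot (shift X) -> tot X} := locked (unsh_fun : {linear _ -> _}).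
Lemma shE x i : sh x i = x (i + 1). Proof. by rewrite /sh -lock. Qed.
Lemma shK x : unsh (sh x) = x.
Proof.
apply: funext_dep => j; rewrite /unsh -lock /= /unsh_fun shE; apply: idx_at; lia.
Qed.
Lemma dif_sh x : dif (shift X) (sh x) = - sh (dif X x).
Proof.
apply: funext_dep => j; rewrite (@difE _ _ _ (j - 1)) ?subrK // totalE !shE shift_diffE.
rewrite sgn1 (@difE _ X _ (j - 1 + 1)); last by lia.
exact: scaleN1r.
Qed.
Lemma hg_sh : hg (-1) sh.
Proof. by move=> x j; rewrite shE opprK => ->. Qed.
Lemma cyc_sh : cyc (-1) sh.
Proof. by split=> [|x]; [exact: hg_sh|rewrite sgnN sgn1 scaleN1r dif_sh opprK]. Qed.
Lemma hg_unsh : hg 1 unsh.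
Proof. by move=> x j e; rewrite /unsh -lock /= /unsh_fun e linear0. Qed.
Lemma unshK x : sh (unsh x) = x.
Proof.
apply: funext_dep => j; rewrite shE /unsh -lock /= /unsh_fun.
have e : j + 1 - 1 = j by lia.
by move: (j + 1 - 1) e => k ->; exact: idxE.
Qed.
Lemma cyc_unsh : cyc 1 unsh.
Proof.
split=> [|x]; first exact: hg_unsh.
by rewrite -[x in LHS]unshK dif_sh linearN shK sgn1 scaleN1r.
Qed.
End ShiftTotal.

Lemma tmap_gshift (A : pzRingType) (X Y : Db A) n (f : gmap X Y) x :
  tmap n (gshift f) (sh X x) = sh Y (tmap n f x).
Proof.
apply: funext_dep => j; rewrite shE (@tmapE _ _ _ _ _ _ (j - n)) ?subrK // shE.
by rewrite (@tmapE _ _ _ _ _ _ (j - n + 1)) //; lia.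
Qed.

(** * Free modules and K-projective complexes *)

Section Free.
Variable A : pzRingType.

(** Freeness is generated by [fgprod] because the terms of a cone are literally of this form;
    lifting properties follow by induction, with no bases. *)
Inductive isfree : fgmod A -> Prop :=
| isfree0 : isfree (fgzero A)
| isfree1 : isfree (fgregular A)
| isfree_prod V W : isfree V -> isfree W -> isfree (fgprod V W).

Section Smul.
Variables (V : lmodType A) (v : V).
Definition smul_fun (a : A^o) : V := (a : A) *: v.
Fact smul_linear : linear smul_fun.
Proof. by move=> a x y; rewrite /smul_fun scalerDl scalerA. Qed.
HB.instance Definition _ := GRing.isLinear.Build A A^o V _ smul_fun smul_linear.
Definition smul : {linear A^o -> V} := smul_fun.
Lemma smulE a : smul a = (a : A) *: v. Proof. by []. Qed.
End Smul.

Lemma regular_linE (V : lmodType A) (f : {linear A^o -> V}) (a : A^o) :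
  f a = (a : A) *: f (1 : A).
Proof. by rewrite -linearZ /=; congr (f _); rewrite [RHS]mulr1. Qed.

Lemma pair_linE (U V W : lmodType A) (f : {linear (U * V)%type -> W}) x y :
  f (x, y) = f (x, 0) + f (0, y).
Proof. by rewrite -linearD; congr (f _); congr pair; rewrite /= ?addr0 ?add0r. Qed.

(** Lifting up to an error in [S] replaces lifting to a quotient module, so that quotients such as a
    simple factor [L' / L] never have to be formed. *)
Lemma free_lift_mod P : isfree P ->
  forall (U W : lmodType A) (al : {linear U -> W}) (S : W -> Prop) (ph : {linear P -> W}),
  submod S -> (forall x, exists u, S (ph x - al u)) ->
  exists ps : {linear P -> U}, forall x, S (ph x - al (ps x)).
Proof.
elim=> [|| P1 P2 _ IH1 _ IH2] U W al S ph sS h.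
- exists \0 => x; have -> : x = 0 by exact: thinmx0.
  by case: sS => S0 _ _ _; rewrite /= !linear0 ?addr0 ?subr0.
- have [u Su] := h (1 : A); exists (smul u) => x.
  rewrite smulE linearZ /= (regular_linE ph) -scalerBr; case: sS => _ _ _; exact.
- pose i1 : {linear P1 -> (P1 * P2)%type} := pair_map idfun \0.
  pose i2 : {linear P2 -> (P1 * P2)%type} := pair_map \0 idfun.
  have [|p1 h1] := IH1 U W al S (ph \o i1) sS; first by move=> x; exact: h.
  have [|p2 h2] := IH2 U W al S (ph \o i2) sS; first by move=> x; exact: h.
  exists ((p1 \o fst) \+ (p2 \o snd)) => -[x y] /=.
  rewrite (pair_linE ph) [al _]linearD; have [_ SD _ _] := sS.
  by rewrite opprD addrACA; apply: SD; [exact: h1|exact: h2].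
Qed.

Lemma submod0 (V : lmodType A) : submod (fun v : V => v = 0).
Proof.
split=> [//|x y -> ->|x ->|a x _ ->]; by rewrite ?addr0 ?oppr0 ?scaler0.
Qed.

Lemma free_lift P : isfree P ->
  forall (U W : lmodType A) (al : {linear U -> W}) (ph : {linear P -> W}),
  (forall x, exists u, al u = ph x) ->
  exists ps : {linear P -> U}, forall x, al (ps x) = ph x.
Proof.
move=> fP U W al ph h; have [|ps hps] := @free_lift_mod _ fP U W al _ ph (@submod0 W).
  by move=> x; have [u <-] := h x; exists u; rewrite subrr.
by exists ps => x; apply/esym/eqP; rewrite -subr_eq0; apply/eqP.
Qed.

End Free.

Section Bump.
Variables (A : pzRingType) (X Y : Db A) (i0 j0 : int) (psi : {linear X i0 -> Y j0}).
Definition bump : gmap X Y := fun i j =>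
  locked (idx (ob Y) j0 j \o psi \o idx (ob X) i i0 : {linear X i -> Y j}).
Lemma bumpE x : bump i0 j0 x = psi x.
Proof. by rewrite /bump -lock /= !idxE. Qed.
Lemma bump_ne i j x : i <> i0 -> bump i j x = 0.
Proof. by move=> ne; rewrite /bump -lock /= (idx_ne _ ne) !linear0. Qed.
Lemma bump_ne2 i j x : j <> j0 -> bump i j x = 0.
Proof. by move=> ne; rewrite /bump -lock /= idx_ne //; exact: nesym. Qed.
End Bump.

Section KProj.
Variable A : pzRingType.
Implicit Types P X Y D : Db A.

Definition frees P := forall i, isfree (P i).
Definition bdd (b : int) P := forall i, b < i -> forall x : P i, x = 0.

Definition kproj P := forall D, acy D -> forall n (F : {linear tot P -> tot D}),
  cyc n F -> htp n F \0.

Section Build.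
Variables (P D : Db A) (b n : int) (f : gmap P D).
Hypotheses (fP : frees P) (bP : bdd b P) (aD : acy D) (hf : chmap n f).

Definition htp_at (h : gmap P D) (i : int) := forall i' j j' : int,
  i' = i + 1 -> j = i + n -> j = j' + 1 -> forall x,
  f i j x = diff D j' j (h i j' x) + sgn n *: h i' j (diff P i i' x).

Definition htp_upto (h : gmap P D) (k : nat) :=
  (forall i, b - k%:Z < i -> htp_at h i) /\
  (forall i j x, i <= b - k%:Z -> h i j x = 0).

(** The hypothesis on [h] stands under the existential quantifier, so that a choice of [h'] for
    every [h] can be iterated in [htp_build]. *)
Lemma htp_step (k : nat) (h : gmap P D) : exists h', htp_upto h k -> htp_upto h' k.+1 /\
  forall i j x, b - k%:Z < i -> h' i j x = h i j x.
Proof.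
have [[hk hz]|nh] := pselect (htp_upto h k); last by exists h.
pose i := b - k%:Z.
(* The defect [ph] takes values in cycles, by the homotopy equation already known in degree [i + 1].
   Acyclicity of [D] makes them boundaries, and freeness of [P i] lifts them linearly. *)
pose ph : {linear P i -> D (i + n)} :=
  f i (i + n) \- sgn_map n (h (i + 1) (i + n) \o diff P i (i + 1)).
have phE x : ph x = f i (i + n) x - sgn n *: h (i + 1) (i + n) (diff P i (i + 1) x) by [].
have [|psi hpsi] := @free_lift _ _ (fP i) _ _ (diff D (i + n - 1) (i + n)) ph.
  move=> x; have [|||y ey] := acy_exact aD (i := i + n) (h := i + n - 1) (k := i + n + 1) _ _ (x := ph x).
  - by lia.
  - by lia.
  - rewrite phE linearB linearZ /=.
    rewrite -[X in X - _](sgnM n) -(hf (i := i) (i' := i + 1)) //.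
    rewrite (@hk (i + 1) _ (i + 1 + 1) (i + n + 1) (i + n)) //; try (rewrite /i; lia).
    by rewrite diffK // linear0 scaler0 addr0 subrr.
  - by exists y.
exists (gadd h (bump psi)) => _; split; last first.
  move=> i1 j x lt_i /=; rewrite bump_ne ?addr0 //; rewrite /i; lia.
split=> [i1 lt_i|i1 j x le_i]; last first.
  rewrite /= bump_ne ?hz ?addr0 //; rewrite /i; lia.
move=> i' j j' -> ij jj' x /=; rewrite [bump psi (i1 + 1) _ _]bump_ne ?addr0; last first.
  rewrite /i; lia.
have [e|ne] := pselect (i1 = i); last first.
  rewrite bump_ne // addr0; apply: hk => //; rewrite -/i; move: lt_i ne; rewrite /i; lia.
subst i1; have e1 : j = i + n by []. have e2 : j' = i + n - 1 by lia.
subst j j'; rewrite bumpE hz // add0r hpsi phE.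
by rewrite subrK.
Qed.

Lemma htp_build : homotopic n f (@gzero A P D).
Proof.
pose H := fix H k := if k is k'.+1 then sval (cid (htp_step k' (H k'))) else @gzero A P D.
have H0 : htp_upto (H 0%N) 0.
  split=> // i ib i' j j' _ _ _ x; have -> : x = 0 by apply: bP; rewrite subr0 in ib.
  by rewrite /= !linear0 scaler0 addr0.
have HS k : htp_upto (H k) k -> htp_upto (H k.+1) k.+1 /\
    forall i j x, b - k%:Z < i -> H k.+1 i j x = H k i j x.
  by rewrite /=; case: (cid _).
have Hk k : htp_upto (H k) k by elim: k => [//|k /HS []].
have Hm k m i j x : b - k%:Z < i -> H (m + k)%N i j x = H k i j x.
  move=> ki; elim: m => // m <-; rewrite addSn; apply: (HS _ (Hk _)).2; lia.
(* [H k] no longer changes in degrees above [b - k], so its column [i] is final from step [K i] on;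
   the homotopy is read off along this diagonal. *)
pose K i := if b < i then 0%N else `|b - i|%N.+1.
have Ki i : b - (K i)%:Z < i by rewrite /K; case: ifP; lia.
exists (fun i j => H (K i) i j) => i i' j j' ii' ij jj' x.
rewrite subr0 -(Hm _ (K i')) // -[in X in _ + X](Hm (K i') (K i)); last by [].
rewrite [in X in _ + X]addnC; apply: (Hk (K i' + K i)%N).1 => //; have := Ki i; lia.
Qed.

End Build.

Lemma frees_kproj P b : frees P -> bdd b P -> kproj P.
Proof.
move=> fP bP D aD n F cF.
have /homotopicE h := htp_build fP bP aD (ent_chmap cF).
by apply: eq_htp h => x; rewrite ?tmap_gzero // tmap_ent //; exact: cF.1.
Qed.

(** In the acyclic cone of [s] the map [F] becomes null-homotopic. The first component of a
    null-homotopy is the lift, the second one the homotopy between [F] and the lift followed by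
    [s]. *)
Lemma kproj_lift P X' X (s : gmap X' X) n (F : {linear tot P -> tot X}) :
  kproj P -> quasi_iso s -> cyc n F ->
  exists F' : {linear tot P -> tot X'}, cyc n F' /\ htp n (tmap 0 s \o F') F.
Proof.
move=> kP /quasi_isoP [cs qs] cF.
have [|H [hH eH]] := kP _ (acy_cone (hs := cs) qs) n (cin2 cs \o F).
  by apply: (cyc_comp _ cF (cyc_cin2 cs)); rewrite oppr0 addr0.
have e1 x := congr1 (cpr1 cs) (eH x); have e2 x := congr1 (cpr2 cs) (eH x).
exists (cpr1 cs \o H); split; first split=> [|x].
- by apply: (@hg_comp _ (n - 1) 1); [lia|exact: hH|exact: hg_cpr1].
- move: (e1 x); rewrite /= subr0 linearD cpr1_in2 cpr1_dif linearZ /= => /esym/eqP.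
  by rewrite addrC subr_eq0 => /eqP <-; rewrite sgnM.
apply: htp_sym; exists (cpr2 cs \o H); split=> [|x].
  by apply: (@hg_comp _ (n - 1) 0); [lia|exact: hH|exact: hg_cpr2].
move: (e2 x); rewrite /= subr0 linearD cpr2_in2 cpr2_dif sgn0 scale1r linearZ /= => ->.
by zmod.
Qed.

(** [F1 - F2] and the given homotopy [H] are the two components of a cycle [T] with values in the
    acyclic cone of [s]; the first component of a null-homotopy of [T] is the homotopy wanted. *)
Lemma kproj_uniq P X' X (s : gmap X' X) n (F1 F2 : {linear tot P -> tot X'}) :
  kproj P -> quasi_iso s -> cyc n F1 -> cyc n F2 ->
  htp n (tmap 0 s \o F1) (tmap 0 s \o F2) -> htp n F1 F2.
Proof.
move=> kP /quasi_isoP [cs qs] c1 c2 [H [hH eH]].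
pose T : {linear tot P -> tot (cone cs)} := (cin1 cs \o (F1 \- F2)) \- (cin2 cs \o H).
have cT : cyc (n - 1) T.
  split=> [|x].
    apply: hgB.
    - by apply: (@hg_comp _ n (-1)) => //; [exact: (cycB c1 c2).1|exact: hg_cin1].
    - apply: (@hg_comp _ (n - 1) (- 0)); [lia|exact: hH|exact: hg_cin2].
  rewrite /T /= [dif (cone cs) _]linearB /= dif_cin1 dif_cin2 sgn0 scale1r [tmap _ _ _]linearB /=.
  move: (eH x) => /= ->; rewrite c1.2 c2.2 sgnD sgnN sgn1 mulrN1.
  rewrite !(linearB, linearD) /= ![_ (sgn n *: _)]linearZ /=.
  by case: (sgn_or A n) => ->; rewrite ?opprK ?scaleN1r ?scale1r; zmod.
have [K [hK eK]] := kP _ (acy_cone (hs := cs) qs) _ T cT.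
exists (sgn_map 1 (cpr1 cs \o K)); split=> [|x].
  apply: hg_sgn; apply: (@hg_comp _ (n - 1 - 1) 1); [lia|exact: hK|exact: hg_cpr1].
have := congr1 (cpr1 cs) (eK x); rewrite /T /= subr0 linearB cpr1_in1 cpr1_in2 subr0 => ->.
rewrite linearD cpr1_dif linearZ /= sgnD sgnN sgn1 mulrN1 !sgn_mapE sgn1 !scaleN1r /=.
by rewrite [dif _ (- _)]linearN scalerN scaleNr.
Qed.

End KProj.

(** * Morphisms of the derived category *)

Section Rel.
Variable A : pzRingType.
Implicit Types P X Y Z : Db A.

(* [F'] represents the composite of the roof [v] with the class of [F]. *)
Definition rel n Y Z (v : dmor n Y Z) (m : int) P (F : tot P -> tot Y) (F' : tot P -> tot Z) :=
  exists G : {linear tot P -> tot (apex v)}, [/\ cyc m G,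
    htp m (tmap 0 (den v) \o G) F & htp (m + n) (tmap n (num v) \o G) F'].

Lemma num_cyc n Y Z (v : dmor n Y Z) : cyc n (tmap n (num v)).
Proof. by apply/chmap_cyc => *; exact: numP. Qed.

Lemma den_cyc n Y Z (v : dmor n Y Z) : cyc 0 (tmap 0 (den v)).
Proof. by apply/chmap_cyc; case: (denP v). Qed.

Lemma qis_htp X Y (F G : tot X -> tot Y) : htp 0 F G -> qis F -> qis G.
Proof.
move=> [H [hH]]; rewrite sgn0 => e [q1 q2].
have {}e x : dif X x = 0 -> F x = G x + dif Y (H x).
  by move=> dx; apply/eqP; rewrite addrC -subr_eq e dx linear0 scaler0 addr0.
split=> [x dx [y ey]|y dy].
  by apply: q1 => //; exists (y + H x); rewrite e // ey linearD.
have [x [y' [dx ->]]] := q2 y dy; exists x, (H x + y'); split=> //.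
by rewrite e // linearD addrA.
Qed.

Lemma quasi_iso_ent X Y (F : {linear tot X -> tot Y}) : cyc 0 F -> qis F -> quasi_iso (ent F).
Proof.
move=> cF qF; apply/quasi_isoP; split; first exact: ent_chmap.
apply: qis_htp qF; apply: eq1_htp => x; rewrite tmap_ent //; exact: cF.1.
Qed.

Lemma rel_cyc n Y Z (v : dmor n Y Z) m P F (F' : {linear tot P -> tot Z}) :
  rel v m F F' -> cyc (m + n) F'.
Proof.
by move=> [G [cG _ /cyc_htp]]; apply; apply: cyc_comp cG (num_cyc v).
Qed.

Lemma rel_cycl n Y Z (v : dmor n Y Z) m P (F : {linear tot P -> tot Y}) F' :
  rel v m F F' -> cyc m F.
Proof.
by move=> [G [cG /cyc_htp h _]]; apply: h; apply: (cyc_comp _ cG (den_cyc v)); rewrite addr0.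
Qed.

Lemma rel_htpl n Y Z (v : dmor n Y Z) m P (F F1 : tot P -> tot Y) (F' : tot P -> tot Z) :
  htp m F F1 -> rel v m F F' -> rel v m F1 F'.
Proof. by move=> h [G [cG h1 h2]]; exists G; split=> //; exact: htp_trans h1 h. Qed.

Lemma rel_htpr n Y Z (v : dmor n Y Z) m P (F : tot P -> tot Y) (F' F1 : tot P -> tot Z) :
  htp (m + n) F' F1 -> rel v m F F' -> rel v m F F1.
Proof. by move=> h [G [cG h1 h2]]; exists G; split=> //; exact: htp_trans h2 h. Qed.

Lemma rel_ex n Y Z (v : dmor n Y Z) m P (F : {linear tot P -> tot Y}) :
  kproj P -> cyc m F -> exists F' : {linear tot P -> tot Z}, rel v m F F'.
Proof.
move=> kP cF; have [G [cG hG]] := kproj_lift kP (denP v) cF.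
by exists (tmap n (num v) \o G), G; split=> //; exact: htp_refl.
Qed.

(** Lifts through the quasi-isomorphism [den v] are unique up to homotopy. *)
Lemma rel_uniq n Y Z (v : dmor n Y Z) m P (F F1 : tot P -> tot Y) (F' F1' : tot P -> tot Z) :
  kproj P -> htp m F F1 -> rel v m F F' -> rel v m F1 F1' -> htp (m + n) F' F1'.
Proof.
move=> kP h [G [cG h1 h2]] [G1 [cG1 h1' h2']].
have hG : htp m G G1.
  apply: (kproj_uniq kP (denP v)) => //.
  exact: htp_trans (htp_trans h1 h) (htp_sym h1').
apply: htp_trans (htp_sym h2) (htp_trans _ h2').
exact: htp_compl (num_cyc v) hG.
Qed.

Lemma dmor_eq_sym n n' X Y (u : dmor n X Y) (v : dmor n' X Y) : u =D v -> v =D u.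
Proof.
move=> [e [C [a [b [ca cb qa hd hn]]]]]; subst n'; split=> //.
exists C, b, a; split=> //; last 2 first.
- by apply/homotopicE/htp_sym/homotopicE.
- by apply/homotopicE/htp_sym/homotopicE.
have [_ qa'] := proj1 (quasi_isoP _) qa.
apply/quasi_isoP; split; last by apply: qis_htp qa'; apply/homotopicE.
apply/chmap_cyc; apply: (eq_cyc _ (cyc_comp _ (proj1 (chmap_cyc _ _) cb) (den_cyc v))).
  by apply: fsym; exact: tmap_gcomp.
by rewrite addr0.
Qed.

(** [F] is lifted to the common refinement [C] of the two roofs. Its image in the apex of [v] agrees
    with [G] up to homotopy by uniqueness of lifts, and its image in the apex of [v'] is the lift
    required. *)
Lemma rel_eqD n n' Y Z (v : dmor n Y Z) (v' : dmor n' Y Z) m P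
    (F : {linear tot P -> tot Y}) (F' : tot P -> tot Z) :
  kproj P -> v =D v' -> rel v m F F' -> rel v' m F F'.
Proof.
move=> kP [e [C [a [b [/chmap_cyc ca /chmap_cyc cb qa /homotopicE hd /homotopicE hn]]]]] r.
subst n'; have cF := rel_cycl r; case: r => G [cG h1 h2].
have [c [cc hc]] := kproj_lift kP qa cF.
have cac : cyc m (tmap 0 a \o c) by apply: (cyc_comp _ cc ca); rewrite addr0.
have hac : htp m (tmap 0 a \o c) G.
  apply: (kproj_uniq kP (denP v) cac cG); apply: htp_trans (htp_sym h1).
  apply: (eq_htp _ (fun=> erefl) hc) => x /=.
  by rewrite (@tmap_gcomp _ 0 0 0).
exists (tmap 0 b \o c); split; first by apply: (cyc_comp _ cc cb); rewrite addr0.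
- apply: htp_trans hc; apply: (@eq_htp _ _ _ _ (tmap 0 (gcomp 0 (den v') b) \o c) _
    (tmap 0 (gcomp 0 (den v) a) \o c)) => [x|//|].
    by rewrite /= (@tmap_gcomp _ 0 0 0).
  by apply: (htp_compr _ cc (htp_sym hd)); rewrite addr0.
- apply: htp_trans h2.
  apply: (@htp_trans _ _ _ _ _ (tmap n (num v) \o (tmap 0 a \o c))); last first.
    exact: htp_compl (num_cyc v) hac.
  apply: (@eq_htp _ _ _ _ (tmap n (gcomp 0 (num v') b) \o c) _
    (tmap n (gcomp 0 (num v) a) \o c)) => [x|x|].
  + by rewrite /= (@tmap_gcomp _ 0 n) // add0r.
  + by rewrite /= (@tmap_gcomp _ 0 n) // add0r.
  + exact: htp_compr cc (htp_sym hn).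
Qed.

(** A homotopy between the two composites is, up to sign, the third component of a chain map into
    the homotopy pullback. It is left unspecified as [y], since [hpull_l] and [hpull_r] do not see
    it. *)
Lemma hpull_map k U V Y (f : gmap U Y) (t : gmap V Y) (hf : chmap k f) (ht : chmap 0 t)
    m P (G : {linear tot P -> tot U}) (G' : {linear tot P -> tot V}) :
  cyc m G -> cyc (m + k) G' -> htp (m + k) (tmap k f \o G) (tmap 0 t \o G') ->
  exists Phi : {linear tot P -> tot (hpull hf ht)}, cyc m Phi /\
    forall x, exists y, Phi x = hin1 hf ht (G x) + hin2 hf ht (G' x) + hin3 hf ht y.
Proof.
move=> [hG cG] [hG' cG'] [h [hh eh]].
exists ((hin1 hf ht \o G) \+ (hin2 hf ht \o G') \+ (hin3 hf ht \o sgn_map k h)).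
split; last by move=> x; exists (sgn_map k h x).
split=> [|x].
  apply: hgD; first apply: hgD.
  - by apply: (@hg_comp _ m 0); [rewrite addr0|exact: hG|exact: hg_hin1].
  - by apply: (@hg_comp _ (m + k) (- k)); [rewrite addrK|exact: hG'|exact: hg_hin2].
  - apply: (@hg_comp _ (m + k - 1) (1 - k)); [lia|exact: hg_sgn|exact: hg_hin3].
have {eh}e := eh x.
rewrite /= !sgn_mapE [dif _ (_ + _)]linearD [dif _ (_ + _)]linearD /= dif_hin1 dif_hin2 dif_hin3.
rewrite cG cG' [dif Y _]linearZ /= ![hin3 _ _ (_ *: _)]linearZ /= sgnM.
rewrite [hin1 _ _ (_ *: _)]linearZ [hin2 _ _ (_ *: _)]linearZ /=.
have -> : hin1 hf ht (dif U (G x)) + hin3 hf ht (tmap k f (G x)) +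
     (sgn k *: hin2 hf ht (dif V (G' x)) - hin3 hf ht (tmap 0 t (G' x))) -
     hin3 hf ht (dif Y (h x)) =
   hin1 hf ht (dif U (G x)) + sgn k *: hin2 hf ht (dif V (G' x)) +
   (hin3 hf ht (tmap k f (G x) - tmap 0 t (G' x)) - hin3 hf ht (dif Y (h x))).
  by rewrite [hin3 _ _ (_ - _)]linearB /=; zmod.
move: e => /= ->; have -> : hin3 hf ht (dif Y (h x) + sgn (m + k) *: h (dif P x)) - hin3 hf ht (dif Y (h x)) =
    sgn (m + k) *: hin3 hf ht (h (dif P x)).
  by rewrite [hin3 _ _ (_ + _)]linearD [hin3 _ _ (_ *: _)]linearZ /=; zmod.
rewrite !scalerDr !scalerA !sgnD.
by case: (sgn_or A m) => ->; case: (sgn_or A k) => ->; rewrite ?mulN1r ?opprK ?mul1r.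
Qed.

Lemma rel_comp k l X Y Z (u : dmor k X Y) (v : dmor l Y Z) m P
    (F : tot P -> tot X) (F' : tot P -> tot Y) (F'' : tot P -> tot Z) :
  rel u m F F' -> rel v (m + k) F' F'' -> rel (dcomp v u) m F F''.
Proof.
move=> [G [cG h1 h2]] [G' [cG' h1' h2']].
have [|Phi [cPhi ePhi]] := hpull_map (fun i i' j j' => numP u i i' j j') (denP v).1 cG cG'.
  exact: htp_trans h2 (htp_sym h1').
exists Phi; split=> //.
  apply: eq_htp h1 => // x /=; have [y ->] := ePhi x.
  by rewrite -[in LHS](tmap_hpull_l (numP u) (denP v).1 0 (den u) (G x) (G' x) y).
rewrite addrA; apply: eq_htp h2' => // x /=; have [y ->] := ePhi x.
by rewrite -(tmap_hpull_r (numP u) (denP v).1 (num v) (G x) (G' x) y erefl).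
Qed.

Lemma rel_dadd k X Y (u v : dmor k X Y) m P
    (F : tot P -> tot X) (F1 F2 : tot P -> tot Y) :
  rel u m F F1 -> rel v m F F2 -> rel (dadd u v) m F (F1 \+ F2).
Proof.
move=> [G [cG h1 h2]] [G' [cG' h1' h2']].
have [||Phi [cPhi ePhi]] := @hpull_map _ _ _ _ _ _ (denP u).1 (denP v).1 m P G G' cG.
- by rewrite addr0.
- by rewrite addr0; exact: htp_trans h1 (htp_sym h1').
exists Phi; split=> //.
  apply: eq_htp h1 => // x /=; have [y ->] := ePhi x.
  by rewrite -[in LHS](tmap_hpull_l (denP u).1 (denP v).1 0 (den u) (G x) (G' x) y).
apply: eq_htp (htpD h2 h2') => // x /=; have [y ->] := ePhi x.
rewrite tmap_gadd /= tmap_hpull_l.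
by rewrite (tmap_hpull_r (denP u).1 (denP v).1 (num v) (G x) (G' x) y (esym (add0r k))).
Qed.

Lemma rel_dzero n X Y m P (F : {linear tot P -> tot X}) :
  cyc m F -> rel (dzero n X Y) m F \0.
Proof.
move=> cF; exists F; split=> //.
  by apply: eq1_htp => x /=; rewrite tmap_gid.
by apply: eq1_htp => x /=; rewrite tmap_gzero.
Qed.

Definition resol P X (pi : tot P -> tot X) := [/\ kproj P, cyc 0 pi & qis pi].

Definition Hom_zero P (n : int) Y := forall F : {linear tot P -> tot Y}, cyc n F -> htp n F \0.

Section Resolved.
Variables (P X : Db A) (pi : {linear tot P -> tot X}) (rP : resol pi).

(** The resolution [P] itself is the common refinement of the two roofs. *)
Lemma rel_mk n Y (u v : dmor n X Y) (F F' : tot P -> tot Y) :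
  htp n F F' -> rel u 0 pi F -> rel v 0 pi F' -> u =D v.
Proof.
case: rP => kP cpi qpi h [G []] cG hG hG' [G1 [cG1 hG1 hG1']].
rewrite add0r in hG' hG1'.
have E (V W : Db A) k (w : dmor k V W) Z (w' : gmap (apex w) Z) l
    (K : {linear tot P -> tot (apex w)}) : cyc 0 K ->
    tmap l (gcomp 0 w' (ent K)) =1 tmap l w' \o K.
  move=> cK x; rewrite (@tmap_gcomp _ 0 l) ?add0r //= tmap_ent //; exact: cK.1.
split=> //; exists P, (ent G), (ent G1); split; try exact: ent_chmap.
- apply/quasi_isoP; split.
    apply/chmap_cyc; apply: (eq_cyc (fsym (E _ _ _ u _ _ _ _ cG))).
    by apply: (cyc_comp _ cG (den_cyc u)); rewrite addr0.
  by apply: qis_htp qpi; apply: eq_htp (htp_sym hG) => // x; rewrite E.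
- apply/homotopicE; apply: (eq_htp (fsym (E _ _ _ u _ _ _ _ cG)) (fsym (E _ _ _ v _ _ _ _ cG1))).
  exact: htp_trans hG (htp_sym hG1).
- apply/homotopicE; apply: (eq_htp (fsym (E _ _ _ u _ _ _ _ cG)) (fsym (E _ _ _ v _ _ _ _ cG1))).
  exact: htp_trans hG' (htp_trans h (htp_sym hG1')).
Qed.

Lemma rep_ex n Y (u : dmor n X Y) :
  exists F : {linear tot P -> tot Y}, rel u 0 pi F /\ cyc n F.
Proof.
case: rP => kP cpi _; have [F hF] := rel_ex u kP cpi; exists F; split=> //.
by have := rel_cyc hF; rewrite add0r.
Qed.

Lemma dzeroP n Y (u : dmor n X Y) :
  u =D dzero n X Y <-> forall F : {linear tot P -> tot Y}, rel u 0 pi F -> htp n F \0.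
Proof.
have [kP cpi _] := rP; have r0 := rel_dzero n Y cpi.
split=> [e F hF|h].
  rewrite -[n]add0r.
  exact: rel_uniq kP (htp_refl _ _) (rel_eqD kP e hF) r0.
by have [F [hF _]] := rep_ex u; exact: rel_mk (h _ hF) hF r0.
Qed.

Lemma dzeroP1 n Y (u : dmor n X Y) (F : tot P -> tot Y) :
  rel u 0 pi F -> htp n F \0 -> u =D dzero n X Y.
Proof.
have [kP cpi _] := rP; have r0 := rel_dzero n Y cpi.
by move=> hF h; exact: rel_mk h hF r0.
Qed.

Lemma pi_qiso : quasi_iso (ent pi).
Proof. by case: rP => _; exact: quasi_iso_ent. Qed.

Definition roof n Y (F : {linear tot P -> tot Y}) (cF : cyc n F) : dmor n X Y :=
  Roof pi_qiso (ent_chmap cF).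

Lemma rel_roof n Y (F : {linear tot P -> tot Y}) (cF : cyc n F) : rel (roof cF) 0 pi F.
Proof.
case: rP => kP [hpi cpi] _; exists idfun; split; first exact: cyc_id.
  by apply: eq1_htp => x /=; rewrite tmap_ent.
by apply: eq1_htp => x /=; rewrite tmap_ent //; exact: cF.1.
Qed.

Lemma Hom_zeroP n Y : (forall u : dmor n X Y, u =D dzero n X Y) <-> Hom_zero P n Y.
Proof.
split=> [h F cF|h u]; first by apply: (proj1 (dzeroP (roof cF)) (h _)); exact: rel_roof.
by apply/dzeroP => F /rel_cyc; rewrite add0r; exact: h.
Qed.

End Resolved.

End Rel.

(** * Shifts and naturality of the action in positive degrees *)

Section ShiftRel.
Variable A : pzRingType.
Implicit Types P X Y Z : Db A.

Definition ushg X Y (f : gmap X Y) : gmap X (shift Y) := fun i j => f i (j + 1).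

Lemma tmap_ushg k n X Y (f : gmap X Y) x : k = n + 1 ->
  tmap n (ushg f) x = sh Y (tmap k f x).
Proof.
move=> ->; apply: funext_dep => j; rewrite shE (@tmapE _ _ _ _ _ _ (j - n)) ?subrK //.
by rewrite (@tmapE _ _ _ _ _ _ (j - n)) //; lia.
Qed.

Lemma ushg_chmap k n X Y (f : gmap X Y) : k = n + 1 -> chmap k f -> chmap n (ushg f).
Proof.
move=> e /chmap_cyc cf; apply/chmap_cyc.
apply: (@eq_cyc _ _ _ _ (sh Y \o tmap k f)) => [x|]; first by rewrite (tmap_ushg _ _ e).
by apply: (cyc_comp _ cf (cyc_sh Y)); rewrite e addrK.
Qed.

(* [X -> Sigma^(n+1) Y] seen as a morphism [X -> Sigma^n (Sigma Y)]. *)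
Definition ush k n X Y (e : k = n + 1) (u : dmor k X Y) : dmor n X (shift Y) :=
  Roof (denP u) (ushg_chmap e (fun i i' j j' => numP u i i' j j')).

Lemma rel_ush k n X Y (e : k = n + 1) (u : dmor k X Y) m P (F : tot P -> tot X)
    (F' : tot P -> tot Y) :
  rel u m F F' -> rel (ush e u) m F (sh Y \o F').
Proof.
move=> [G [cG h1 h2]]; exists G; split=> //.
apply: (@eq_htp _ _ _ _ (sh Y \o (tmap k (num u) \o G))) => [x|//|].
  by rewrite /= (tmap_ushg _ _ e).
by apply: (htp_compl _ (cyc_sh Y) h2); rewrite e addrA addrK.
Qed.

Lemma rel_dshift n X Y (v : dmor n X Y) m m' P (F : tot P -> tot X) (F' : tot P -> tot Y) :
  m = m' + 1 -> rel v m F F' -> rel (dshift v) m' (sh X \o F) (sh Y \o F').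
Proof.
move=> e [G [cG h1 h2]]; exists (sh (apex v) \o G); split.
- by apply: (cyc_comp _ cG (cyc_sh _)); rewrite e addrK.
- apply: (@eq_htp _ _ _ _ (sh X \o (tmap 0 (den v) \o G))) => [x|//|].
    by rewrite /= tmap_gshift.
  by apply: (htp_compl _ (cyc_sh X) h1); rewrite e addrK.
- apply: (@eq_htp _ _ _ _ (sh Y \o (tmap n (num v) \o G))) => [x|//|].
    by rewrite /= tmap_gshift.
  by apply: (htp_compl _ (cyc_sh Y) h2); rewrite e addrAC addrK.
Qed.

Lemma rel_dopp n X Y (v : dmor n X Y) m P (F : tot P -> tot X) (F' : tot P -> tot Y) :
  rel v m F F' -> rel (dopp v) m F (fun x => - F' x).
Proof.
move=> [G [cG h1 h2]]; exists G; split=> //.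
by apply: (eq_htp _ _ (htpN h2)) => x //=; rewrite tmap_gopp.
Qed.

End ShiftRel.

Lemma sgn_map1E (A : pzRingType) (V W : lmodType A) (F : {linear V -> W}) x :
  sgn_map 1 F x = - F x.
Proof. by rewrite sgn_mapE sgn1 scaleN1r. Qed.

Section Natural.
Variables (A : pzRingType) (R : gcring) (phi : central_action R A).
Implicit Types P X Y : Db A.

(** Induction on the degree [i]: a morphism of degree [i + 1] to [Y] is one of degree [i] to
    [shift Y], and in degree 0 [act_natural] applies. By [act_shift] each step contributes a sign
    depending on the parity of [m], which is not recorded. *)
Lemma act_natural_rel P X (pi : {linear tot P -> tot X}) m r (i : nat) Y
    (u : dmor i%:Z X Y) (F : {linear tot P -> tot Y}) (F' : {linear tot P -> tot Y})
    (b : {linear tot P -> tot X}) (F'' : {linear tot P -> tot Y}) :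
  resol pi -> homog m r -> rel u 0 pi F -> rel (phi m r Y) i%:Z F F' ->
  rel (phi m r X) 0 pi b -> rel u m%:Z b F'' ->
  htp (i%:Z + m%:Z) F'' F' \/ htp (i%:Z + m%:Z) F'' (fun x => - F' x).
Proof.
move=> rpi hr; have [kP cpi _] := rpi.
elim: i Y u F F' F'' => [|i IH] Y u F F' F'' r1 r2 r3 r4.
  left; rewrite add0r; have e := act_natural phi hr u.
  have r2' : rel (phi m r Y) (0 + 0) F F' by rewrite addr0.
  have r4' : rel u (0 + m%:Z) b F'' by rewrite add0r.
  have := rel_uniq kP (htp_refl _ _) (rel_comp r3 r4') (rel_eqD kP e (rel_comp r1 r2')).
  by rewrite add0r addr0.
have e : i.+1%:Z = i%:Z + 1 by lia.
have s1 := rel_ush e r1; have s4 := rel_ush e r4.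
have s2 := rel_dshift e r2.
have [F1 [hF1 r2']] : exists F1 : {linear tot P -> tot Y}, (F1 =1 F' \/ F1 =1 (fun x => - F' x)) /\
    rel (phi m r (shift Y)) i%:Z (sh Y \o F) (sh Y \o F1).
  have := act_shift phi hr Y => /dmor_eq_sym ea.
  case: (odd m) ea => ea.
    exists (sgn_map 1 F'); split; first by right=> x; rewrite /= sgn_map1E.
    apply: (rel_eqD kP ea); apply: rel_htpr (rel_dopp s2); apply: eq1_htp => x /=.
    by rewrite sgn_map1E linearN.
  by exists F'; split; [left|exact: rel_eqD kP ea s2].
(* A homotopy between the shifted maps is brought back by [unsh], the inverse of [sh]. *)
have back (K : {linear tot P -> tot Y}) : htp (i%:Z + m%:Z) (sh Y \o F'') (sh Y \o K) ->
    htp (i.+1%:Z + m%:Z) F'' K.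
  move=> h; apply: (@eq_htp _ _ _ _ (unsh Y \o (sh Y \o F'')) _ (unsh Y \o (sh Y \o K))).
  - by move=> x /=; rewrite shK.
  - by move=> x /=; rewrite shK.
  - by apply: (htp_compl _ (cyc_unsh Y) h); lia.
have [h|h] := IH _ _ _ _ _ s1 r2' r3 s4.
  by have := back _ h; case: hF1 => hF1 /(eq_htp (fun=> erefl) hF1); [left|right].
have {}h : htp (i%:Z + m%:Z) (sh Y \o F'') (sh Y \o sgn_map 1 F1).
  by apply: eq_htp h => // x /=; rewrite sgn_map1E linearN.
have := back _ h; case: hF1 => hF1 h'; [right|left]; apply: eq_htp h' => // x /=.
  by rewrite sgn_map1E hF1.
by rewrite sgn_map1E hF1 opprK.
Qed.

End Natural.

(** * The ascending chain condition for graded submodules of Hom *)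

Section GradedNoetherian.
Variables (A : pzRingType) (R : gcring) (phi : central_action R A) (T : Db A).
Implicit Types P X Y : Db A.

(* Graded R-submodules of [Hom^*(P, T)].  [R] acts through the target [T], so that
  precomposition with chain maps of any degree is R-linear. *)
Definition gsub P (C : int -> {linear tot P -> tot T} -> Prop) :=
  [/\ forall i F, C i F -> cyc i F,
      forall i (F G : {linear tot P -> tot T}), C i F -> htp i F G -> C i G,
      forall i, C i \0,
      forall i F G, C i F -> C i G -> C i (F \+ G) &
      (forall i F, C i F -> C i (sgn_map 1 F)) /\
      forall m r i (F F' : {linear tot P -> tot T}), homog m r ->
        C i F -> rel (phi m r T) i F F' -> C (i + m%:Z) F'].

(** The truncation concerns only the comparison of the chain, with one [N] for all degrees from [n0]
    on; the submodules themselves live in all degrees. *)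
Definition gnoeth P := exists n0 : int, forall C : nat -> int -> {linear tot P -> tot T} -> Prop,
  (forall k, gsub (C k)) -> (forall k i F, C k i F -> C k.+1 i F) ->
  exists N, forall k i F, (N <= k)%N -> n0 <= i -> C k i F -> C N i F.

Lemma chain_le P (C : nat -> int -> {linear tot P -> tot T} -> Prop) :
  (forall k i F, C k i F -> C k.+1 i F) ->
  forall k l i F, (k <= l)%N -> C k i F -> C l i F.
Proof.
move=> hC k l i F /subnK <-; elim: (l - k)%N => [//|d IH] /IH; rewrite addSn; exact: hC.
Qed.

Lemma gnoeth_of P X (pi : {linear tot P -> tot X}) :
  resol pi -> ev_noetherian_fin_length phi X T -> gnoeth P.
Proof.
move=> rpi [n0 [noeth _]]; have [kP cpi _] := rpi.
(* The cut is moved up to a nonnegative degree, where [act_natural_rel] exchanges the given action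
   through the source with the action through the target. *)
pose n1 : int := `|n0|%N.
have n10 : n0 <= n1 by rewrite /n1; lia.
have n1_ge0 : 0 <= n1 by [].
exists n1 => C gC hC.
pose Zr i (u : dmor i X T) := forall F : {linear tot P -> tot T}, rel u 0 pi F -> htp i F \0.
(* The finite families attached to [C k]: zero below [n1] and in large degrees, with representatives
   in [C k] from [n1] on. *)
pose S k (u : forall i : int, dmor i X T) :=
  (exists N : int, forall i, (i < n1) || (N < i) -> Zr i (u i)) /\
  (forall i, n1 <= i -> forall F : {linear tot P -> tot T}, rel (u i) 0 pi F -> C k i F).
have Zr_dzero i : Zr i (dzero i X T).
  move=> F hF; rewrite -[i in htp i]add0r.
  exact: rel_uniq kP (htp_refl _ _) hF (rel_dzero _ _ cpi).
have [N hN] : exists N, forall n, (N <= n)%N -> forall u, S n u -> S N u.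
  apply: noeth => [k|k u [s h]]; last by split=> // i ni F hF; apply: hC; exact: h.
  have [C1 C2 C3 C4 [C5 C6]] := gC k.
  have C0 i (F : {linear tot P -> tot T}) : htp i F \0 -> C k i F.
    by move=> h; apply: C2 (C3 i) (htp_sym h).
  split.
  - move=> u [[N s] _]; exists N => i hi; apply/(dzeroP rpi); apply: s.
    by case/orP: hi => [lt|->]; [rewrite (lt_le_trans lt)|rewrite orbT].
  - move=> u v [[N s] h] uv; split.
      by exists N => i /s hi F /(rel_eqD kP (dmor_eq_sym (uv i))); exact: hi.
    by move=> i ni F /(rel_eqD kP (dmor_eq_sym (uv i))); exact: h.
  - split; first by exists 0 => i _.
    by move=> i _ F hF; apply: C0; exact: Zr_dzero hF.
  - move=> u v [[N s] h] [[N' s'] h'].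
    have dec i (F : {linear tot P -> tot T}) : rel (dadd (u i) (v i)) 0 pi F ->
        exists F1 F2 : {linear tot P -> tot T},
        [/\ rel (u i) 0 pi F1, rel (v i) 0 pi F2 & htp i F (F1 \+ F2)].
      move=> hF; have [F1 [r1 _]] := rep_ex rpi (u i); have [F2 [r2 _]] := rep_ex rpi (v i).
      exists F1, F2; split=> //; rewrite -[i in htp i]add0r.
      exact: rel_uniq kP (htp_refl _ _) hF (rel_dadd r1 r2).
    split.
      exists (Num.max N N') => i hi F /dec [F1 [F2 [r1 r2 e]]]; apply: htp_trans e _.
      have ui : Zr i (u i) by apply: s; move: hi; lia.
      have vi : Zr i (v i) by apply: s'; move: hi; lia.
      by apply: eq_htp (htpD (ui _ r1) (vi _ r2)) => // x /=; rewrite addr0.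
    move=> i ni F /dec [F1 [F2 [r1 r2 e]]]; apply: C2 (htp_sym e).
    by apply: C4; [exact: h r1|exact: h' r2].
  - move=> m r u v hr [[N s] h] uv.
    have [b [hb cb]] := rep_ex rpi (phi m r X).
    have dec i (F : {linear tot P -> tot T}) : rel (v i) 0 pi F ->
        exists2 F'' : {linear tot P -> tot T}, rel (u (i - m%:Z)) m%:Z b F'' & htp i F F''.
      move=> hF; have [F'' r4] := rel_ex (u (i - m%:Z)) kP cb; exists F'' => //.
      have r4' : rel (u (i - m%:Z)) (0 + m%:Z) b F'' by rewrite add0r.
      have := rel_uniq kP (htp_refl _ _) (rel_eqD kP (uv i) hF) (rel_comp hb r4').
      by rewrite add0r addrC subrK.
    have zero i : Zr _ (u (i - m%:Z)) -> Zr i (v i).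
      move=> z F /dec [F'' r4 e]; apply: htp_trans e _.
      have /(dzeroP rpi) u0 := z.
      have := rel_uniq kP (htp_refl _ _) (rel_eqD kP u0 r4) (rel_dzero _ _ cb).
      by rewrite addrC subrK.
    split.
      by exists (N + m%:Z) => i hi; apply: zero; apply: s; move: hi; lia.
    move=> i ni F hF; have [lt|ge] := ltP (i - m%:Z) n1.
      apply: C0; apply: zero hF; apply: s; by rewrite lt.
    have [F'' r4 e] := dec i F hF.
    have [F0 [r1 c0]] := rep_ex rpi (u (i - m%:Z)).
    have [F' r2] := rel_ex (phi m r T) kP c0.
    have CF' := C6 _ _ _ _ _ hr (h _ ge _ r1) r2.
    (* The degree [i - m] of [u (i - m)] is generalised to [j], so that case analysis can turn it
       into a natural number; the negative case contradicts [n1 <= j]. *)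
    clear c0; move: e ge r4 r1 r2 CF'; move: (u (i - m%:Z)) (subrK m%:Z i).
    move: (i - m%:Z) => j uj ej; clear zero dec uv ni hF; subst i.
    case: j uj => [j|j] uj e ge r4 r1 r2 CF'; last by move: (le_trans n1_ge0 ge).
    apply: (C2 _ _ _ _ (htp_sym e)).
    have [h1|h1] := act_natural_rel rpi hr r1 r2 hb r4; first exact: C2 (htp_sym h1).
    apply: C2 (C5 _ _ CF') _; apply: htp_sym; apply: eq_htp h1 => // x.
    by rewrite /= sgn_map1E.
exists N => k i F Nk ni CF.
have [C1 C2 C3 C4 _] := gC k; have cF := C1 _ _ CF.
(* A single homogeneous [F] is fed to the chain condition as the family concentrated in degree
   [i]. *)
pose g j : gmap P T := if j == i then ent F else @gzero A P T.
have gch j : chmap j (g j).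
  by rewrite /g; case: eqP => [->|_]; [exact: ent_chmap|exact: gzero_chmap].
pose u j : dmor j X T := Roof (pi_qiso rpi) (gch j).
have gz j : j <> i -> u j =D dzero j X T.
  move=> ne; apply: (dzeroP1 rpi (F := \0)); last exact: htp_refl.
  exists idfun; split; [exact: cyc_id| |].
    by apply: eq1_htp => x /=; rewrite tmap_ent //; exact: cpi.1.
  by apply: eq1_htp => x /=; rewrite /g; case: eqP => // _; rewrite tmap_gzero.
have ui : rel (u i) 0 pi F.
  exists idfun; split; [exact: cyc_id| |].
    by apply: eq1_htp => x /=; rewrite tmap_ent //; exact: cpi.1.
  by apply: eq1_htp => x /=; rewrite /g eqxx tmap_ent //; exact: cF.1.
have [|_] := hN k Nk u; last by apply.
split; first by exists i => j hj; apply/(dzeroP rpi)/gz; move: hj; lia.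
move=> j nj G hG; have [e|ne] := pselect (j = i); last first.
  apply: C2 (C3 j) _; apply: htp_sym.
  exact: (proj1 (dzeroP rpi (u j)) (gz j ne)).
subst j; apply: C2 CF _; rewrite -[i in htp i]add0r.
exact: rel_uniq kP (htp_refl _ _) ui hG.
Qed.

End GradedNoetherian.

(** * Cones and Koszul objects *)

(* What exactness of the long exact sequence of [X -> Sigma^a X -> X // r] says about the
  degrees in which the cohomology of [X] ([E]) and of [X // r] ([E']) vanishes. *)
Definition tri (a : int) (E E' : int -> Prop) :=
  [/\ forall i, E (i - 1) -> E (i - a) -> E' i,
      forall i, E' i -> E i -> E (i - a) &
      forall i, E (i - a) -> E' (i + 1) -> E i].

Section ConeTri.
Variables (A : pzRingType) (n : int) (P : Db A) (b : gmap P P) (hb : chmap n b).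
Notation Q := (cone hb).
Notation in1 := (cin1 hb).
Notation in2 := (cin2 hb).
Notation pr1 := (cpr1 hb).
Notation pr2 := (cpr2 hb).

Let cb : cyc n (tmap n b). Proof. exact/chmap_cyc. Qed.

Lemma htp0_eq m (X Y : Db A) (F : {linear tot X -> tot Y}) : htp m F \0 ->
  exists H : {linear tot X -> tot Y}, hg (m - 1) H /\
    forall x, F x = dif Y (H x) + sgn m *: H (dif X x).
Proof. by move=> [H [hH e]]; exists H; split=> // x; rewrite -e /= subr0. Qed.

(** The null-homotopy on the second summand, extended to the cone by [pr2], has a boundary whose
    subtraction from [F] makes it vanish strictly on [in2]; what remains depends on [pr1] only. *)
Lemma cone_factor (Y : Db A) i (F : {linear tot Q -> tot Y}) :
  cyc i F -> htp (i - n) (F \o in2) \0 ->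
  exists g : {linear tot P -> tot Y}, cyc (i - 1) g /\ htp i F (g \o pr1).
Proof.
move=> cF /htp0_eq[h [hh eh]].
have [F1 F1E] : exists F1 : {linear tot Q -> tot Y}, forall z,
    F1 z = F z - (dif Y (h (pr2 z)) + sgn i *: h (pr2 (dif Q z))).
  exists (F \- ((dif Y \o (h \o pr2)) \+ sgn_map i ((h \o pr2) \o dif Q))) => z.
  by rewrite /= sgn_mapE.
have FF1 : htp i F F1.
  exists (h \o pr2); split=> [|z].
    by apply: (@hg_comp _ n (i - n - 1)); [lia|exact: hg_cpr2|exact: hh].
  by rewrite F1E /=; zmod.
have cF1 : cyc i F1 by exact: cyc_htp FF1 cF.
have F1in2 y : F1 (in2 y) = 0.
  have /= := eh y; rewrite F1E cpr2_dif cpr1_in2 cpr2_in2 linear0 add0r linearZ /= => ->.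
  by rewrite scalerA sgnD sgnN subrr.
have F1pr z : F1 z = F1 (in1 (pr1 z)).
  by rewrite [z in LHS](cone_eta z) linearD F1in2 addr0.
exists (F1 \o in1); split; last first.
  by apply: htp_trans FF1 _; apply: eq1_htp => z /=; rewrite -F1pr.
split=> [|x].
  by apply: (@hg_comp _ (-1) i); [lia|exact: hg_cin1|exact: cF1.1].
have := cF1.2 (in1 x); rewrite dif_cin1 linearB F1in2 sub0r => e.
by rewrite /= -[LHS]opprK e sgnD sgnN sgn1 mulrN1 scaleNr.
Qed.

Lemma tri_contra Y : tri n (fun i => Hom_zero P i Y) (fun i => Hom_zero Q i Y).
Proof.
split=> i h1 h2 F cF.
- have [|g [cg hg]] := cone_factor cF (h2 (F \o in2) _).
    by apply: cyc_comp _ (cyc_cin2 hb) cF; rewrite addrC.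
  apply: htp_trans hg _.
  apply: (@eq_htp _ _ _ _ (g \o pr1) _ (\0 \o pr1)) => //.
  by apply: (htp_compr _ (cyc_cpr1 hb) (h1 _ cg)); lia.
- have [|h [hh eh]] := htp0_eq (h2 (F \o tmap n b) _).
    by apply: cyc_comp _ cb cF; lia.
  (* The null-homotopy of [F] after [b] is exactly the datum extending [F] to a chain map on the
     cone. *)
  pose G : {linear tot Q -> tot Y} := (F \o pr2) \+ sgn_map i (h \o pr1).
  have cG : cyc i G.
    split=> [|z].
      apply: hgD; first by apply: (@hg_comp _ n (i - n)); [lia|exact: hg_cpr2|exact: cF.1].
      apply: hg_sgn; apply: (@hg_comp _ 1 (i - 1)); [lia|exact: hg_cpr1|exact: hh].
    rewrite /G /= !sgn_mapE /= cpr2_dif cpr1_dif linearD [F (_ *: _)]linearZ /= cF.2.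
    have /= -> := eh (pr1 z); rewrite linearN scalerN linearD [dif _ (_ *: _)]linearZ /=.
    by rewrite scalerDr; sgn_cases; zmod.
  apply: (@eq_htp _ _ _ _ (G \o in2) _ (\0 \o in2)) => // [y|].
    by rewrite /G /= sgn_mapE /= cpr2_in2 cpr1_in2 linear0 scaler0 addr0.
  by apply: (htp_compr _ (cyc_cin2 hb) (h1 _ cG)); lia.
- have [|H [hH eH]] := htp0_eq (h2 (F \o pr1) _).
    by apply: cyc_comp _ (cyc_cpr1 hb) cF; lia.
  have [|k [hk ek]] := htp0_eq (h1 (H \o in2) _).
    split=> [|y].
      by apply: (@hg_comp _ (- n) i); [lia|exact: hg_cin2|move: hH; rewrite addrK].
    have /= := eH (in2 y); rewrite cpr1_in2 linear0 dif_cin2 linearZ /= scalerA.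
    move/esym/eqP; rewrite addrC addr_eq0 => /eqP; rewrite !sgnD sgnN sgn1.
    by sgn_cases => // /oppr_inj.
  exists ((H \o in1) \- sgn_map i (k \o tmap n b)); split=> [|x].
    apply: hgB.
      apply: (@hg_comp _ (-1) i); [lia|exact: hg_cin1|by move: hH; rewrite addrK].
    by apply: hg_sgn; apply: (@hg_comp _ n (i - n - 1)); [lia|exact: cb.1|exact: hk].
  rewrite /= subr0 !sgn_mapE /=.
  have /= := eH (in1 x); rewrite cpr1_in1 dif_cin1 linearB => ->.
  have /= -> := ek (tmap n b x); rewrite (cyc_sgnE cb) linearZ /=.
  rewrite [dif _ (_ - _)]linearB [dif _ (_ *: _)]linearZ /= scalerA !sgnD sgnN sgn1.
  by sgn_cases; zmod.
Qed.

(** The covariant long exact sequence runs through the degrees in the opposite direction. Negating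
    them gives it the shape of the contravariant one, so both satisfy the same [tri]. *)
Lemma tri_co Z : tri n (fun i => Hom_zero Z (- i) P) (fun i => Hom_zero Z (- i) Q).
Proof.
split=> i; [have -> : - (i - 1) = - i + 1 by lia|have -> : - (i - n) = - i + n by lia|
  have -> : - (i + 1) = - i - 1 by lia]; rewrite ?opprB; move: (- i) => {}i h1 h2 F cF.
- have [|h [hh eh]] := htp0_eq (h1 (pr1 \o F) _).
    by apply: cyc_comp _ cF (cyc_cpr1 hb).
  have [F1 F1E] : exists F1 : {linear tot Z -> tot Q}, forall x,
      F1 x = F x + (dif Q (in1 (h x)) + sgn i *: in1 (h (dif Z x))).
    exists (F \+ ((dif Q \o (in1 \o h)) \+ sgn_map i ((in1 \o h) \o dif Z))) => x.
    by rewrite /= sgn_mapE.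
  have FF1 : htp i F1 F.
    exists (in1 \o h); split=> [|x].
      by apply: (@hg_comp _ (i + 1 - 1) (-1)); [lia|exact: hh|exact: hg_cin1].
    by rewrite F1E /=; zmod.
  have cF1 : cyc i F1 by exact: cyc_htp (htp_sym FF1) cF.
  have F1pr1 x : pr1 (F1 x) = 0.
    rewrite F1E !linearD dif_cin1 linearB /= linearZ /= cpr1_in2 !cpr1_in1.
    have /= -> := eh x; rewrite sgnD sgn1 mulrN1 scaleNr; zmod.
  have F1in x : F1 x = in2 (pr2 (F1 x)).
    by rewrite [LHS]cone_eta F1pr1 linear0 add0r.
  apply: htp_trans (htp_sym FF1) _.
  have [||K hK] := htp_compl (k := i) _ (cyc_cin2 hb) (h2 (pr2 \o F1) _).
  + by lia.
  + split=> [|x].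
      by apply: (@hg_comp _ i n); [lia|exact: cF1.1|exact: hg_cpr2].
    by rewrite /= cF1.2 linearZ /= cpr2_dif F1pr1 linear0 add0r scalerA -sgnD addrC.
  + exists K; case: hK => hK e; split=> // x.
    by rewrite -e /= -F1in [in2 0]linear0.
- have [|H [hH eH]] := htp0_eq (h1 (in2 \o F) _).
    by apply: (cyc_comp _ cF (cyc_cin2 hb)); lia.
  have [|k [hk ek]] := htp0_eq (h2 (pr1 \o H) _).
    split=> [|x].
      by apply: (@hg_comp _ (i - 1) 1); [lia|exact: hH|exact: hg_cpr1].
    have /= := congr1 pr1 (eH x); rewrite cpr1_in2 linearD cpr1_dif linearZ /=.
    move/esym/eqP; rewrite addrC subr_eq0 => /eqP <-.
    by rewrite sgnM.
  exists (sgn_map n ((tmap n b \o k) \+ (pr2 \o H))); split=> [|x].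
    apply: hg_sgn; apply: hgD.
      by apply: (@hg_comp _ (i - 1) n); [lia|exact: hk|exact: cb.1].
    by apply: (@hg_comp _ (i - 1) n); [lia|exact: hH|exact: hg_cpr2].
  have /= := congr1 pr2 (eH x); rewrite cpr2_in2 linearD cpr2_dif linearZ /=.
  have /= -> := ek x; rewrite linearD cb.2 linearZ /= subr0 !sgn_mapE /= => ->.
  rewrite [dif _ (_ *: _)]linearZ /= linearD !scalerDr.
  by sgn_cases; zmod.
- have [|h [hh eh]] := htp0_eq (h1 (tmap n b \o F) _).
    by apply: (cyc_comp _ cF cb); lia.
  pose G : {linear tot Z -> tot Q} := (in1 \o F) \- sgn_map n (in2 \o h).
  have cG : cyc (i - 1) G.
    split=> [|x].
      apply: hgB; first by apply: (@hg_comp _ i (-1)) => //; [exact: cF.1|exact: hg_cin1].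
      by apply: hg_sgn; apply: (@hg_comp _ (n + i - 1) (- n)); [lia|exact: hh|exact: hg_cin2].
    rewrite /G /= !sgn_mapE /= linearB [dif _ (_ *: _)]linearZ /= dif_cin1 dif_cin2.
    have /= -> := eh x; rewrite cF.2 [in1 (_ *: _)]linearZ [in2 (_ + _)]linearD [in2 (_ *: _)]linearZ /=.
    rewrite !(scalerBr, scalerDr).
    by sgn_cases; zmod.
  apply: (@eq_htp _ _ _ _ (pr1 \o G) _ (pr1 \o \0)) => [x|x|].
  + by rewrite /G /= sgn_mapE /= linearB cpr1_in1 linearZ /= cpr1_in2 scaler0 subr0.
  + by rewrite /= linear0.
  + by apply: (htp_compl _ (cyc_cpr1 hb) (h2 _ cG)); rewrite subrK.
Qed.

End ConeTri.

Section ConeNoeth.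
Variables (A : pzRingType) (R : gcring) (phi : central_action R A) (T : Db A).

Lemma rel_pre n Y Z (v : dmor n Y Z) m l k (P P' : Db A) (F : tot P -> tot Y)
    (F' : tot P -> tot Z) (K : {linear tot P' -> tot P}) :
  k = l + m -> cyc l K -> rel v m F F' -> rel v k (F \o K) (F' \o K).
Proof.
move=> -> cK [G [cG h1 h2]]; exists (G \o K); split.
- exact: cyc_comp cK cG.
- exact: htp_compr cK h1.
- by apply: (htp_compr _ cK h2); rewrite addrA.
Qed.

(** A chain [C] on the cone induces two chains on [P]: inverse images [L] under composition with
    [cpr1], and restrictions [Rr] along [cin2]. Once both are stationary so is [C]: an element of
    [C k] differs from an element of [C N] with the same restriction by one coming from [L]. *)
Lemma gnoeth_cone n (P : Db A) (b : gmap P P) (hb : chmap n b) :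
  kproj P -> kproj (cone hb) -> gnoeth phi T P -> gnoeth phi T (cone hb).
Proof.
move=> kP kQ [n0 gP]; set Q := cone hb.
(* Large enough for both [i - n] and [i - 1], the degrees in which [Rr] and [L] are compared, to be
   at least [n0]. *)
exists (n0 + `|n|%N + 1) => C gC hC.
pose L k i (F : {linear tot P -> tot T}) := cyc i F /\ C k (i + 1) (F \o cpr1 hb).
pose Rr k i (F : {linear tot P -> tot T}) := cyc i F /\
  exists G : {linear tot Q -> tot T}, C k (i + n) G /\ htp i (G \o cin2 hb) F.
have gL k : gsub phi (L k).
  have [C1 C2 C3 C4 [C5 C6]] := gC k; split.
  - by move=> i F [].
  - move=> i F G [cF CF] h; split; first exact: cyc_htp h cF.
    by apply: C2 CF _; apply: (htp_compr _ (cyc_cpr1 hb) h); rewrite addrC.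
  - move=> i; split; first exact: cyc0.
    by apply: C2 (C3 _) _; apply: eq1_htp.
  - move=> i F G [cF CF] [cG CG]; split; first exact: cycD.
    by apply: C2 (C4 _ _ _ CF CG) _; apply: eq1_htp.
  - split=> [i F [cF CF]|m r i F F' hr [cF CF] rF].
      split; first by apply: eq_cyc (cycN cF) => x /=; rewrite sgn_map1E.
      by apply: C2 (C5 _ _ CF) _; apply: eq1_htp => x /=; rewrite !sgn_map1E.
    split; first exact: rel_cyc rF.
    rewrite addrAC; apply: C6 hr CF _; apply: rel_pre rF; last exact: cyc_cpr1.
    by rewrite addrC.
have gR k : gsub phi (Rr k).
  have [C1 C2 C3 C4 [C5 C6]] := gC k; split.
  - by move=> i F [].
  - move=> i F G [cF [K [CK hK]]] h; split; first exact: cyc_htp h cF.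
    by exists K; split=> //; exact: htp_trans hK h.
  - move=> i; split; first exact: cyc0.
    by exists \0; split=> //; apply: eq1_htp.
  - move=> i F G [cF [K [CK hK]]] [cG [K' [CK' hK']]]; split; first exact: cycD.
    exists (K \+ K'); split; first exact: C4.
    by apply: eq_htp (htpD hK hK').
  - split=> [i F [cF [K [CK hK]]]|m r i F F' hr [cF [K [CK hK]]] rF].
      split; first by apply: eq_cyc (cycN cF) => x /=; rewrite sgn_map1E.
      exists (sgn_map 1 K); split; first exact: C5.
      by apply: eq_htp (htpN hK) => x /=; rewrite sgn_map1E.
    split; first exact: rel_cyc rF.
    have [K' rK] := rel_ex (phi m r T) kQ (C1 _ _ CK).
    exists K'; split; first by rewrite addrAC; exact: C6 hr CK rK.
    apply: rel_uniq kP hK _ rF; apply: rel_pre rK; last exact: cyc_cin2.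
    by rewrite addrC addrK.
have [N1 hN1] := gP _ gL (fun k i F h => conj h.1 (hC _ _ _ h.2)).
have [N2 hN2] : exists N, forall k i F, (N <= k)%N -> n0 <= i -> Rr k i F -> Rr N i F.
  apply: gP => // k i F [cF [K [CK hK]]]; split=> //; exists K; split=> //; exact: hC.
exists (N1 + N2)%N => k i F Nk ni CF.
have [C1 C2 C3 C4 [C5 C6]] := gC k; have cF := C1 _ _ CF.
have Rk : Rr k (i - n) (F \o cin2 hb).
  split; first by apply: (cyc_comp _ (cyc_cin2 hb) cF); rewrite addrC.
  by exists F; split; [rewrite subrK|exact: htp_refl].
have [|_ [G [CG hG]]] := hN2 _ _ _ (leq_trans (leq_addl _ _) Nk) _ Rk; first by lia.
rewrite subrK in CG.
have CGk : C k i G by apply: (chain_le hC) CG; apply: leq_trans (leq_addl _ _) Nk.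
have CD := C4 _ _ _ CF (C5 _ _ CGk).
have [|g [cg hgD]] := cone_factor (C1 _ _ CD).
  apply: eq_htp (htpD (htp_sym hG) (htpN (htp_refl (i - n) (G \o cin2 hb)))) => x /=.
    by rewrite sgn_map1E.
  by rewrite subrr.
have Lk : L k (i - 1) g by split=> //; rewrite subrK; exact: C2 CD hgD.
have [|_ CgN] := hN1 _ _ _ (leq_trans (leq_addr _ _) Nk) _ Lk; first by lia.
rewrite subrK in CgN.
have [_ D2 _ D4 _] := gC (N1 + N2)%N.
apply: D2 (D4 _ _ _ (chain_le hC (leq_addl N1 N2) CG) (chain_le hC (leq_addr N2 N1) CgN)) _.
apply: eq_htp (htpD (htp_refl i G) (htp_sym hgD)) => // x /=.
by rewrite sgn_map1E; zmod.
Qed.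

End ConeNoeth.

Section Koszul.
Variables (A : pzRingType) (R : gcring) (phi : central_action R A).

Lemma qis_lift (P X' X : Db A) (s : gmap X' X) (a : {linear tot P -> tot X'})
    (pi : {linear tot P -> tot X}) :
  quasi_iso s -> cyc 0 a -> qis pi -> htp 0 (tmap 0 s \o a) pi -> qis a.
Proof.
move=> /quasi_isoP [/chmap_cyc cs [s1 s2]] ca qpi /htp_sym h.
have {qpi h}[p1 p2] := qis_htp h qpi.
have Ds x : dif X' x = 0 -> dif X (tmap 0 s x) = 0.
  by move=> e; rewrite (cyc_sgnE cs) e linear0 scaler0.
split=> [x dx [y ey]|y dy].
  apply: p1 => //; exists (tmap 0 s y) => /=; rewrite ey cs.2 sgn0.
  exact: scale1r.
have [x [y' [dx ey]]] := p2 _ (Ds _ dy).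
have [||z ez] := s1 (y - a x).
- by rewrite linearB /= dy (cyc_sgnE ca) dx linear0 scaler0 subr0.
- by exists y'; rewrite linearB ey /=; zmod.
by exists x, z; split=> //; rewrite -ez; zmod.
Qed.

(** The square with sides [b], [f], [a], [pi] commutes up to homotopy only; the homotopy [h] becomes
    the off-diagonal component of the map of cones [rho]. The rest is the five lemma on elements. *)
Lemma cone_resol n (P X' X : Db A) (f : gmap X' X) (hf : chmap n f) (b : gmap P P)
    (hb : chmap n b) (a : {linear tot P -> tot X'}) (pi : {linear tot P -> tot X}) :
  kproj (cone hb) -> cyc 0 a -> qis a -> cyc 0 pi -> qis pi ->
  htp n (pi \o tmap n b) (tmap n f \o a) ->
  exists rho : {linear tot (cone hb) -> tot (cone hf)}, resol rho.
Proof.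
move=> kQ ca [a1 a2] cpi [p1 p2] [h0 [hh0 eh0]].
(* The sign is moved to the boundary term, so that [h] itself can serve as a component of [rho]. *)
have [h [hh eh]] : exists h : {linear tot P -> tot X}, hg (n - 1) h /\ forall x,
    pi (tmap n b x) = tmap n f (a x) + sgn n *: dif X (h x) + h (dif P x).
  exists (sgn_map n h0); split=> [|x]; first exact: hg_sgn.
  have /= e := eh0 x; rewrite /= !sgn_mapE [dif _ (_ *: _)]linearZ /= sgnM -addrA -e.
  by zmod.
have ca' x : dif X' (a x) = a (dif P x) by rewrite (cyc_sgnE ca) sgn0 scale1r.
have cpi' x : dif X (pi x) = pi (dif P x) by rewrite (cyc_sgnE cpi) sgn0 scale1r.
have cf : cyc n (tmap n f) by exact/chmap_cyc.
have cb : cyc n (tmap n b) by exact/chmap_cyc.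
have [rho rhoE] : exists rho : {linear tot (cone hb) -> tot (cone hf)}, forall z,
    rho z = cin1 hf (a (cpr1 hb z)) + cin2 hf (pi (cpr2 hb z) + h (cpr1 hb z)).
  by exists ((cin1 hf \o (a \o cpr1 hb)) \+
     (cin2 hf \o ((pi \o cpr2 hb) \+ (h \o cpr1 hb)))) => z.
have rho_pr1 z : cpr1 hf (rho z) = a (cpr1 hb z).
  by rewrite rhoE linearD /= cpr1_in1 cpr1_in2 addr0.
have rho_pr2 z : cpr2 hf (rho z) = pi (cpr2 hb z) + h (cpr1 hb z).
  by rewrite rhoE linearD /= cpr2_in1 cpr2_in2 add0r.
have cone_eq (Z W : Db A) (k : gmap Z W) (hk : chmap n k) (z z' : tot (cone hk)) :
    cpr1 hk z = cpr1 hk z' -> cpr2 hk z = cpr2 hk z' -> z = z'.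
  by move=> e1 e2; rewrite (cone_eta z) e1 e2 -cone_eta.
have crho z : rho (dif _ z) = dif _ (rho z).
  apply: cone_eq; first by rewrite rho_pr1 !cpr1_dif linearN rho_pr1 ca'.
  rewrite rho_pr2 !cpr2_dif cpr1_dif rho_pr1 rho_pr2 linearN linearD eh.
  rewrite [pi (_ *: _)]linearZ /= -cpi' [dif X (_ + _)]linearD scalerDr; zmod.
exists rho; split=> //.
  split=> [|z]; last by rewrite crho sgn0 scale1r.
  apply: (@eq_hg _ _ _ _ ((cin1 hf \o (a \o cpr1 hb)) \+
     (cin2 hf \o ((pi \o cpr2 hb) \+ (h \o cpr1 hb))))) => [z|]; first by rewrite rhoE.
  apply: hgD.
    apply: (@hg_comp _ 1 (-1)) => //; last exact: hg_cin1.
    by apply: (@hg_comp _ 1 0); [rewrite addr0|exact: hg_cpr1|exact: ca.1].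
  apply: (@hg_comp _ n (- n)); [lia| |exact: hg_cin2]; apply: hgD.
    by apply: (@hg_comp _ n 0); [rewrite addr0|exact: hg_cpr2|exact: cpi.1].
  by apply: (@hg_comp _ 1 (n - 1)); [lia|exact: hg_cpr1|exact: hh].
split=> [z dz [w ew]|z dz].
  have [dx bx] := cone0P dz.
  have e1 := congr1 (cpr1 hf) ew; have e2 := congr1 (cpr2 hf) ew.
  rewrite rho_pr1 cpr1_dif in e1; rewrite rho_pr2 cpr2_dif in e2.
  have [|x' ex] := a1 _ dx; first by exists (- cpr1 hf w); rewrite linearN.
  pose y := cpr2 hb z + tmap n b x'.
  have dy : dif P y = 0.
    rewrite /y linearD (cyc_sgnE cb) -ex bx; sgn_cases; rewrite ?scalerN; sgn_cases; zmod.
  have du : dif X' (cpr1 hf w + a x') = 0.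
    by rewrite linearD ca' -ex e1; zmod.
  (* [x'] is determined only up to a cycle; [x1] is the correction that turns the remaining second
     component into a boundary. *)
  have [x1 [u1 [dx1 eu]]] := a2 _ du.
  have [||y1 ey1] := p1 (y - tmap n b x1).
  - by rewrite linearB dy (cyc_sgnE cb) dx1 linear0 scaler0 subr0.
  - exists (sgn n *: (cpr2 hf w + h x' + tmap n f u1 - h x1)).
    rewrite linearB /y linearD /= !eh dx1 linear0 addr0.
    have -> : pi (cpr2 hb z) = tmap n f (cpr1 hf w) + sgn n *: dif X (cpr2 hf w) - h (cpr1 hb z).
      by rewrite -e2; zmod.
    have -> : cpr1 hf w = a x1 + dif X' u1 - a x' by rewrite -eu; zmod.
    rewrite ex [dif X (_ *: _)]linearZ /= linearB !linearD /= linearN /= (cyc_sgnE cf).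
    by sgn_cases; zmod.
  exists (cin1 hb (x1 - x') + cin2 hb (sgn n *: y1)); apply: cone_eq.
    rewrite cpr1_dif [cpr1 _ (_ + _)]linearD /= cpr1_in1 cpr1_in2 addr0 [dif P _]linearB /= dx1 ex.
    by zmod.
  rewrite cpr2_dif [cpr1 _ (_ + _)]linearD [cpr2 _ (_ + _)]linearD /= cpr1_in1 cpr1_in2.
  rewrite cpr2_in1 cpr2_in2 addr0 add0r [dif P (_ *: _)]linearZ /= sgnM -ey1 /y.
  by rewrite [tmap _ _ (_ - _)]linearB /=; zmod.
have [du fu] := cone0P dz.
have [x [u1 [dx eu]]] := a2 _ du.
pose v := cpr2 hf z + tmap n f u1.
have ev : sgn n *: dif X v = - tmap n f (a x).
  apply/eqP; rewrite eq_sym -subr_eq0; apply/eqP.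
  have <- : - tmap n f (cpr1 hf z) - sgn n *: dif X (cpr2 hf z) = 0 by rewrite fu; zmod.
  rewrite eu /v [tmap n f (_ + _)]linearD [dif X (_ + _)]linearD scalerDr (cyc_sgnE cf) sgnM /=.
  by zmod.
(* [b x] is a boundary because its image under [pi] is one; hence [x] is the first component of a
   cycle of the cone. *)
have [||y0 ey0] := p1 (tmap n b x).
- by rewrite (cyc_sgnE cb) dx linear0 scaler0.
- exists (sgn n *: (h x - v)); rewrite eh dx linear0 addr0.
  rewrite [dif X (_ *: _)]linearZ /= linearB scalerBr ev; zmod.
have dw : dif X (v + sgn n *: pi y0 - h x) = 0.
  rewrite linearB linearD [dif X (_ *: _)]linearZ /= cpi' -ey0 eh dx linear0 addr0.
  have -> : dif X v = - (sgn n *: tmap n f (a x)) by rewrite -scalerN -ev sgnM.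
  by rewrite scalerDr sgnM; zmod.
have [y1 [v1 [dy1 ew]]] := p2 _ dw.
exists (cin1 hb x + cin2 hb (y1 - sgn n *: y0)), (cin1 hf (- u1) + cin2 hf (sgn n *: v1)).
split.
  apply: cone_eq; first by rewrite cpr1_dif [cpr1 _ (_ + _)]linearD /= cpr1_in1 cpr1_in2 addr0 dx oppr0 linear0.
  rewrite cpr2_dif [cpr1 _ (_ + _)]linearD [cpr2 _ (_ + _)]linearD /=.
  rewrite cpr1_in1 cpr1_in2 cpr2_in1 cpr2_in2 addr0 add0r linear0.
  by rewrite linearB [dif P (_ *: _)]linearZ /= dy1 -ey0 sub0r scalerN sgnM; zmod.
apply: cone_eq.
  rewrite [RHS]linearD /= rho_pr1 cpr1_dif ![cpr1 _ (_ + _)]linearD /= !cpr1_in1 !cpr1_in2 !addr0.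
  by rewrite linearN opprK -eu.
rewrite [RHS]linearD /= rho_pr2 cpr2_dif ![cpr1 _ (_ + _)]linearD ![cpr2 _ (_ + _)]linearD /=.
rewrite !cpr1_in1 !cpr1_in2 !cpr2_in1 !cpr2_in2 !addr0 !add0r.
rewrite [dif X (_ *: _)]linearZ /= sgnM linearN linearB [pi (_ *: _)]linearZ /=.
have -> : cpr2 hf z = v - tmap n f u1 by rewrite /v; zmod.
have -> : v = pi y1 + dif X v1 - sgn n *: pi y0 + h x by rewrite -ew; zmod.
by zmod.
Qed.

(** The Koszul object is the cone of a numerator that starts at the apex of a roof, not at [X]. So
    [pi] is first lifted to [a] through the denominator, and [b] then lifts the numerator after [a]
    through [pi]. *)
Lemma koszul_resol (P X : Db A) (pi : {linear tot P -> tot X}) (m : nat) (r : R) :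
  resol pi -> frees P ->
  (forall (b : gmap P P) (hb : chmap m%:Z b), kproj (cone hb)) ->
  exists (b : gmap P P) (hb : chmap m%:Z b),
    exists rho : {linear tot (cone hb) -> tot (koszul phi X (m, r))}, resol rho.
Proof.
move=> [kP cpi qpi] fP kQ; set u := phi m r X.
have [a [ca ha]] := kproj_lift kP (denP u) cpi.
have cn : cyc m (tmap m (num u) \o a) by apply: (cyc_comp _ ca (num_cyc u)); rewrite add0r.
have [b [cb hb]] := kproj_lift kP (pi_qiso (And3 kP cpi qpi)) cn.
exists (ent b), (ent_chmap cb); rewrite /koszul /=.
have kQ' := kQ _ (ent_chmap cb).
apply: (cone_resol (numP u) kQ' ca (qis_lift (denP u) ca qpi ha) cpi qpi).
apply: eq_htp hb => // x /=; rewrite !tmap_ent //; [exact: cb.1|exact: cpi.1].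
Qed.

End Koszul.

(** * Vanishing of Hom in high degrees for an object of complexity 0 *)

Section HighVanishing.
Variables (A : pzRingType) (R : gcring) (phi : central_action R A).

(** For [t = 0] the bound is [a / n], which is below 1 as soon as [n] exceeds the absolute value of
    [a]. *)
Lemma growth0 (L : nat -> nat -> Prop) : growth L 0 -> exists N, forall n, (N <= n)%N -> L n 0%N.
Proof.
move=> [a [N h]]; exists (N + (Num.bound `|a|).+1)%N => n hn.
have [|l [Ll la]] := h n; first by lia.
suff l0 : l = 0%N by rewrite -l0.
have n_gt : `|a| < n%:R.
  apply: lt_le_trans (archi_boundP (normr_ge0 a)) _; rewrite ler_nat.
  by apply: leq_trans hn; rewrite addnS ltnW // ltnS leq_addl.
have n_gt0 : 0 < n%:R :> Rdefinitions.R by exact: le_lt_trans (normr_ge0 a) n_gt.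
have : l%:R < 1 :> Rdefinitions.R.
  apply: le_lt_trans la _; rewrite sub0r exprN1 ltr_pdivrMr // mul1r.
  exact: le_lt_trans (ler_norm a) n_gt.
by rewrite ltrn1; case: l {Ll la}.
Qed.

Lemma is_cx0 (P X : Db A) (pi : {linear tot P -> tot X}) : resol pi -> is_cx phi X 0 ->
  exists N, forall n : nat, (N <= n)%N -> forall u : dmor n%:Z X X, u =D dzero n%:Z X X.
Proof.
move=> rpi [/growth0 [N hN] _]; have [kP cpi _] := rpi.
exists N => n /hN [_ nch] u; apply: contrapT => u0; apply: nch.
have T0 : dzero n%:Z X X =D dzero n%:Z X X.
  by apply: (dzeroP1 rpi (rel_dzero _ _ cpi)); exact: htp_refl.
(* Length 0 forbids a strict chain with one step; a nonzero [u] would give the chain from the zero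
   submodule to the whole module. *)
exists (fun k v => if k is 0%N then v =D dzero n%:Z X X else True); split; last first.
  case=> [|k] //; split=> //; by exists u.
case=> [|k] _; last by split.
split=> //.
- move=> v w /(dzeroP rpi) hv vw; apply/(dzeroP rpi) => F.
  by move/(rel_eqD kP (dmor_eq_sym vw)); exact: hv.
- move=> v w /(dzeroP rpi) hv /(dzeroP rpi) hw.
  have [F1 [r1 _]] := rep_ex rpi v; have [F2 [r2 _]] := rep_ex rpi w.
  apply: (dzeroP1 rpi (rel_dadd r1 r2)).
  by apply: eq_htp (htpD (hv _ r1) (hw _ r2)) => // x /=; rewrite addr0.
- move=> r v w hr v0 ew; apply/(dzeroP rpi) => F rF.
  have [b [rb cb]] := rep_ex rpi (phi 0%N r X).
  have r0 : rel (dcomp v (phi 0%N r X)) 0 pi (\0 : tot P -> tot X).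
    apply: rel_comp rb _; apply: rel_eqD kP (dmor_eq_sym v0) _.
    by apply: rel_dzero; rewrite addr0.
  have := rel_uniq kP (htp_refl _ _) (rel_eqD kP ew rF) r0.
  by rewrite !add0r.
Qed.

Lemma rel0 n Y Z (v : dmor n Y Z) m (P : Db A) (F : {linear tot P -> tot Y}) (F' : tot P -> tot Z) :
  kproj P -> htp m F \0 -> rel v m F F' -> htp (m + n) F' \0.
Proof.
move=> kP F0 rF; apply: rel_uniq kP F0 rF _; exists \0; split; first exact: cyc0.
  by apply: eq1_htp => x /=; rewrite linear0.
by apply: eq1_htp => x /=; rewrite linear0.
Qed.

Lemma relD n Y Z (v : dmor n Y Z) m (P : Db A) (F F1 : tot P -> tot Y) (F' F1' : tot P -> tot Z) :
  rel v m F F' -> rel v m F1 F1' -> rel v m (F \+ F1) (F' \+ F1').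
Proof.
move=> [G [cG h1 h2]] [K [cK k1 k2]]; exists (G \+ K); split; first exact: cycD.
  by apply: eq_htp (htpD h1 k1) => // x /=; rewrite linearD.
by apply: eq_htp (htpD h2 k2) => // x /=; rewrite linearD.
Qed.

Lemma relN n Y Z (v : dmor n Y Z) m (P : Db A) (F : tot P -> tot Y) (F' : tot P -> tot Z) :
  rel v m F F' -> rel v m (fun x => - F x) (fun x => - F' x).
Proof.
move=> [G [cG h1 h2]]; exists (sgn_map 1 G); split.
- by apply: eq_cyc (cycN cG) => x /=; rewrite sgn_map1E.
- by apply: eq_htp (htpN h1) => // x /=; rewrite sgn_map1E linearN.
- by apply: eq_htp (htpN h2) => // x /=; rewrite sgn_map1E linearN.
Qed.

(** In nonnegative degrees, homogeneous elements of degree at least [N] act as zero, since their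
    action also factors through a zero endomorphism of [X]. The chain condition bounds the degrees
    of generators, so high degrees are reached only by such elements. *)
Lemma gnoeth_vanish (T P X : Db A) (pi : {linear tot P -> tot X}) : resol pi ->
  (exists N, forall n : nat, (N <= n)%N -> forall u : dmor n%:Z X X, u =D dzero n%:Z X X) ->
  gnoeth phi T P -> exists B : nat, forall i : nat, (B <= i)%N -> Hom_zero P i%:Z T.
Proof.
move=> rpi [N hN] [n0 gP]; have [kP cpi _] := rpi.
have act0 m (r : R) (i : nat) (F F' : {linear tot P -> tot T}) : homog m r -> (N <= m)%N ->
    cyc i%:Z F -> rel (phi m r T) i%:Z F F' -> htp (i%:Z + m%:Z) F' \0.
  move=> hr Nm cF rF; have [b [rb cb]] := rep_ex rpi (phi m r X).
  have b0 : htp m%:Z b \0 by apply: (proj1 (dzeroP rpi (phi m r X))) rb; exact: hN.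
  have [F'' rF''] := rel_ex (roof rpi cF) kP cb.
  have F''0 : htp (i%:Z + m%:Z) F'' \0 by rewrite addrC; exact: rel0 kP b0 rF''.
  have [h|h] := act_natural_rel rpi hr (rel_roof rpi cF) rF rb rF''.
    exact: htp_trans (htp_sym h) F''0.
  by apply: eq_htp (htp_trans (htpN (htp_sym h)) (htpN F''0)) => x /=; rewrite ?opprK ?oppr0.
pose n1 := `|n0|%N.
(* The graded submodule generated by the degrees from 0 to [n1 + k], as an intersection of
   submodules. *)
pose gen k i (F : {linear tot P -> tot T}) := cyc i F /\
  forall C, gsub phi C -> (forall j (G : {linear tot P -> tot T}),
    0 <= j <= (n1 + k)%N%:Z -> cyc j G -> C j G) -> C i F.
have [||k0 hk0] := gP gen.
- move=> k; split.
  + by move=> i F [].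
  + move=> i F G [cF hF] h; split; first exact: cyc_htp h cF.
    by move=> C gC hC; have [_ C2 _ _ _] := gC; exact: C2 (hF C gC hC) h.
  + by move=> i; split=> [|C gC hC]; [exact: cyc0|case: gC].
  + move=> i F G [cF hF] [cG hG]; split=> [|C gC hC]; first exact: cycD.
    by have [_ _ _ C4 _] := gC; apply: C4; [exact: hF|exact: hG].
  + split=> [i F [cF hF]|m r i F F' hr [cF hF] rF].
      split=> [|C gC hC]; first by apply: eq_cyc (cycN cF) => x /=; rewrite sgn_map1E.
      by have [_ _ _ _ [C5 _]] := gC; apply: C5; exact: hF.
    split=> [|C gC hC]; first exact: rel_cyc rF.
    by have [_ _ _ _ [_ C6]] := gC; exact: C6 hr (hF C gC hC) rF.
- move=> k i F [cF hF]; split=> // C gC hC; apply: hF => // j G hj; apply: hC; move: hj; lia.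
(* Generators have degree at most [n1 + k0], so moving one into degree at least [B] takes an element
   of degree at least [N]. [D] collects the elements killed by every move into these degrees; [F]
   itself is recovered with [r = 1]. *)
pose B := (n1 + k0 + N)%N.
pose D i (F : {linear tot P -> tot T}) := [/\ cyc i F, i < 0 -> htp i F \0 &
  forall m r (F' : {linear tot P -> tot T}),
  homog m r -> B%:Z <= i + m%:Z -> rel (phi m r T) i F F' -> htp (i + m%:Z) F' \0].
have gD : gsub phi D.
  split.
  - by move=> i F [].
  - move=> i F G [cF zF hF] h; split; first exact: cyc_htp h cF.
      by move=> /zF; exact: htp_trans (htp_sym h).
    by move=> m r F' hr hm /(rel_htpl (htp_sym h)); exact: hF.
  - move=> i; split=> [|_|m r F' hr hm]; [exact: cyc0|exact: htp_refl|].
    by apply: rel0 => //; exact: htp_refl.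
  - move=> i F G [cF zF hF] [cG zG hG]; split; first exact: cycD.
      by move=> i0; apply: eq_htp (htpD (zF i0) (zG i0)) => // x /=; rewrite addr0.
    move=> m r F' hr hm rF'.
    have [F1 r1] := rel_ex (phi m r T) kP cF; have [G1 r2] := rel_ex (phi m r T) kP cG.
    apply: htp_trans (rel_uniq kP (htp_refl _ _) rF' (relD r1 r2)) _.
    apply: eq_htp (htpD (hF _ _ _ hr hm r1) (hG _ _ _ hr hm r2)) => // x /=.
    by rewrite addr0.
  - split=> [i F [cF zF hF]|m r i F F' hr [cF zF hF] rF].
      split; first by apply: eq_cyc (cycN cF) => x /=; rewrite sgn_map1E.
        by move=> /zF h; apply: eq_htp (htpN h) => x /=; rewrite ?sgn_map1E ?oppr0.
      move=> m r F' hr hm rF'.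
      have r1 : rel (phi m r T) i F (sgn_map 1 F').
        apply: rel_htpr (rel_htpl _ (relN rF')); apply: eq1_htp => x /=.
          by rewrite sgn_map1E.
        by rewrite sgn_map1E opprK.
      apply: eq_htp (htpN (hF _ _ _ hr hm r1)) => x /=; last by rewrite oppr0.
      by rewrite sgn_map1E opprK.
    split; first exact: rel_cyc rF.
      move=> im; apply: rel0 kP (zF _) rF; lia.
    move=> m' r' F1 hr' hm' r1.
    have e : i + m%:Z + m'%:Z = i + (m' + m)%N%:Z by lia.
    rewrite e; apply: hF (homogM hr' hr) _ _; first by rewrite -e.
    exact: rel_eqD kP (dmor_eq_sym (actM phi hr' hr T)) (rel_comp rF r1).
exists B => i Bi F cF.
have [||_ hF] := hk0 (k0 + i)%N i%:Z F (leq_addr _ _) _.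
- by rewrite /B /n1 in Bi; lia.
- by split=> // C gC; apply=> //; lia.
have [|_ _ DF] := hF D gD.
  move=> j G hj cG; split=> //; first by lia.
  move=> m r F' hr hm rF'; case: j hj cG hm rF' => // j hj cG hm rF'.
  apply: act0 hr _ cG rF'; move: hj hm; rewrite /B; lia.
rewrite -[i%:Z]addr0; apply: (DF 0%N 1 F (homog1 R)); first by lia.
apply: rel_eqD kP (dmor_eq_sym (act1 phi T)) _; exists F; split=> //.
  by apply: eq1_htp => x /=; rewrite tmap_gid.
by apply: eq1_htp => x /=; rewrite tmap_gid.
Qed.

End HighVanishing.

(** * Modules over Artin algebras *)

Section ChainConditions.
Variables (T : Type) (sub : (T -> Prop) -> Prop).

Lemma artinian_min (Q : (T -> Prop) -> Prop) : artinian sub -> (forall S, Q S -> sub S) ->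
  (exists S, Q S) ->
  exists S, Q S /\ forall S', Q S' -> (forall x, S' x -> S x) -> forall x, S x -> S' x.
Proof.
move=> art Qsub [S0 QS0]; apply: contrapT => no.
have step (S : {S | Q S}) : exists S' : {S | Q S},
    (forall x, sval S' x -> sval S x) /\ ~ (forall x, sval S x -> sval S' x).
  apply: contrapT => h; apply: no; exists (sval S); split=> [|S' QS' sS x Sx]; first exact: svalP.
  by apply: contrapT => nx; apply: h; exists (exist _ S' QS'); split=> // k; exact: nx (k x Sx).
have [f hf] := choice step.
pose C n := iter n f (exist _ S0 QS0).
have [|n x|N hN] := art (fun n => sval (C n)); first by move=> n; exact/Qsub/svalP.
  by exact: (hf _).1.
by apply: (hf (C N)).2; exact: hN N.+1 (leqnSn N).
Qed.

Lemma noetherian_max (Q : (T -> Prop) -> Prop) : noetherian sub -> (forall S, Q S -> sub S) ->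
  (exists S, Q S) ->
  exists S, Q S /\ forall S', Q S' -> (forall x, S x -> S' x) -> forall x, S' x -> S x.
Proof.
move=> art Qsub [S0 QS0]; apply: contrapT => no.
have step (S : {S | Q S}) : exists S' : {S | Q S},
    (forall x, sval S x -> sval S' x) /\ ~ (forall x, sval S' x -> sval S x).
  apply: contrapT => h; apply: no; exists (sval S); split=> [|S' QS' sS x Sx]; first exact: svalP.
  by apply: contrapT => nx; apply: h; exists (exist _ S' QS'); split=> // k; exact: nx (k x Sx).
have [f hf] := choice step.
pose C n := iter n f (exist _ S0 QS0).
have [|n x|N hN] := art (fun n => sval (C n)); first by move=> n; exact/Qsub/svalP.
  by exact: (hf _).1.
by apply: (hf (C N)).2; exact: hN N.+1 (leqnSn N).
Qed.

End ChainConditions.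

Section Submodules.
Variables (A : pzRingType) (C : A -> Prop).
Implicit Type V : lmodType A.

Lemma submod_sub V S : submod_over C (V := V) S -> forall x y, S x -> S y -> S (x - y).
Proof. by move=> [_ SD SN _] x y Sx Sy; apply: SD => //; exact: SN. Qed.

Lemma submod_setI V (S S' : V -> Prop) :
  submod_over C S -> submod_over C S' -> submod_over C (fun x => S x /\ S' x).
Proof.
move=> [a0 aD aN aZ] [b0 bD bN bZ]; split=> //.
- by move=> x y [? ?] [? ?]; split; [exact: aD|exact: bD].
- by move=> x [? ?]; split; [exact: aN|exact: bN].
- by move=> a x Ca [? ?]; split; [exact: aZ|exact: bZ].
Qed.

Lemma submod_setD V (S S' : V -> Prop) : submod_over C S -> submod_over C S' ->
  submod_over C (fun x => exists y z, [/\ S y, S' z & x = y + z]).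
Proof.
move=> [a0 aD aN aZ] [b0 bD bN bZ]; split.
- by exists 0, 0; rewrite addr0.
- move=> x y [x1 [x2 [? ? ->]]] [y1 [y2 [? ? ->]]]; exists (x1 + y1), (x2 + y2).
  by split; [exact: aD|exact: bD|exact: addrACA].
- by move=> x [x1 [x2 [? ? ->]]]; exists (- x1), (- x2); split; [exact: aN|exact: bN|exact: opprD].
- move=> a x Ca [x1 [x2 [? ? ->]]]; exists (a *: x1), (a *: x2).
  by split; [exact: aZ|exact: bZ|exact: scalerDr].
Qed.

(** The span with coefficients in [C], recursive in the list of generators so that chain conditions
    can be proved one generator at a time. *)
Fixpoint gspan V (s : seq V) (x : V) : Prop :=
  if s is v :: s' then exists z y, [/\ C z, gspan s' y & x = z *: v + y] else x = 0.

Lemma gspan_fingen V : fingen_over C V -> exists s : seq V, forall x, gspan s x.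
Proof.
move=> [s hs]; exists s => x; have [c [cC ->]] := hs x; move: c cC {hs x}.
elim: s => [|v s IH] c cC /=; first by rewrite big_ord0.
rewrite big_ord_recl /=; exists (c 0%N), (\sum_(i < size s) c i.+1 *: s`_i).
by split=> //; exact: (IH (fun i => c i.+1)).
Qed.

Hypotheses (C0 : C 0) (CD : forall x y, C x -> C y -> C (x + y)) (CN : forall x, C x -> C (- x))
  (CM : forall x y, C x -> C y -> C (x * y)).

Lemma submod_gspan V (s : seq V) : submod_over C (gspan s).
Proof.
elim: s => [|v s [s0 sD sN sZ]] /=.
  by split=> [//|x y -> ->|x ->|a x _ ->]; rewrite ?addr0 ?oppr0 ?scaler0.
split.
- by exists 0, 0; rewrite scale0r addr0.
- move=> x y [z [u [? ? ->]]] [z' [u' [? ? ->]]]; exists (z + z'), (u + u').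
  by split; [exact: CD|exact: sD|rewrite scalerDl addrACA].
- move=> x [z [u [? ? ->]]]; exists (- z), (- u).
  by split; [exact: CN|exact: sN|rewrite scaleNr opprD].
- move=> a x Ca [z [u [? ? ->]]]; exists (a * z), (a *: u).
  by split; [exact: CM|exact: sZ|rewrite scalerDr scalerA].
Qed.

Lemma gspan_catl V (s t : seq V) x : gspan s x -> gspan (s ++ t) x.
Proof.
elim: s x => [|v s IH] x /=; last by move=> [z [y [? ? ->]]]; exists z, y; split=> //; exact: IH.
by move->; have [] := submod_gspan t.
Qed.

Lemma gspan_catr V (s t : seq V) x : gspan t x -> gspan (s ++ t) x.
Proof.
elim: s x => [//|v s IH] x /= /IH h.
by exists 0, x; rewrite scale0r add0r.
Qed.

End Submodules.

Section Artin.
Variable A : pzRingType.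
Implicit Type V W : lmodType A.
Notation cen := (@central A).
Notation zsub := (submod_over cen).

Lemma central0 : cen 0.
Proof. by move=> x; rewrite mul0r mulr0. Qed.
Lemma central1 : cen 1.
Proof. by move=> x; rewrite mul1r mulr1. Qed.
Lemma centralD x y : cen x -> cen y -> cen (x + y).
Proof. by move=> hx hy z; rewrite mulrDl mulrDr hx hy. Qed.
Lemma centralN x : cen x -> cen (- x).
Proof. by move=> hx z; rewrite mulNr mulrN hx. Qed.
Lemma centralM x y : cen x -> cen y -> cen (x * y).
Proof. by move=> hx hy z; rewrite -mulrA hy mulrA hx -mulrA. Qed.
Hint Resolve central0 central1 : core.

Lemma zsub_gspan V (s : seq V) : zsub (gspan cen s).
Proof.
exact: (submod_gspan central0 centralD centralN centralM).
Qed.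

Lemma submod_zsub V S : submod (V := V) S -> zsub S.
Proof. by move=> [s0 sD sN sZ]; split=> // a x _; exact: sZ. Qed.

Definition zideal (I : A^o -> Prop) := zsub I /\ forall x, I x -> cen x.

Lemma zideal_cen : zideal (fun x : A^o => cen x).
Proof.
split=> //; split; [exact: central0|exact: centralD|exact: centralN|exact: centralM].
Qed.

Section Dcc.
Hypothesis artZ : artinian zideal.

(** For a new generator [v], the coefficients of [v] occurring in [C n] modulo the span of [s] form
    a descending chain of ideals of the center. Once it is stationary, an element can be corrected
    to have no [v] component, and induction applies. *)
Lemma span_dcc V (s : seq V) (C : nat -> V -> Prop) : (forall n, zsub (C n)) ->
  (forall n x, C n.+1 x -> C n x) ->
  exists N, forall n, (N <= n)%N -> forall x, gspan cen s x -> C N x -> C n x.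
Proof.
move=> sC dC; have dC' n m x : (n <= m)%N -> C m x -> C n x.
  by move/subnK <-; elim: (m - n)%N => [//|k IH]; rewrite addSn => /dC/IH.
elim: s => [|v s [N1 h1]].
  by exists 0%N => n _ x /= -> _; have [] := sC n.
pose I n (z : A^o) := cen z /\ exists y, gspan cen s y /\ C n ((z : A) *: v + y).
have [s0 sD sN sZ] := zsub_gspan s.
have [||N2 h2] := artZ (C := I).
- move=> n; have [c0 cD cN cZ] := sC n; split; last by move=> x [].
  split.
  + by split=> //; exists 0; rewrite scale0r addr0.
  + move=> x y [cx [u [gu Cu]]] [cy [u' [gu' Cu']]]; split; first exact: centralD.
    by exists (u + u'); split; [exact: sD|rewrite scalerDl addrACA; exact: cD].
  + move=> x [cx [u [gu Cu]]]; split; first exact: centralN.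
    by exists (- u); split; [exact: sN|rewrite scaleNr -opprD; exact: cN].
  + move=> a x ca [cx [u [gu Cu]]]; split; first exact: centralM.
    exists (a *: u); split; first exact: sZ.
    by rewrite -scalerA -scalerDr; exact: cZ.
- by move=> n x [cx [u [gu Cu]]]; split=> //; exists u; split=> //; exact: dC.
exists (N1 + N2)%N => n Nn x [z [y [cz gy ->]]] Cx.
have [c0 cD cN cZ] := sC n.
have [|_ [y' [gy' Cy']]] := h2 n (leq_trans (leq_addl _ _) Nn) z.
  split=> //; exists y; split=> //; apply: dC' Cx; exact: leq_addl.
have -> : z *: v + y = (z *: v + y') + (y - y') by zmod.
apply: cD => //; apply: h1; first exact: leq_trans (leq_addr _ _) Nn.
  exact: (submod_sub (zsub_gspan s)).
have -> : y - y' = (z *: v + y) - (z *: v + y') by zmod.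
apply: (submod_sub (sC N1)); first by apply: dC' Cx; exact: leq_addr.
by apply: dC' Cy'; exact: leq_trans (leq_addr _ _) Nn.
Qed.

Lemma zsub_artinian V (s : seq V) : (forall x, gspan cen s x) -> artinian (@submod_over A cen V).
Proof.
move=> hs C sC dC; have [N hN] := span_dcc s sC dC.
by exists N => n Nn x; exact: hN.
Qed.

(* Ascending chains of [Z]-submodules stabilise in all subquotients killed by [I]
   of artinian modules. *)
Definition acc_subquotients (I : A^o -> Prop) := forall V, artinian (@submod_over A cen V) ->
  forall W1 W2 : V -> Prop, zsub W1 -> zsub W2 -> (forall x, W1 x -> W2 x) ->
  (forall a w, I a -> W2 w -> W1 ((a : A) *: w)) ->
  forall C : nat -> V -> Prop, (forall n, zsub (C n)) -> (forall n x, C n x -> C n.+1 x) ->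
  (forall n x, W1 x -> C n x) -> (forall n x, C n x -> W2 x) ->
  exists N, forall n, (N <= n)%N -> forall x, C n x -> C N x.

(* Vectors [v i] witnessing a strictly ascending chain span strictly descending tails. *)
Lemma acc_subquotients_maximal (m : A^o -> Prop) :
  (forall z : A, cen z -> ~ m z -> exists2 z' : A, cen z' & m (1 - z' * z)) -> acc_subquotients m.
Proof.
move=> hm V artV W1 W2 sW1 sW2 W12 mW C sC aC WC CW; apply: contrapT => no.
have aC' n k x : (n <= k)%N -> C n x -> C k x.
  by move/subnK <-; elim: (k - n)%N => [//|l IH] /IH; rewrite addSn; exact: aC.
have step n : exists t : nat * V, (n <= t.1)%N /\ C t.1 t.2 /\ ~ C n t.2.
  apply: contrapT => h; apply: no; exists n => k nk x Cx; apply: contrapT => nx.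
  by apply: h; exists (k, x).
have [f hf] := choice step.
pose k i := iter i (fun n => (f n).1) 0%N; pose v i := (f (k i)).2.
have kS i : (k i <= k i.+1)%N := (hf (k i)).1.
have kle i j : (i <= j)%N -> (k i <= k j)%N.
  move/subnK <-; elim: (j - i)%N => [//|l IH]; rewrite addSn; exact: leq_trans IH (kS _).
have vC i : C (k i.+1) (v i) := (hf (k i)).2.1.
have vN i : ~ C (k i) (v i) := (hf (k i)).2.2.
have [w0 wD wN wZ] := sW1.
(* [W1] plus the span of [v j], ..., [v (l - 1)]. The union over [l] is a tail, and the tails
   descend with [j]; at a stationary [N] the vector [v N] lies in the next tail. *)
pose W j l w := exists c : nat -> A, (forall i, cen (c i)) /\
  W1 (w - \sum_(j <= i < l) c i *: v i).
have Wmono j l l' w : (l <= l')%N -> W j l w -> W j l' w.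
  move=> ll' [c [cc Wc]]; exists (fun i => if (i < l)%N then c i else 0); split.
    by move=> i; case: ifP.
  suff -> : \sum_(j <= i < l') (if (i < l)%N then c i else 0) *: v i = \sum_(j <= i < l) c i *: v i by [].
  rewrite [RHS](big_nat_widen _ _ _ _ _ ll') [RHS]big_mkcond /=.
  by apply: eq_bigr => i _; case: ifP; rewrite ?scale0r.
have [||N hN] := artV (fun j w => exists l, W j l w).
- move=> j; split.
  + exists 0%N, (fun=> 0); split=> //; rewrite big1 ?subr0 // => i _; exact: scale0r.
  + move=> x y [l1 /(Wmono _ _ (l1 + _)%N _ (leq_addr _ _)) Wx].
    move=> [l2 /(Wmono _ _ (l1 + l2)%N _ (leq_addl _ _)) Wy].
    have [c [cc h1]] := Wx l2; have [c' [cc' h2]] := Wy.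
    exists (l1 + l2)%N, (fun i => c i + c' i); split; first by move=> i; exact: centralD.
    rewrite (eq_bigr _ (fun i _ => scalerDl _ _ _)) big_split /= opprD addrACA; exact: wD.
  + move=> x [l [c [cc h]]]; exists l, (fun i => - c i); split; first by move=> i; exact: centralN.
    rewrite (eq_bigr _ (fun i _ => scaleNr _ _)) sumrN -opprD; exact: wN.
  + move=> a x ca [l [c [cc h]]]; exists l, (fun i => a * c i); split.
      by move=> i; exact: centralM.
    rewrite (eq_bigr _ (fun i _ => esym (scalerA _ _ _))) -scaler_sumr -scalerBr; exact: wZ.
- move=> j w [l [c [cc h]]]; exists (j + l)%N.
  have [lt|ge] := leqP l j.
    exists (fun=> 0); split=> //.
    rewrite [X in w - X]big1 => [|i _]; last exact: scale0r.
    by move: h; rewrite big_geq // (leq_trans lt).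
  apply: Wmono (leq_addl _ _) _.
  exists (fun i => if i == j then 0 else c i); split; first by move=> i; case: ifP.
  rewrite big_ltn // eqxx scale0r add0r.
  suff -> : \sum_(j.+1 <= i < l) (if i == j then 0 else c i) *: v i =
            \sum_(j.+1 <= i < l) c i *: v i by [].
  apply: eq_big_nat => i /andP[ji _].
  by rewrite gtn_eqF.
have [|l [c [cc Wv]]] := hN N.+1 (leqnSn N) (v N).
  exists N.+1, (fun=> 1); split=> //.
  by rewrite big_nat1 scale1r subrr.
have CkN : C (k N.+1) (\sum_(N.+1 <= i < l) c i *: v i).
  have -> : \sum_(N.+1 <= i < l) c i *: v i = v N - (v N - \sum_(N.+1 <= i < l) c i *: v i).
    by rewrite opprB addrC subrK.
  by apply: (submod_sub (sC _)) => //; exact: WC.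
(* The terms are removed from the top. All but the last lie in [C (k l)], hence so does the last. A
   coefficient outside [m] is invertible up to an element of [m], which sends [v l] into [W1], and
   would force [v l] into [C (k l)]. So the coefficient is in [m] and the term in [W1]. *)
have SW : W1 (\sum_(N.+1 <= i < l) c i *: v i).
  elim: l {Wv} CkN => [|l IH]; first by rewrite big_geq.
  have [lt|ge] := leqP l N; first by rewrite big_geq.
  rewrite big_nat_recr //= => hC.
  have CS : C (k l) (\sum_(N.+1 <= i < l) c i *: v i).
    have [c0 cD _ cZ] := sC (k l).
    rewrite big_nat; apply: (big_ind (C (k l))) => // i /andP[_ il].
    by apply: cZ => //; apply: aC' (vC i); exact: (kle i.+1 l).
  have Cl : C (k l) (c l *: v l).
    have -> : c l *: v l = (\sum_(N.+1 <= i < l) c i *: v i + c l *: v l) -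
       \sum_(N.+1 <= i < l) c i *: v i by rewrite addrC addKr.
    by apply: (submod_sub (sC _)) => //; apply: aC' hC; exact: (kle N.+1 l).
  have ml : m (c l).
    apply: contrapT => nm; have [z' cz' hz'] := hm _ (cc l) nm.
    apply: (vN l); have -> : v l = (1 - z' * c l) *: v l + z' *: (c l *: v l).
      by rewrite scalerA -scalerDl subrK scale1r.
    have [c0 cD _ cZ] := sC (k l); apply: cD; last exact: cZ.
    by apply: WC; apply: mW => //; exact: CW (vC l).
  have Wl : W1 (c l *: v l) by apply: mW => //; exact: CW (vC l).
  apply: wD => //; apply: IH.
  have -> : \sum_(N.+1 <= i < l) c i *: v i =
    (\sum_(N.+1 <= i < l) c i *: v i + c l *: v l) - c l *: v l by rewrite addrK.
  by apply: (submod_sub (sC _)) => //; exact: WC.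
apply: (vN N); apply: WC; rewrite -[v N](subrK (\sum_(N.+1 <= i < l) c i *: v i)); exact: wD.
Qed.

(* If a minimal ideal [I] with this property is not zero, choose [x] generating a minimal
  ideal over the annihilator of [I]; then the annihilator of [x] in [I] has the property
  and is strictly smaller. *)
Lemma acc_subquotients_zero : acc_subquotients (fun a => a = 0).
Proof.
have [||I [[[sI cI] gI] minI]] := artinian_min (Q := fun I => zideal I /\ acc_subquotients I) artZ.
- by move=> S [].
- exists cen; split=> [|V _ W1 W2 _ _ _ h C _ _ WC CW].
    exact: zideal_cen.
  exists 0%N => n _ x Cx; apply: WC; rewrite -[x]scale1r; apply: h => //; exact: CW Cx.
have [I0|nI] := pselect (forall x, I x -> x = 0).
  move=> V artV W1 W2 s1 s2 W12 h; apply: (gI V artV W1 W2) => // a w /I0 -> _.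
  by rewrite scale0r; case: s1.
exfalso; have [i0 iD iN iZ] := sI.
pose T (z : A^o) := cen z /\ forall i : A, I i -> (z : A) * i = 0.
have sT : zsub T.
  split.
  - by split=> // i _; rewrite mul0r.
  - move=> x y [cx hx] [cy hy]; split=> [|i Ii]; first exact: centralD.
    by rewrite mulrDl hx // hy // addr0.
  - move=> x [cx hx]; split=> [|i Ii]; first exact: centralN.
    by rewrite mulNr hx // oppr0.
  - move=> a x ca [cx hx]; split=> [|i Ii]; first exact: centralM.
    by rewrite -mulrA hx // mulr0.
have [t0 tD tN tZ] := sT.
pose QT (J : A^o -> Prop) := [/\ zideal J, forall x, T x -> J x & exists2 x, J x & ~ T x].
have [||T' [[[sT' cT'] TT' [x T'x nTx]] minT]] := artinian_min (Q := QT) artZ.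
- by move=> S [].
- exists cen; split.
  + exact: zideal_cen.
  + by move=> y [].
  + exists 1 => // -[_ h]; apply: nI => y Iy; rewrite -[y]mul1r; exact: h.
have cx := cT' _ T'x; have [u0 uD uN uZ] := sT'.
pose m (z : A^o) := cen z /\ T ((z : A) * x).
have gm : acc_subquotients m.
  apply: acc_subquotients_maximal => z cz nm.
  (* If [z] is not in [m], the ideal [J] generated by [T] and [z x] competes with [T']; by
     minimality it contains [x], and the coefficient of [z x] in [x] inverts [z] modulo [m]. *)
  pose J (y : A^o) := exists t u : A^o,
    [/\ T t, (exists2 a : A, cen a & u = a * (z * x)) & y = t + u].
  have QJ : QT J.
    split.
    + split.
        apply: (submod_setD sT); split.
        * by exists 0 => //; rewrite mul0r.
        * move=> _ _ [a ca ->] [a' ca' ->]; exists (a + a'); [exact: centralD|by rewrite mulrDl].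
        * move=> _ [a ca ->]; exists (- a); [exact: centralN|by rewrite mulNr].
        * move=> a' _ ca' [a ca ->]; exists (a' * a); [exact: centralM|exact: mulrA].
      move=> y [t [u [[ct _] [a ca ->] ->]]]; apply: centralD => //.
      by apply: centralM => //; exact: centralM.
    + by move=> y Ty; exists y, 0; split=> //; [exists 0; rewrite ?mul0r|rewrite addr0].
    + exists (z * x); last by move=> h; apply: nm.
      by exists 0, (z * x); split=> //; [exists 1; rewrite ?mul1r|rewrite add0r].
  have [|t [u [Tt [a ca ->] ex]]] := minT J QJ _ x T'x.
    move=> y [t [u [Tt [a ca ->] ->]]]; apply: uD; first exact: TT'.
    by apply: (uZ a) => //; apply: (uZ z).
  exists a => //; split; first by apply: centralD => //; apply: centralN; exact: centralM.
  by rewrite mulrBl mul1r -mulrA [X in T (X - _)]ex addrK.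
pose I'' (z : A^o) := I z /\ x * z = 0.
have QI : zideal I'' /\ acc_subquotients I''.
  split; first split.
  - split.
    + by split=> //; rewrite mulr0.
    + by move=> y z [Iy xy] [Iz xz]; split; [exact: iD|rewrite mulrDr xy xz addr0].
    + by move=> y [Iy xy]; split; [exact: iN|rewrite mulrN xy oppr0].
    + move=> a y ca [Iy xy]; split; first exact: iZ.
      by rewrite mulrA -ca -mulrA xy mulr0.
  - by move=> y [/cI].
  move=> V artV W1 W2 s1 s2 W12 h C sC aC WC CW.
  have [v0 vD vN vZ] := s1; have [w0 wD wN wZ] := s2.
  (* Products of [m] and [I] lie in [I''], because [m x] annihilates [I]. Hence [W0] cuts the
     subquotient into [W0 / W1], killed by [m], and [W2 / W0], killed by [I]. *)
  pose W0 w := W2 w /\ forall z : A, m z -> W1 (z *: w).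
  have sW0 : zsub W0.
    split.
    + by split=> // z _; rewrite scaler0.
    + move=> y z [Wy hy] [Wz hz]; split; first exact: wD.
      by move=> a ma; rewrite scalerDr; apply: vD; [exact: hy|exact: hz].
    + move=> y [Wy hy]; split; first exact: wN.
      by move=> a ma; rewrite scalerN; apply: vN; exact: hy.
    + move=> a y ca [Wy hy]; split; first exact: wZ.
      by move=> b mb; rewrite scalerA -ca -scalerA; apply: vZ => //; exact: hy.
  have W10 y : W1 y -> W0 y by move=> Wy; split; [exact: W12|move=> z [cz _]; exact: vZ].
  have [|||||N1 h1] := gm V artV W1 W0 s1 sW0 W10 _ (fun n y => C n y /\ W0 y).
  - by move=> a w ma [_]; apply.
  - by move=> n; exact: submod_setI.
  - by move=> n y [Cy Wy]; split=> //; exact: aC.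
  - by move=> n y Wy; split; [exact: WC|exact: W10].
  - by move=> n y [].
  have [||||||N2 h2] := gI V artV W0 W2 sW0 s2 _ _
     (fun n y => exists c w, [/\ C n c, W0 w & y = c + w]).
  - by move=> y [].
  - move=> a w Ia Ww; have ca := cI _ Ia; split; first exact: wZ.
    move=> z [cz [_ hz]]; rewrite scalerA; apply: h => //; split; first exact: iZ.
    by rewrite mulrA -cz hz.
  - by move=> n; exact: submod_setD.
  - by move=> n y [c [w [Cc Ww ->]]]; exists c, w; split=> //; exact: aC.
  - by move=> n y Wy; exists 0, y; split; [have [] := sC n| |rewrite add0r].
  - by move=> n y [c [w [Cc [Ww _] ->]]]; apply: wD => //; exact: CW Cc.
  have aC' n l y : (n <= l)%N -> C n y -> C l y.
    by move/subnK <-; elim: (l - n)%N => [//|d IH] /IH; rewrite addSn; exact: aC.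
  exists (N1 + N2)%N => n Nn y Cy.
  have [|c [w [Cc Ww ey]]] := h2 n (leq_trans (leq_addl _ _) Nn) y.
    by exists y, 0; split; [|case: sW0|rewrite addr0].
  have [|Cw _] := h1 n (leq_trans (leq_addr _ _) Nn) w.
    split=> //; have -> : w = y - c by rewrite ey addrC addKr.
    apply: (submod_sub (sC n)) => //; apply: aC' Cc; exact: leq_trans (leq_addl _ _) Nn.
  have [_ cD _ _] := sC (N1 + N2)%N.
  by rewrite ey; apply: cD; [apply: aC' Cc; exact: leq_addl|apply: aC' Cw; exact: leq_addr].
by apply: nTx; split=> // i Ii; have [] := minI I'' QI (fun y => @proj1 _ _) i Ii.
Qed.

(** The module is artinian over the center, and as a subquotient of itself it is killed by the zero
    ideal. *)
Lemma zsub_noetherian V (s : seq V) :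
  (forall x, gspan cen s x) -> noetherian (@submod_over A cen V).
Proof.
move=> hs C sC aC.
apply: (acc_subquotients_zero (zsub_artinian hs) (W1 := fun x => x = 0) (W2 := fun=> True)) => //.
- by split=> [//|x y -> ->|x ->|a x _ ->]; rewrite ?addr0 ?oppr0 ?scaler0.
- by move=> a w -> _; rewrite scale0r.
- by move=> n x ->; have [] := sC n.
Qed.

End Dcc.

Lemma artin_span (hA : artin_algebra A) V : fingen V ->
  exists s : seq V, forall x, gspan cen s x.
Proof.
have [_ /gspan_fingen[t ht]] := hA; move=> /gspan_fingen[s hs].
exists (flatten [seq [seq (a : A) *: v | a <- t] | v <- s]) => x.
elim: s x {hs} (hs x) => [//|v s IH] x /= [a [y [_ gy ->]]].
have [_ sD _ _] := zsub_gspan (flatten [seq [seq (a : A) *: v | a <- t] | v <- v :: s]).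
apply: sD; last by apply: gspan_catr; [exact: central0|exact: IH].
apply: (gspan_catl central0 centralD centralN centralM).
have ha := ht a; clear IH ht; elim: t a ha => [|b t IH] a /=; first by move->; rewrite scale0r.
move=> [z [y' [cz gy' ->]]]; exists z, ((y' : A) *: v); split=> //; first exact: IH.
by rewrite scalerA -scalerDl.
Qed.

End Artin.

Section ArtinModules.
Variables (A : pzRingType) (hA : artin_algebra A).
Implicit Type V : lmodType A.

Lemma fg_artinian V : fingen V -> artinian (@submod A V).
Proof.
move=> fV; have [s hs] := artin_span hA fV; move=> C sC dC.
by apply: (zsub_artinian hA.1 hs) => // n; exact: submod_zsub.
Qed.

Lemma fg_noetherian V : fingen V -> noetherian (@submod A V).
Proof.
move=> fV; have [s hs] := artin_span hA fV; move=> C sC dC.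
by apply: (zsub_noetherian hA.1 hs) => // n; exact: submod_zsub.
Qed.

Lemma submod_True V : submod (fun _ : V => True).
Proof. by []. Qed.

Lemma submod_ker V (W : lmodType A) (f : {linear V -> W}) : submod (fun x => f x = 0).
Proof.
split=> [|x y hx hy|x hx|a x _ hx]; first exact: linear0.
- by rewrite linearD hx hy addr0.
- by rewrite linearN hx oppr0.
- by rewrite linearZ /= hx scaler0.
Qed.

Lemma submod_line V (v : V) : submod (fun x => exists a : A, x = a *: v).
Proof.
split.
- by exists 0; rewrite scale0r.
- by move=> _ _ [a ->] [b ->]; exists (a + b); rewrite scalerDl.
- by move=> _ [a ->]; exists (- a); rewrite scaleNr.
- by move=> c _ _ [a ->]; exists (c * a); rewrite scalerA.
Qed.

(** Among the submodules of [S] covered by a finite free module there is a maximal one; adding the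
    line through any [v] in [S] shows that it is all of [S]. *)
Lemma submod_fg V (S : V -> Prop) : fingen V -> submod S ->
  exists F : fgmod A, isfree F /\ exists rho : {linear F -> V}, forall v, S v <-> exists x, rho x = v.
Proof.
move=> fV sS; have [s0 sD sN sZ] := sS.
pose Q (U : V -> Prop) := (forall v, U v -> S v) /\ exists F : fgmod A, isfree F /\
  exists rho : {linear F -> V}, forall v, U v <-> exists x, rho x = v.
have Qsub U : Q U -> submod U.
  move=> [_ [F [_ [rho hr]]]]; split.
  - by apply/hr; exists 0; rewrite linear0.
  - by move=> x y /hr[a <-] /hr[b <-]; apply/hr; exists (a + b); rewrite linearD.
  - by move=> x /hr[a <-]; apply/hr; exists (- a); rewrite linearN.
  - by move=> c x _ /hr[a <-]; apply/hr; exists (c *: a); rewrite linearZ.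
have [|U [QU maxU]] := noetherian_max (fg_noetherian fV) Qsub.
  exists (fun v => v = 0); split=> [v ->//|]; exists (fgzero A); split; first exact: isfree0.
  by exists \0 => v; split=> [->|[x <-]] //; exists 0.
have [US [F [fF [rho hr]]]] := QU.
exists F; split=> //; exists rho => v; split=> [Sv|/hr]; last exact: US.
apply/hr; pose rho' : {linear fgprod (fgregular A) F -> V} := (smul v \o fst) \+ (rho \o snd).
apply: (maxU (fun w => exists x, rho' x = w)).
- split=> [w [[a x] <-]|].
    by apply: sD; [exact: sZ|apply: US; apply/hr; exists x].
  exists (fgprod (fgregular A) F); split; first by apply: isfree_prod => //; exact: isfree1.
  by exists rho'.
- move=> w /hr[x <-]; exists (0 : A, x); rewrite /rho' /= smulE scale0r; exact: add0r.
- exists (1 : A, 0 : F); rewrite /rho' /= smulE scale1r linear0; exact: addr0.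
Qed.

(* The class of [e] in [A / rad A] generates a complement of [m / rad A]: [e] is taken in a
  left ideal minimal among those that contain the radical and supplement [m]. *)
Lemma maximal_split (m : A^o -> Prop) : maximal_left_ideal m ->
  exists e : A, (forall b : A, m b -> jacobson (b * e)) /\ m (1 - e).
Proof.
move=> mm; have [sm _ _] := mm; have [m0 mD mN mZ] := sm.
have jm x : jacobson x -> m x by apply.
have sJ : submod (fun x : A^o => jacobson (x : A)).
  split.
  - by move=> I [[]].
  - by move=> x y hx hy I hI; have [[_ h _ _] _ _] := hI; apply: h; [exact: hx|exact: hy].
  - by move=> x hx I hI; have [[_ _ h _] _ _] := hI; apply: h; exact: hx.
  - by move=> a x _ hx I hI; have [[_ _ _ h] _ _] := hI; apply: h => //; exact: hx.
pose Q (c : A^o -> Prop) := [/\ submod c, forall x : A, jacobson x -> c x &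
  exists2 e : A, c e & m (1 - e)].
have [||c [[sc Jc [e ce me]] minc]] := artinian_min (Q := Q) (fg_artinian (@fingen_regular A)).
- by move=> S [].
- by exists (fun=> True); split=> //; exists 1 => //; rewrite subrr.
have [c0 cD cN cZ] := sc.
(* If [x] in [c] and [m] avoided a maximal left ideal [m'], the intersection of [c] and [m'] would
   still supplement [m], against the minimality of [c]. *)
have cm x : c x -> m x -> jacobson (x : A).
  move=> cx mx m' hm'; apply: contrapT => nx; have [sm' [y ny] maxm'] := hm'.
  have [m'0 m'D m'N m'Z] := sm'.
  have [u hu] : exists u : A, m' (1 - u * x).
    have [||J1|J1] := maxm' (fun y => exists z w, [/\ m' z, (exists a : A, w = a *: x) & y = z + w]).
    - by apply: submod_setD => //; exact: submod_line.
    - by move=> z hz; exists z, 0; split=> //; [exists 0; rewrite scale0r|rewrite addr0].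
    - exfalso; apply: nx; apply: J1; exists 0, x; split=> //; last by rewrite add0r.
      by exists 1; rewrite scale1r.
    - have [z [w [hz [a ->] e1]]] := J1 (1 : A); exists a.
      by rewrite [X in X - _]e1 addrK.
  apply: nx; have [||] // := minc (fun y => c y /\ m' y) _ _ x cx; last by move=> z [].
  split; first exact: submod_setI.
    by move=> z Jz; split; [exact: Jc|exact: Jz].
  (* As [1 - u x] is in [m'], so is [e (1 - u x)]; it differs from [e] by a multiple of [x], which
     lies in [m]. *)
  exists (e - e * u * x).
    split; first by apply: cD => //; apply: cN; exact: (cZ (e * u)).
    have -> : e - e * u * x = e *: ((1 - u * x) : A^o) by rewrite [RHS]mulrBr mulr1 mulrA.
    exact: m'Z.
  have -> : 1 - (e - e * u * x) = (1 - e) + e * u * x by rewrite opprB addrA addrAC.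
  by apply: mD => //; exact: (mZ (e * u)).
exists e; split=> // b mb; apply: cm; first exact: (cZ b).
have -> : b * e = b - b *: ((1 - e) : A^o) by rewrite [b *: _]mulrBr mulr1 opprB addrC subrK.
by apply: (submod_sub sm) => //; exact: mZ.
Qed.

(* For a free resolution [P] and a submodule [S] of [V]: [Ext^(- j)] with values in [S]
  vanishes. *)
Definition Ext_zero_in (P : Db A) (j : int) V (S : V -> Prop) :=
  forall g : {linear P j -> V}, (forall x, S (g x)) ->
    (forall x : P (j - 1), g (diff P (j - 1) j x) = 0) ->
  exists h : {linear P (j + 1) -> V}, (forall x, S (h x)) /\
    forall x, g x = h (diff P j (j + 1) x).

(** In place of a composition series: [L] is maximal among the submodules of [S] for which vanishing
    holds, and [L'] is minimal above it. The simple factor [L' / L] is a summand of [K], so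
    vanishing extends to [L'], a contradiction. *)
Lemma Ext_zero_in_fg (K : fgmod A) (p : {linear A^o -> K}) (hK : is_mod_jacobson p)
    (P : Db A) (j : int) : frees P -> Ext_zero_in P j (fun _ : K => True) ->
  forall V (S : V -> Prop), fingen V -> submod S -> Ext_zero_in P j S.
Proof.
move=> fP vK V S fV sS; have [psurj pker] := hK.
pose Q (L : V -> Prop) := [/\ submod L, forall x, L x -> S x & Ext_zero_in P j L].
have QL L : Q L -> submod L by case.
have [|L [[sL LS vL] maxL]] := noetherian_max (fg_noetherian fV) QL.
  exists (fun v => v = 0); split; [exact: submod0|by move=> x ->; case: sS|].
  move=> g g0 _; exists \0; split=> // x; exact: g0.
have [SL|nSL] := pselect (forall x, S x -> L x).
  move=> g gS dg; have [h [hL e]] := vL g (fun x => SL _ (gS x)) dg.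
  by exists h; split=> // x; exact: LS.
exfalso; pose QM (L' : V -> Prop) := [/\ submod L', forall x, L' x -> S x,
  forall x, L x -> L' x & exists2 x, L' x & ~ L x].
have [||L' [[sL' L'S LL' [x L'x nLx]] minL']] := artinian_min (Q := QM) (fg_artinian fV).
- by move=> U [].
- exists S; split=> //; apply: contrapT => h; apply: nSL => x Sx; apply: contrapT => nx.
  by apply: h; exists x.
have [l0 lD lN lZ] := sL; have [l'0 l'D l'N l'Z] := sL'.
have gen y : ~ L y -> L' y -> forall z, L' z -> exists a : A, L (z - a *: y).
  move=> nLy L'y z L'z.
  have [||] := minL' (fun v => exists l w, [/\ L l, (exists a : A, w = a *: y) & v = l + w]) _ _ z L'z.
  - split.
    + by apply: submod_setD => //; exact: submod_line.
    + move=> v [l [w [Ll [a ->] ->]]]; apply: L'S; apply: l'D; [exact: LL'|exact: l'Z].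
    + by move=> v Lv; exists v, 0; split=> //; [exists 0; rewrite scale0r|rewrite addr0].
    + exists y => //; exists 0, y; split=> //; last by rewrite add0r.
      by exists 1; rewrite scale1r.
  - by move=> v [l [w [Ll [a ->] ->]]]; apply: l'D; [exact: LL'|exact: l'Z].
  - by move=> l [w [Ll [a ->] ->]]; exists a; rewrite addrK.
(* [L' / L] is generated by the class of [x] and is isomorphic to [A / m]. Right multiplication by
   the [e] found below embeds it in [A / rad A], split by the projection to [A / m] since [1 - e] is
   in [m]. *)
pose m (a : A^o) := L ((a : A) *: x).
have sm : submod m.
  split.
  - by rewrite /m scale0r.
  - by move=> a b ma mb; rewrite /m scalerDl; exact: lD.
  - by move=> a ma; rewrite /m scaleNr; exact: lN.
  - by move=> a b _ mb; rewrite /m -scalerA; exact: lZ.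
have mm : maximal_left_ideal m.
  split=> //; first by exists 1; rewrite /m scale1r.
  move=> J sJ mJ; have [Jm|nJ] := pselect (forall a, J a -> m a); [by left|right].
  have [a Ja nma] : exists2 a, J a & ~ m a.
    apply: contrapT => h; apply: nJ => a Ja; apply: contrapT => na; by apply: h; exists a.
  have [|b hb] := gen _ nma _ x L'x; first exact: l'Z.
  have J1 : J (1 : A).
    have -> : (1 : A) = ((1 - b * a : A) : A^o) + b *: (a : A^o) by rewrite /= [b *: _]/(b * a) subrK.
    case: sJ => _ JD _ JZ; apply: JD; last exact: JZ.
    by apply: mJ; rewrite /m scalerBl scale1r -scalerA.
  move=> z; have -> : z = (z : A) *: (1 : A^o) by rewrite [RHS]mulr1.
  by case: sJ => _ _ _ JZ; exact: JZ.
have jm a : jacobson (a : A) -> m a by apply.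
have [e [he me]] := maximal_split mm.
suff vL' : Ext_zero_in P j L' by apply: nLx; apply: (maxL L').
move=> g gL' dg.
have [|al hal] := @free_lift_mod _ _ (fP j) _ _ (smul x) L g sL.
  by move=> y; exact: gen.
(* Modulo [L], the cocycle [g] is [al] followed by the action on [x]; multiplied by [e] it becomes a
   cocycle with values in [K], hence a coboundary [h]. *)
have [|h [_ hh]] := vK (p \o (smul (e : A^o) \o al)) (fun=> I).
  move=> y /=; apply/pker; rewrite smulE; apply: he; rewrite /m.
  by have := lN _ (hal (diff P (j - 1) j y)); rewrite dg sub0r opprK.
have [|ht hht] := @free_lift _ _ (fP (j + 1)) _ _ p h; first by move=> y; exact: psurj.
have mdiff y : m (al y - ht (diff P j (j + 1) y) * e).
  set b := ht _; have jb : jacobson (b - (al y : A) * e).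
    apply/pker; rewrite linearB hht /b -hh /= smulE; exact: subrr.
  have m1 (a : A) : m (a * (1 - e)) by case: sm => _ _ _ mZ; exact: mZ.
  have -> : (al y : A) - b * e = al y * (1 - e) + al y * e * (1 - e) - (b - al y * e) * e.
    by rewrite !mulrBr !mulr1 mulrBl; zmod.
  apply: (submod_sub sm); last exact: (jm _ (he _ (jm _ jb))).
  by case: sm => _ mD _ _; apply: mD.
(* The coboundary is carried back to [L']. It accounts for [g] modulo [L], and the vanishing for [L]
   takes care of the difference. *)
pose k : {linear P (j + 1) -> V} := smul x \o (smul (e : A^o) \o ht).
have kE y : k y = ((ht y : A) * e) *: x by [].
have [||h' [h'L eh']] := vL (g \- (k \o diff P j (j + 1))).
- move=> y; rewrite -[X in L X]/(g y - k (diff P j (j + 1) y)).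
  have -> : g y - k (diff P j (j + 1) y) =
     (g y - (al y : A) *: x) + ((al y : A) - (ht (diff P j (j + 1) y) : A) * e) *: x.
    by rewrite kE scalerBl; zmod.
  by apply: lD; [exact: hal|exact: mdiff].
- move=> y; rewrite -[LHS]/(g _ - k (diff P j (j + 1) _)) dg diffK //; last by lia.
  by rewrite linear0 subr0.
exists (h' \+ k); split=> y.
  by apply: l'D; [exact: LL'|rewrite kE; exact: l'Z].
by rewrite /= -eh' /= subrK.
Qed.

End ArtinModules.

Section StalkBridge.
Variables (A : pzRingType) (N : fgmod A).
Implicit Type P : Db A.

Definition Ext_zero P (j : int) := Ext_zero_in P j (fun _ : N => True).

Lemma stalk_zero (j : int) (x : stalk N j) : j <> 0 -> x = 0.
Proof.
move: x; rewrite /stalk /= /stalk_ob; case: eqP => // _ x _; exact: thinmx0.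
Qed.

(** The stalk lives in degree 0, so a chain map of degree [n] amounts to its entry out of degree
    [- n], and a homotopy to its entry out of degree [- n + 1]. *)
Lemma Hom_zero_stalk P (n : int) : Hom_zero P n (stalk N) <-> Ext_zero P (- n).
Proof.
split=> [hv g _ dg|ve F cF].
  have cf : chmap n (bump (X := P) (Y := stalk N) (i0 := - n) (j0 := 0) g).
    move=> i i' j j' ii' ij jj' x; rewrite /= scaler0.
    have [e|ne] := pselect (i' = - n); last by rewrite bump_ne.
    have e' : j' = 0 by lia.
    have e'' : i = - n - 1 by lia.
    clear ii' ij jj'; subst i' j' i; rewrite bumpE; exact: dg.
  have [h hh] : homotopic n (bump (X := P) (Y := stalk N) (i0 := - n) (j0 := 0) g) (@gzero A P (stalk N)).
    apply/homotopicE; apply: (eq_htp (fun=> erefl) (fsym (@tmap_gzero A n P (stalk N)))).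
    apply: hv; exact/chmap_cyc.
  exists (sgn_map n (h (- n + 1) 0)); split=> // x.
  have := hh (- n) (- n + 1) 0 (-1) erefl ltac:(lia) ltac:(lia) x.
  by rewrite bumpE /= subr0 add0r sgn_mapE.
have cf := ent_chmap cF.
have [|h [_ eh]] := ve (ent F (- n) 0) (fun=> I).
  move=> x; rewrite (cf (- n - 1) (- n) (-1) 0); try lia.
  by rewrite /= scaler0.
have /homotopicE : homotopic n (ent F) (@gzero A P (stalk N)).
  exists (bump (X := P) (Y := stalk N) (i0 := - n + 1) (j0 := 0) (sgn_map n h)).
  move=> i i' j j' ii' ij jj' x; rewrite /= subr0 add0r.
  have [e|ne] := pselect (i = - n); last by rewrite [LHS]stalk_zero ?[RHS]stalk_zero //; lia.
  have e' : j = 0 by lia.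
  clear ij jj'; subst i i' j; by rewrite bumpE /= sgn_mapE /= sgnM -eh.
by move=> hh; apply: (eq_htp _ _ hh) => x; rewrite ?tmap_gzero // tmap_ent //; exact: cF.1.
Qed.

End StalkBridge.

Section SubmoduleType.
Variables (A : pzRingType) (W : lmodType A) (S : W -> Prop) (sS : submod S).

(* The unused argument makes the closure proof available to instance resolution. *)
Definition submod_pred_of (_ : submod S) : {pred W} := fun x => `[< S x >].
Notation submod_pred := (submod_pred_of sS).

Lemma submod_predP x : reflect (S x) (x \in submod_pred).
Proof. exact: asboolP. Qed.

Lemma submod_pred_closed : submod_closed submod_pred.
Proof.
have [s0 sD sN sZ] := sS; split=> [|a x y]; first exact/submod_predP.
by move=> /submod_predP Sx /submod_predP Sy; apply/submod_predP; apply: sD => //; exact: sZ.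
Qed.

Record submod_type := SubmodType { submod_val : W; submod_valP : submod_val \in submod_pred }.
HB.instance Definition _ := [isSub for submod_val].
HB.instance Definition _ := [Choice of submod_type by <:].
HB.instance Definition _ :=
  GRing.SubChoice_isSubLmodule.Build A W submod_pred submod_type submod_pred_closed.

End SubmoduleType.

(** * Free resolutions and injective dimension *)

Section ResolutionComplex.
Variables (A : pzRingType) (F : nat -> fgmod A) (dk : forall k, {linear F k.+1 -> F k}).
Hypothesis dkP : forall k v, dk k v = 0 <-> exists x, dk k.+1 x = v.

Definition res_ob (i : int) : fgmod A :=
  match i with Posz 0 => F 0 | Posz _.+1 => fgzero A | Negz k => F k.+1 end.
(** The successor by pattern matching: it computes on constructors, so that [res_next_diff] is typed
    without transport. As [Negz k] is [- (k + 1)], it carries the term [F k.+1]. *)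
Definition res_next (i : int) : int :=
  match i with Posz k => Posz k.+1 | Negz 0 => Posz 0 | Negz k.+1 => Negz k end.
Definition res_next_diff (i : int) : {linear res_ob i -> res_ob (res_next i)} :=
  match i with Posz k => \0 | Negz 0 => dk 0 | Negz k.+1 => dk k.+1 end.
Definition res_diff (i j : int) : {linear res_ob i -> res_ob j} :=
  idx res_ob (res_next i) j \o res_next_diff i.

Lemma res_nextE i : res_next i = i + 1. Proof. by case: i => [k|[|k]] /=; lia. Qed.
Lemma res_diffE i x : res_diff i (res_next i) x = res_next_diff i x.
Proof. exact: idxE. Qed.
Lemma res_zero i (x : res_ob i) : 0 < i -> x = 0.
Proof. by case: i x => [[|k]|k] //= x _; exact: thinmx0. Qed.

Fact res_diffK (i j k : int) : j = i + 1 -> k = j + 1 ->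
  forall x, res_diff j k (res_diff i j x) = 0.
Proof.
rewrite -!res_nextE => -> -> x; rewrite !res_diffE.
case: i x => [k'|[|[|k']]] x //=.
- exact: (proj2 (@dkP 0%N _) (ex_intro _ x erefl)).
- exact: (proj2 (@dkP k'.+1 _) (ex_intro _ x erefl)).
Qed.

Lemma res_exact i : i < 0 -> exact_at res_diff i.
Proof.
move=> i0 h k; rewrite -!res_nextE => ih ->; subst i => x; rewrite res_diffE.
case: h i0 x => [//|[//|k']] _ /= x dx.
have [y <-] : exists y, dk k'.+1 y = x by apply/(@dkP k'); case: k' x dx.
by exists y; exact: (@res_diffE (Negz k'.+1) y).
Qed.

Fact res_bounded : exists b : nat, forall i : int, (b < `|i|)%N -> exact_at res_diff i.
Proof.
exists 0%N => i i0; have [lt|ge] := ltP i 0; first exact: res_exact.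
move=> h k _ _ x _; exists 0; rewrite linear0; apply/esym/res_zero; lia.
Qed.

Definition res_complex : Db A := MkDb res_diffK res_bounded.
End ResolutionComplex.

Section Resolution.
Variables (A : pzRingType) (hA : artin_algebra A).

(** Injectivity is applied to the inclusion of the image of [delta] in [Q]; the hypothesis on
    kernels makes [g] well defined on this image. *)
Lemma injective_extend (I : lmodType A) : injective_module I ->
  forall (P Q : lmodType A) (delta : {linear P -> Q}) (g : {linear P -> I}),
  (forall x, delta x = 0 -> g x = 0) -> exists h : {linear Q -> I}, forall x, g x = h (delta x).
Proof.
move=> injI P Q delta g hg.
pose S q := exists x, delta x = q.
have sS : submod S.
  split.
  - by exists 0; rewrite linear0.
  - by move=> _ _ [x <-] [y <-]; exists (x + y); rewrite linearD.
  - by move=> _ [x <-]; exists (- x); rewrite linearN.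
  - by move=> a _ _ [x <-]; exists (a *: x); rewrite linearZ.
pose U : lmodType A := submod_type sS.
have pre (u : U) : exists x, delta x = val u.
  have : S (val u) by apply/(submod_predP sS); exact: submod_valP.
  by [].
pose f (u : U) : I := g (sval (cid (pre u))).
have fE (u : U) x : delta x = val u -> f u = g x.
  move=> e; rewrite /f; case: (cid _) => y /= ey.
  by apply/eqP; rewrite -subr_eq0 -linearB; apply/eqP/hg; rewrite linearB ey e subrr.
have f_lin : linear f.
  move=> a u v; have [x ex] := pre u; have [y ey] := pre v.
  rewrite (fE u x) // (fE v y) // -linearP; apply: fE.
  by rewrite linearP ex ey.
pose F := GRing.isLinear.Build A U I _ f f_lin.
pose f' : {linear U -> I} := HB.pack f F.
have [h hh] := injI U Q (val : {linear submod_type sS -> Q}) f' val_inj.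
exists h => x; have Sx : delta x \in submod_pred_of sS by apply/(submod_predP sS); exists x.
by rewrite -[delta x]/(val (SubmodType Sx)) hh; apply/esym/fE.
Qed.

(** Dimension shifting along the injective coresolution of [V], with [P] exact in negative degrees
    on the other side. *)
Lemma Ext_zero_injdim (V : lmodType A) (n : nat) (P : Db A) : injdim_le V n -> frees P ->
  (forall i, i < 0 -> exact_at (diff P) i) ->
  forall j : int, j < - n%:Z -> Ext_zero_in P j (fun _ : V => True).
Proof.
move=> [I [e [d [injI [I0 [inj_e [d0 dS]]]]]]] fP exP.
have ext k (j i j' : int) (g : {linear P j -> I k}) : j < 0 -> j = i + 1 -> j' = j + 1 ->
    (forall x, g (diff P i j x) = 0) ->
    exists h : {linear P j' -> I k}, forall x, g x = h (diff P j j' x).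
  move=> j0 ij jj' gd; apply: (injective_extend (injI k)) => x dx.
  by have [y <-] := exP j j0 i j' ij jj' x dx.
(* The statement for the [k]-th cosyzygy, the kernel of [d k], whose injective dimension is at most
   [q = n - k]. For [q = 0] the next injective term is zero, so every map has values in the
   kernel. *)
have key q : forall k (j i j' : int), (k + q = n)%N -> j < - q%:Z -> j = i + 1 -> j' = j + 1 ->
    forall g : {linear P j -> I k}, (forall x, d k (g x) = 0) ->
    (forall x, g (diff P i j x) = 0) ->
    exists h : {linear P j' -> I k}, (forall x, d k (h x) = 0) /\ forall x, g x = h (diff P j j' x).
  elim: q => [|q IH] k j i j' kq jq ij jj' g dg gd;
    (have [|h0 hh0] := ext k j i j' g _ ij jj' gd; first by lia).
  - exists h0; split=> // x; apply: I0; lia.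
  have [||||||h1 [dh1 e1]] := IH k.+1 j' j (j' + 1) _ _ _ _ (d k \o h0).
  - by lia.
  - by lia.
  - by lia.
  - by [].
  - by move=> x; apply/(dS k); exists (h0 x).
  - by move=> x /=; rewrite -hh0 dg.
  (* [h0] need not have values in the kernel of [d k]. The next cosyzygy gives [h1] with the same
     defect, and lifting [h1] through [d k] yields the correction. *)
  have [|t ht] := @free_lift _ _ (fP (j' + 1)) _ _ (d k) h1.
    by move=> x; have [y ey] := proj1 (dS k (h1 x)) (dh1 x); exists y.
  exists (h0 \- (t \o diff P j' (j' + 1))); split=> x /=.
    by rewrite linearB ht -e1 subrr.
  by rewrite -hh0 diffK // linear0 subr0.
move=> j jn g _ gd.
have [||||||h [dh eh]] := key n 0%N j (j - 1) (j + 1) _ _ _ _ (e \o g).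
- by rewrite add0n.
- by [].
- by lia.
- by [].
- by move=> x; apply/d0; exists (g x).
- by move=> x /=; rewrite gd linear0.
have [|h' hh'] := @free_lift _ _ (fP (j + 1)) _ _ e h.
  by move=> x; have [v ev] := proj1 (d0 (h x)) (dh x); exists v.
exists h'; split=> // x; apply: inj_e; rewrite hh' -eh.
by [].
Qed.

Lemma Ext_zero_free (P : Db A) (j : int) : Ext_zero_in P j (fun _ : (A^o : lmodType A) => True) ->
  forall F : fgmod A, isfree F -> Ext_zero_in P j (fun _ : F => True).
Proof.
move=> hA1 F; elim=> [|//|F1 F2 _ IH1 _ IH2] g _ dg.
  by exists \0; split=> // x; exact: thinmx0.
have [|h1 [_ e1]] := IH1 (fst \o g) (fun=> I); first by move=> x /=; rewrite dg.
have [|h2 [_ e2]] := IH2 (snd \o g) (fun=> I); first by move=> x /=; rewrite dg.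
exists (pair_map h1 h2); split=> // x.
by rewrite /= /pair_map -e1 -e2 /=; case: (g x).
Qed.

(** Source, target and map are bundled so that the whole resolution is an iteration of [syzygy]; the
    target of [syzygy s] is by computation the source of [s]. *)
Record presentation := Presentation {
  psrc : fgmod A; ptgt : fgmod A; pfree : isfree psrc; pmap : {linear psrc -> ptgt} }.

Let ker_cover (s : presentation) : exists t : fgmod A, isfree t /\
  exists rho : {linear t -> psrc s}, forall v, pmap s v = 0 <-> exists x, rho x = v.
Proof. exact: (submod_fg hA (fgP _) (submod_ker (pmap s))). Qed.

Definition syzygy (s : presentation) : presentation :=
  let c := cid (ker_cover s) in
  Presentation (proj1 (svalP c)) (sval (cid (proj2 (svalP c)))).

Lemma syzygyP s : forall v : psrc s, pmap s v = 0 <-> exists x, pmap (syzygy s) x = v.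
Proof. by rewrite /syzygy /=; case: (cid (proj2 _)). Qed.

Lemma free_resolution (V : fgmod A) : exists (P : Db A) (pi : {linear tot P -> tot (stalk V)}),
  [/\ frees P, bdd 0 P, forall i, i < 0 -> exact_at (diff P) i & resol pi].
Proof.
have [F [fF [rho hrho]]] := submod_fg hA (fgP V) (submod_True V).
pose s0 := Presentation fF rho; pose st k := iter k syzygy s0.
pose dk k : {linear psrc (st k.+1) -> psrc (st k)} := pmap (st k.+1).
have dkP k v : dk k v = 0 <-> exists x, dk k.+1 x = v by exact: (@syzygyP (st k.+1) v).
pose P := res_complex dkP.
have fP : frees P.
  by case=> [[|k]|k]; [exact: fF|exact: isfree0|exact: (pfree (st k.+1))].
have bP : bdd 0 P by move=> i i0 x; exact: res_zero.
pose s : gmap P (stalk V) := bump (X := P) (Y := stalk V) (i0 := 0) (j0 := 0) rho.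
have cs : chmap 0 s.
  move=> i i' j j' ii' ij jj' x; rewrite /= scaler0.
  have [e|ne] := pselect (i' = 0); last by rewrite /s bump_ne.
  have ei : i = -1 by lia.
  have ej : j' = 0 by lia.
  clear ii' ij jj'; subst i i' j'; rewrite /s bumpE.
  have /syzygyP /= e : exists y, pmap (syzygy s0) y = res_next_diff dk (-1) x by exists x.
  by rewrite -[RHS]e; congr (rho _); exact: (res_diffE dk x).
have qs : quasi_iso s.
  split=> // h i j ih ji; split.
    have [lt|ge] := ltP i 0; first by move=> x dx _; have [y <-] := res_exact dkP lt ih ji dx; exists y.
    have [gt|le] := ltP 0 i; first by move=> x _ _; exists 0; rewrite linear0; exact: res_zero.
    have ei : i = 0 by lia.
    have eh : h = -1 by lia.
    clear ih ji; subst i h => x _ [y]; rewrite /s bumpE => e.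
    have [z <-] := proj1 (@syzygyP s0 x) e.
    by exists z; exact/esym/(res_diffE dk (i := -1) z).
  have [e|ne] := pselect (i = 0); last first.
    by move=> y _; exists 0, 0; rewrite !linear0 [y]stalk_zero // addr0.
  clear ih; subst i => y _; have [x ex] := proj1 (hrho y) I.
  exists x, 0; rewrite linear0 addr0 /s bumpE ex; split=> //.
  by apply: res_zero; rewrite ji.
exists P, (tmap 0 s); split=> //; first exact: (res_exact dkP).
have [_ q] := proj1 (quasi_isoP _) qs.
by split=> //; [exact: frees_kproj fP bP|exact/chmap_cyc].
Qed.

End Resolution.

(** * Vanishing along the Koszul tower *)

Section Finish.
Variables (A : pzRingType) (hA : artin_algebra A).

Lemma Ext_zero_inE (P : Db A) (j : int) (V : lmodType A) (S : V -> Prop) : Ext_zero_in P j S ->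
  forall i k : int, j = i + 1 -> k = j + 1 -> forall g : {linear P j -> V}, (forall x, S (g x)) ->
    (forall x, g (diff P i j x) = 0) ->
  exists h : {linear P k -> V}, (forall x, S (h x)) /\ forall x, g x = h (diff P j k x).
Proof. by move=> v i k ij ->; have -> : i = j - 1 by [lia]; exact: v. Qed.

(** With a finite free cover [F] of [S], vanishing at [j] for [S] follows from vanishing at [j] for
    [F] and at [j - 1] for the kernel of the cover. Induction climbs from [j0] towards [s]. *)
Lemma Ext_zero_in_below (P : Db A) (j0 s : int) : frees P ->
  (forall j, j <= j0 -> forall (V : lmodType A) (S : V -> Prop), fingen V -> submod S -> Ext_zero_in P j S) ->
  (forall j, j < s -> Ext_zero_in P j (fun _ : (A^o : lmodType A) => True)) ->
  forall j, j < s -> forall (V : lmodType A) (S : V -> Prop), fingen V -> submod S -> Ext_zero_in P j S.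
Proof.
move=> fP low vA.
have main (m : nat) : forall j, j <= j0 + m%:Z -> j < s ->
    forall (V : lmodType A) (S : V -> Prop), fingen V -> submod S -> Ext_zero_in P j S.
  elim: m => [|m IH] j jm js V S fV sS; first by apply: low => //; move: jm; rewrite addr0.
  have [F [fF [rho hr]]] := submod_fg hA fV sS.
  move=> g gS dg.
  have [|g1 hg1] := @free_lift _ _ (fP j) _ _ rho g; first by move=> x; apply/hr.
  have v1 : Ext_zero_in P (j - 1) (fun x : F => rho x = 0).
    by apply: IH; [lia|lia|exact: fgP|exact: submod_ker].
  have [||||h [hr0 eh]] := Ext_zero_inE v1 (i := j - 2) (k := j) _ _ (g := g1 \o diff P (j - 1) j).
  - by lia.
  - by lia.
  - by move=> x; rewrite /= hg1 dg.
  - by move=> x /=; rewrite diffK ?linear0 //; lia.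
  have [||k [_ ek]] := Ext_zero_free (vA j js) fF (g := g1 \- h) => //.
    by move=> x /=; rewrite -eh subrr.
  exists (rho \o k); split=> x; first by apply/hr; exists (k x).
  by rewrite /= -ek /= linearB hg1 hr0 subr0.
move=> j js V S fV sS; apply: (main `|j - j0|%N) => //; lia.
Qed.

(* In low degrees the boundaries are direct summands, so the complex is contractible there. *)
Lemma low_contraction (P : Db A) (j0 : int) : frees P ->
  (forall j, j <= j0 -> forall (V : lmodType A) (S : V -> Prop), fingen V -> submod S -> Ext_zero_in P j S) ->
  exists (q0 : int) (s : {linear tot P -> tot P}), hg (-1) s /\
    forall x j, j <= q0 -> (dif P (s x) + s (dif P x)) j = x j.
Proof.
move=> fP low; have [b hb] := bounded P.
have sig (k : int) : exists sg : {linear P (k + 1) -> P k}, k <= j0 ->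
    forall x, diff P k (k + 1) (sg (diff P k (k + 1) x)) = diff P k (k + 1) x.
  have [kj|nk] := boolP (k <= j0); last by exists \0.
  pose S (y : P (k + 1)) := exists x, diff P k (k + 1) x = y.
  have sS : submod S.
    split.
    - by exists 0; rewrite linear0.
    - by move=> _ _ [x <-] [y <-]; exists (x + y); rewrite linearD.
    - by move=> _ [x <-]; exists (- x); rewrite linearN.
    - by move=> a _ _ [x <-]; exists (a *: x); rewrite linearZ.
  (* The differential is a cocycle with values in its own image [S]; that it is a coboundary means
     that [r] retracts onto the boundaries. *)
  have [||r [rS er]] := low k kj _ S (fgP _) sS (diff P k (k + 1)).
  - by move=> x; exists x.
  - by move=> x; rewrite diffK //; lia.
  have [|sg hsg] := @free_lift _ _ (fP (k + 1)) _ _ (diff P k (k + 1)) r.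
    by move=> x; exact: rS.
  by exists sg => _ x; rewrite hsg -er.
pose sg k := sval (cid (sig k)).
have sgP k x : k <= j0 -> diff P k (k + 1) (sg k (diff P k (k + 1) x)) = diff P k (k + 1) x.
  by rewrite /sg; case: (cid _) => f /= hf /hf.
pose Sg : {linear tot P -> tot P} := tmap (-1) (fun i j => sg j \o idx (ob P) i (j + 1)).
have SgE x k : Sg x k = sg k (x (k + 1)).
  rewrite /Sg (@tmapE _ _ _ _ _ _ (k + 1)) /= ?idxE //; lia.
have SgP x m : m <= j0 + 1 -> dif P (Sg (dif P x)) m = dif P x m.
  move=> hm; have := sgP (m - 1) (x (m - 1)); rewrite -[diff P _ _ (x _)](difE (X := P) x) //.
  rewrite -SgE -[diff P _ _ (Sg _ _)](difE (X := P) (Sg (dif P x))) // subrK; apply; lia.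
have hSg : hg (-1) Sg by exact: hg_tmap.
(* In these degrees [1 - Sg d] takes values in cycles, cycles are boundaries by the bound [b] on the
   cohomology, and [d Sg] fixes boundaries. *)
exists (Num.min j0 (- b%:Z - 1)), (Sg \o (idfun \- (Sg \o dif P))).
split.
  apply: (@hg_comp _ 0 (-1)) => //; apply: hgB; first exact: hg_id.
  by apply: (@hg_comp _ 1 (-1)) => //; exact: hg_dif.
move=> x j hj; rewrite /= dif2 linear0 subr0.
set y := x - Sg (dif P x).
have dy : diff P j (j + 1) (y j) = 0.
  rewrite -(@difE _ _ _ j) // /y linearB totalE totalNE SgP ?subrr //; lia.
have [|||z ez] := hb j _ (j - 1) (j + 1) _ _ (y j) dy; try lia.
have yz : (y - dif P (single (ob P) (j - 1) z)) j = 0.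
  by rewrite (@dif_single _ _ _ j) ?subrK // totalE totalNE singleE ez subrr.
have hDS : hg 0 (dif P \o Sg) by apply: (@hg_comp _ (-1) 1) => //; exact: hg_dif.
have e1 : dif P (Sg y) j = y j.
  have := hDS (y - dif P (single (ob P) (j - 1) z)) j; rewrite subr0 => /(_ yz) /=.
  rewrite !linearB totalE totalNE SgP; last by lia.
  move/eqP; rewrite subr_eq0 => /eqP ->.
  by move/eqP: yz; rewrite totalE totalNE subr_eq0 => /eqP ->.
by rewrite totalE e1 /y totalE totalNE subrK.
Qed.

(** The contraction [s] first removes, up to homotopy, all components of [F] in degrees at most
    [q0]. The finitely many degrees from [q0 + 1] to [top] are then cleared in ascending order, each
    by the vanishing of Ext with values in [P q]. *)
Lemma Hom_zero_perfect (Z P : Db A) (top i : int) (j0 : int) : frees P -> bdd top P ->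
  (forall j, j <= j0 -> forall (V : lmodType A) (S : V -> Prop), fingen V -> submod S -> Ext_zero_in P j S) ->
  (forall q, q <= top -> Ext_zero_in Z (q - i) (fun _ : P q => True)) ->
  Hom_zero Z i P.
Proof.
move=> fP bP low ext; have [q0 [s [hs es]]] := low_contraction fP low.
(* [F] vanishes below [q], so its component in degree [q] is a cocycle of [Z] with values in [P q];
   the homotopy [H] removes it and disturbs only degree [q + 1]. *)
have asc (m : nat) : forall q, top - m%:Z < q -> forall F : {linear tot Z -> tot P}, cyc i F ->
    (forall x j, j < q -> F x j = 0) -> htp i F \0.
  elim: m => [|m IH] q hq F cF F0.
    apply: eq1_htp => x; apply: funext_dep => j; rewrite /= total0E.
    by have [lt|ge] := ltP j q; [exact: F0|apply: bP; lia].
  have [gt|le] := ltP top q.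
    apply: eq1_htp => x; apply: funext_dep => j; rewrite /= total0E.
    by have [lt|ge] := ltP j q; [exact: F0|apply: bP; lia].
  have [||h [_ eh]] := ext q le (ent F (q - i) q) => //.
    move=> x; rewrite entE -(@dif_single _ _ (q - i - 1)) ?subrK // cF.2 totalE.
    by rewrite (@difE _ _ _ (q - 1)) ?subrK // F0 ?linear0 ?scaler0 //; lia.
  pose H : {linear tot Z -> tot P} := tmap (i - 1) (bump (X := Z) (Y := P) (i0 := q - i + 1) (j0 := q) h).
  have H0 y j : j <> q -> H y j = 0.
    move=> ne; rewrite /H (@tmapE _ _ _ _ _ _ (j - i + 1)); last by lia.
    by rewrite bump_ne2.
  have Hq y : H y q = h (y (q - i + 1)).
    by rewrite /H (@tmapE _ _ _ _ _ _ (q - i + 1)) ?bumpE //; lia.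
  have [F1 F1E] : exists F1 : {linear tot Z -> tot P}, forall x,
      F1 x = F x - (sgn i *: dif P (H x) + H (dif Z x)).
    exists (F \- ((sgn_map i (dif P \o H)) \+ (H \o dif Z))) => x.
    by rewrite /= sgn_mapE.
  have FF1 : htp i F F1.
    exists (sgn_map i H); split=> [|x]; first by apply: hg_sgn; exact: hg_tmap.
    by rewrite F1E /= !sgn_mapE [dif _ (_ *: _)]linearZ /= sgnM; zmod.
  apply: (htp_trans FF1); apply: (IH (q + 1)); first by lia.
    exact: cyc_htp FF1 cF.
  move=> x j hj; rewrite F1E !totalE (@difE _ _ _ (j - 1)) ?subrK // (H0 x (j - 1)); last by lia.
  rewrite linear0 scaler0 add0r.
  have [e|ne] := pselect (j = q); last by rewrite F0 ?H0 ?subrr //; lia.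
  subst j; rewrite Hq (@difE _ _ _ (q - i)) // -eh.
  by rewrite -(@tmapE _ i _ _ (ent F) x (q - i) q) ?subrK // tmap_ent ?subrr //; exact: cF.1.
move=> F cF.
have [F1 F1E] : exists F1 : {linear tot Z -> tot P}, forall x,
    F1 x = F x - (dif P (s (F x)) + s (dif P (F x))).
  by exists (F \- ((dif P \o (s \o F)) \+ (s \o (dif P \o F)))).
have FF1 : htp i F F1.
  exists (s \o F); split=> [|x]; first by apply: (@hg_comp _ i (-1)) => //; exact: cF.1.
  by rewrite F1E /= cF.2 linearZ /= sgnM; zmod.
apply: (htp_trans FF1); apply: (asc `|top - q0|%N (q0 + 1)); first by lia.
  exact: cyc_htp FF1 cF.
move=> x j hj; rewrite F1E totalE totalNE es ?subrr //; lia.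
Qed.

(** Composition with [pi] is injective and surjective on homotopy classes of maps out of the
    K-projective [Z], by uniqueness and existence of lifts. *)
Lemma Hom_zero_resol (Z P Y : Db A) (pi : {linear tot P -> tot Y}) i :
  kproj Z -> resol pi -> Hom_zero Z i P <-> Hom_zero Z i Y.
Proof.
move=> kZ rpi; have [_ cpi _] := rpi; have qpi := pi_qiso rpi.
have piE : tmap 0 (ent pi) =1 pi by apply: tmap_ent; exact: cpi.1.
split=> h F cF.
  have [F' [cF' hF']] := kproj_lift kZ qpi cF.
  apply: htp_trans (htp_sym hF') _.
  apply: (@eq_htp _ _ _ _ (pi \o F') _ (pi \o \0)) => [x|x|]; first by rewrite /= piE.
    by rewrite /= linear0.
  by apply: (htp_compl _ cpi (h _ cF')); rewrite addr0.
apply: (kproj_uniq kZ qpi cF (cyc0 _ _ _)).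
have hp : htp i (pi \o F) \0 by apply: h; apply: (cyc_comp _ cF cpi); rewrite addr0.
by apply: eq_htp hp => x /=; rewrite ?piE ?linear0.
Qed.

End Finish.

(** * Propagation of zeros along a tower of triangles *)

Fixpoint tower (l : seq nat) (E Ec : int -> Prop) : Prop :=
  if l is a :: l' then exists E', tri a%:Z E E' /\ tower l' E' Ec
  else forall i, E i <-> Ec i.

(** Passing to the cone moves the start of the window by [a] and its end by 1, and moves the bound
    [s] by [a]. At least [a] zeros are available for [E], as the other entries of the list are
    positive; they spread in both directions in steps of [a]. *)
Lemma tower_above (l : seq nat) : all (fun a => 0 < a)%N l -> forall E Ec (s n : int),
  tower l E Ec -> (forall i, s + (sumn l)%:Z < i -> Ec i) -> s < n ->
  (forall i, n <= i <= n + (sumn l)%:Z - (size l)%:Z -> E i) -> forall i, s < i -> E i.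
Proof.
elim: l => [|a l IH] /= => [_|/andP[a0 al]] E Ec s n.
  by move=> t hc _ _ i si; apply/t/hc; rewrite addr0.
move=> [E' [[t1 t2 t3] t]] hc sn win.
have szl : (size l <= sumn l)%N.
  by elim: l al {IH t hc win} => //= b l IHl /andP[b0 /IHl]; lia.
have hE' : forall i, s + a%:Z < i -> E' i.
  apply: (IH al E' Ec _ (n + a%:Z) t) => [i hi|//|i hi].
  - by apply: hc; rewrite PoszD addrA.
  - by rewrite ltrD2r.
  - by apply: t1; apply: win; lia.
have up (k : nat) : E (n + k%:Z).
  elim/ltn_ind: k => k IHk; have [lt|ge] := ltnP k a.
    by apply: win; lia.
  apply: t3; last by apply: hE'; lia.
  have -> : n + k%:Z - a%:Z = n + (k - a)%N%:Z by lia.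
  by apply: IHk; lia.
have down (k : nat) : s < n - k%:Z -> E (n - k%:Z).
  elim/ltn_ind: k => k IHk hk.
  have -> : n - k%:Z = (n - k%:Z + a%:Z) - a%:Z by lia.
  apply: t2; first by apply: hE'; lia.
  have [lt|ge] := ltnP k a.
    have -> : n - k%:Z + a%:Z = n + (a - k)%N%:Z by lia.
    exact: up.
  have -> : n - k%:Z + a%:Z = n - (k - a)%N%:Z by lia.
  by apply: IHk; lia.
move=> i si; have [lt|ge] := ltP i n.
  have e : i = n - `|n - i|%N%:Z by lia.
  by rewrite e; apply: down; rewrite -e.
have -> : i = n + `|i - n|%N%:Z by lia.
exact: up.
Qed.

(** Here the range lies below [s], and the bound moves by only 1 per cone: [t3] uses [E'] in degree
    [i + 1], and [t2] in degree [i], to conclude for degrees below [s]. *)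
Lemma tower_below (l : seq nat) : all (fun a => 0 < a)%N l -> forall E Ec (s n : int),
  tower l E Ec -> (forall i, i < s + (size l)%:Z -> Ec i) ->
  n + (sumn l)%:Z - (size l)%:Z < s ->
  (forall i, n <= i <= n + (sumn l)%:Z - (size l)%:Z -> E i) -> forall i, i < s -> E i.
Proof.
elim: l => [|a l IH] /= => [_|/andP[a0 al]] E Ec s n.
  by move=> t hc _ _ i si; apply/t/hc; rewrite addr0.
move=> [E' [[t1 t2 t3] t]] hc sn win.
have szl : (size l <= sumn l)%N.
  by elim: l al {IH t hc sn win} => //= b l IHl /andP[b0 /IHl]; lia.
have hE' : forall i, i < s + 1 -> E' i.
  apply: (IH al E' Ec _ (n + a%:Z) t) => [i hi||i hi].
  - by apply: hc; lia.
  - by lia.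
  - by apply: t1; apply: win; lia.
have up (k : nat) : n + k%:Z < s -> E (n + k%:Z).
  elim/ltn_ind: k => k IHk hk; have [lt|ge] := ltnP k a.
    by apply: win; lia.
  apply: t3; last by apply: hE'; lia.
  have e : n + k%:Z - a%:Z = n + (k - a)%N%:Z by lia.
  by rewrite e; apply: IHk; lia.
have down (k : nat) : E (n - k%:Z).
  elim/ltn_ind: k => k IHk.
  (* For [k = 0] the zero is taken from the window, since [n + a] may exceed the range in which [E']
     is known to vanish. *)
  have [k0|k_gt0] := posnP k; first by rewrite k0 subr0 -[n]addr0; apply: (up 0%N); lia.
  have -> : n - k%:Z = (n - k%:Z + a%:Z) - a%:Z by lia.
  apply: t2; first by apply: hE'; lia.
  have [lt|ge] := ltnP k a.
    have -> : n - k%:Z + a%:Z = n + (a - k)%N%:Z by lia.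
    by apply: up; lia.
  have -> : n - k%:Z + a%:Z = n - (k - a)%N%:Z by lia.
  by apply: IHk; lia.
move=> i si; have [lt|ge] := ltP i n.
  have -> : i = n - `|n - i|%N%:Z by lia.
  exact: down.
have e : i = n + `|i - n|%N%:Z by lia.
by rewrite e; apply: up; rewrite -e.
Qed.

Section Tower.
Variables (A : pzRingType) (R : gcring) (phi : central_action R A) (T : Db A).

Lemma frees_cone n (P : Db A) (b : gmap P P) (hb : chmap n b) : frees P -> frees (cone hb).
Proof. by move=> fP i; apply: isfree_prod; exact: fP. Qed.

(** Both summands of the cone are shifted down by at least 1 because [n] is positive. This is the
    origin of the [- c] in the bound on the degrees of the last resolution. *)
Lemma bdd_cone n t (P : Db A) (b : gmap P P) (hb : chmap n b) : 0 < n -> bdd t P ->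
  bdd (t - 1) (cone hb).
Proof. by move=> n0 bP i it [x y]; congr pair; apply: bP; lia. Qed.

(** One induction carries everything about the iterated cones. [B] will be the stalk of the algebra,
    where the vanishing bound rises by the degree of [r] at every step; [Y] and [Z] are left
    arbitrary for the two halves of the theorem. *)
Lemma koszul_tower (B : Db A) (rs : seq (nat * R)) : forall (X P : Db A) (pi : {linear tot P -> tot X})
    (t s : int),
  (forall r : nat * R, r \in rs -> (0 < r.1)%N /\ homog r.1 r.2) ->
  resol pi -> frees P -> bdd t P -> gnoeth phi T P -> (forall i, s < i -> Hom_zero P i B) ->
  exists (Pc : Db A) (pc : {linear tot Pc -> tot (foldl (koszul phi) X rs)}),
    [/\ resol pc, frees Pc, bdd (t - (size rs)%:Z) Pc, gnoeth phi T Pc &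
      [/\ forall i, s + (sumn (map fst rs))%:Z < i -> Hom_zero Pc i B,
          forall Y, tower (map fst rs) (fun i => Hom_zero P i Y) (fun i => Hom_zero Pc i Y) &
          forall Z, tower (map fst rs) (fun i => Hom_zero Z (- i) P) (fun i => Hom_zero Z (- i) Pc)]].
Proof.
elim: rs => [|[m r] rs IH] X P pi t s hrs rpi fP bP gP hB.
  exists P, pi; split=> //=; rewrite ?subr0 //; split=> //= i; by rewrite addr0; exact: hB.
have [/= m0 hr] := hrs (m, r) (mem_head _ _).
have kQ (b : gmap P P) (hb : chmap m%:Z b) : kproj (cone hb).
  by apply: (@frees_kproj _ _ (t - 1)); [exact: frees_cone|apply: bdd_cone].
have [b [hb [rho rrho]]] := koszul_resol phi r rpi fP kQ.
have [kP _ _] := rpi.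
have [|||||Pc [pc [h1 h2 h3 h4 [h5 h6 h7]]]] := IH _ _ rho (t - 1) (s + m%:Z) _ rrho.
- by move=> r' hr'; apply: hrs; rewrite inE hr' orbT.
- exact: frees_cone.
- exact: bdd_cone.
- exact: gnoeth_cone kP (kQ _ hb) gP.
- by move=> i si; have [t1 _ _] := tri_contra hb B; apply: t1; apply: hB; lia.
exists Pc, pc; split=> //.
  by have -> : t - (size rs).+1%:Z = t - 1 - (size rs)%:Z by lia.
split=> [i|Y|Z] /=.
- by rewrite PoszD addrA; exact: h5.
- by exists (fun i => Hom_zero (cone hb) i Y); split; [exact: tri_contra|exact: h6].
- by exists (fun i => Hom_zero Z (- i) (cone hb)); split; [exact: tri_co|exact: h7].
Qed.

End Tower.

Theorem theorem3p5
    (A : pzRingType) (hA : artin_algebra A) (hG : gorenstein A)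
    (d : nat) (hd : is_injdim (A^o : lmodType A) d)
    (K : fgmod A) (p : {linear A^o -> K}) (hK : is_mod_jacobson p)
    (M : fgmod A) (hM : maximal_CM M)
    (R : gcring) (phi : central_action R A)
    (hR : ev_noetherian_fin_length phi (stalk M) (stalk K))
    (c : nat) (hc : is_complexity M c)
    (rs : seq (nat * R)) (hsz : size rs = c)
    (hrs : reduces_complexity phi rs (stalk M))
    (N : fgmod A) :
  let w := (\sum_(r <- rs) r.1 - c)%N in
  ((exists n : nat, (d < n)%N /\
      forall i : nat, (n <= i <= n + w)%N -> Ext_vanishes i M N) <->
   (forall i : nat, (d < i)%N -> Ext_vanishes i M N)) /\
  ((exists n : nat, (d < n)%N /\
      forall i : nat, (n <= i <= n + w)%N -> Ext_vanishes i N M) <->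
   (forall i : nat, (d < i)%N -> Ext_vanishes i N M)).
Proof.
move=> w; have [hom cxM cxk] := hrs.
have [PM [piM [fPM bPM _ rPM]]] := free_resolution hA M.
have [PN [piN [fPN bPN exPN rPN]]] := free_resolution hA N.
have [kPM _ _] := rPM; have [kPN _ _] := rPN.
have extM Y (i : nat) : Ext_vanishes i M Y <-> Hom_zero PM i (stalk Y) := Hom_zeroP rPM i%:Z (stalk Y).
have extN Y (i : nat) : Ext_vanishes i N Y <-> Hom_zero PN i (stalk Y) := Hom_zeroP rPN i%:Z (stalk Y).
have hBM (i : int) : 0 < i -> Hom_zero PM i (stalk (fgregular A)).
  by case: i => // i i0; apply/extM; exact: hM.
have [Pc [pc [rpc fPc bPc gPc [hBc towM towN]]]] :=
  koszul_tower hom rPM fPM bPM (gnoeth_of rPM hR) hBM.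
(* The reduction hypothesis starts at index 1, so for the empty sequence the complexity of [M]
   itself is used. *)
have cx0 : is_cx phi (foldl (koszul phi) (stalk M) rs) 0.
  have [rs0|rs_gt0] := posnP (size rs).
    by move: rs0 cxM => /size0nil ->.
  by have := cxk (size rs); rewrite rs_gt0 leqnn take_size subnn; apply.
have [B hB] := gnoeth_vanish rpc (is_cx0 rpc cx0) gPc.
have low j : j <= - B%:Z -> forall (V : lmodType A) (S : V -> Prop),
    fingen V -> submod S -> Ext_zero_in Pc j S.
  move=> jB; apply: (Ext_zero_in_fg hA hK fPc).
  have -> : j = - (`|j|%N%:Z) by lia.
  by apply/Hom_zero_stalk/hB; lia.
set l := map fst rs in hBc towM towN.
have l_gt0 : all (fun a => 0 < a)%N l.
  by apply/allP => a /mapP[r /hom[r0 _] ->].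
have el : sumn l = (\sum_(r <- rs) r.1)%N by rewrite sumnE big_map.
have sl : size l = c by rewrite size_map.
have lw : (sumn l)%:Z - (size l)%:Z = w%:Z.
  suff : (size l <= sumn l)%N by rewrite /w -el sl; lia.
  by elim: l l_gt0 {hBc towM towN el sl} => //= a l IHl /andP[a0 /IHl]; lia.
(* Vanishing in high degrees is pulled down to the bound [sumn l], where [A] as coefficients is
   controlled because [M] is maximal Cohen-Macaulay. *)
have hcM (i : int) : 0 + (sumn l)%:Z < i -> Hom_zero Pc i (stalk N).
  move=> hi; apply/Hom_zero_stalk; apply: (Ext_zero_in_below hA fPc low (s := - (sumn l)%:Z)) => //.
  - move=> j hj; have -> : j = - (- j) by lia.
    by apply/(Hom_zero_stalk (fgregular A)); apply: hBc; lia.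
  - by lia.
  - exact: fgP.
have injA : injdim_le (A^o : lmodType A) d by case: hd.
(* The terms of [Pc] are free and sit in degrees [q <= - c], so the Ext groups of [N] concerned have
   degree [i - q > d]. *)
have hcN (i : int) : d%:Z - c%:Z < i -> Hom_zero PN i Pc.
  move=> hi; apply: (Hom_zero_perfect (top := 0 - (size rs)%:Z) fPc bPc low) => q hq.
  by apply: Ext_zero_free (fPc q); apply: (Ext_zero_injdim injA fPN exPN); lia.
split; split.
- move=> [n [dn win]] i di; apply/extM.
  (* The bound is 0 here: the zeros spread to all positive degrees, in particular to those above
     [d]. *)
  apply: (tower_above l_gt0 (towM (stalk N)) hcM (n := n%:Z)); [lia| |lia].
  move=> j hj; have ej : j = `|j|%N%:Z by lia.
  by rewrite ej; apply/extM/win; lia.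
- by move=> h; exists d.+1; split=> // i /andP[di _]; exact: h.
- move=> [n [dn win]] i di; apply/extN/(Hom_zero_resol i%:Z kPN rPM).
  have hi : - i%:Z < - d%:Z by lia.
  rewrite -[i%:Z]opprK.
  (* In negated degrees the window from [n] to [n + w] becomes the one from [- n - w] to [- n],
     which ends below [- d]. *)
  apply: (tower_below l_gt0 (towN PN) (s := - d%:Z) (n := - n%:Z - w%:Z)) hi.
  + by move=> j hj; apply: hcN; lia.
  + by lia.
  + move=> j hj; have ej : - j = `|j|%N%:Z by lia.
    by rewrite ej; apply/(Hom_zero_resol _ kPN rPM)/extN/win; lia.
- by move=> h; exists d.+1; split=> // i /andP[di _]; exact: h.
Qed.
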